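(* Let $V$ be a complex vector space of dimension $2n$ with a symplectic form $\omega$. If $X\subset\mathbb{P}(V)=\mathbb{P}^{2n-1}$ is an irreducible legendrian variety generated by quadrics, and $G<\mathbf{Sp}(V)$ is the connected group associated with the quadratic part of the ideal of $X$, then the smooth locus $X_0$ of $X$ is an orbit of the action of $G$ on $X$.
   Context: A linear subspace $W\subset V$ is Lagrangian if it is a maximal subspace with $\omega|_W\equiv 0$. For a projective variety $X\subset\mathbb{P}(V)$ let $\hat X\subset V$ be the affine cone and $\hat X_0$ the set of smooth points of $\hat X$ other than $0$. $X$ is legendrian if $T_x\hat X_0$ is Lagrangian in $V$ for every $x\in\hat X_0$. $X$ is generated by quadrics if its homogeneous ideal $\mathcal{I}(X)\subset\mathbb{C}[V]$ is generated by $\mathcal{I}_2:=\mathcal{I}(X)\cap \mathrm{Sym}^2V^*$. The group $G$: choose a basis of $V$ in which $\omega$ has matrix $J=\begin{pmatrix}0&\mathrm{Id}_n\\-\mathrm{Id}_n&0\end{pmatrix}$. The map $\rho:\mathrm{Sym}^2V^*\to\mathfrak{sp}(V)$ sending the quadratic polynomial $f(x)=x^TAx$ ($A$ symmetric) to $2JA$ is a linear isomorphism, independent of the choice of symplectic basis, and is an isomorphism of Lie algebras for the Poisson bracket $[f,g](x)=\omega'(\mathrm{d}f_x,\mathrm{d}g_x)$ on $\mathbb{C}[V]$, where $\omega'$ is the form on $V^*$ corresponding to $\omega$ under $V\simeq V^*$, $v\mapsto\omega(v,\cdot)$. For $X$ legendrian, $\mathcal{I}_2$ is a Lie subalgebra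 of $\mathrm{Sym}^2V^*$, and $G$ is the connected subgroup of the symplectic group $\mathbf{Sp}(V)$ with Lie algebra $\rho(\mathcal{I}_2)$. The action of $G$ on $\mathbb{P}(V)$ preserves $X$. *)

(* Defs.v *)
(* MathComp world: MathComp-Analysis for the topology of matrix spaces, real-closed
   for the complex numbers R[i], multinomials for C[V]. *)
From HB Require Import structures.
From mathcomp Require Import all_boot all_order all_algebra.
From mathcomp Require Export complex.
From mathcomp Require mpoly.
(* The notations of mpoly clash with those of MathComp-Analysis. *)
Import -(notations) mpoly.
From mathcomp Require Export all_classical all_reals all_analysis.

Set Implicit Arguments.
Unset Strict Implicit.
Unset Printing Implicit Defensive.

Import Order.TTheory GRing.Theory Num.Theory.
Import numFieldNormedType.Exports.
Local Open Scope classical_set_scope.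
Local Open Scope ring_scope.

Definition irreducible_in (T : Type) (isclosed : set (set T)) (Y : set T) : Prop :=
  [/\ isclosed Y, Y !=set0 &
      forall A B : set T, isclosed A -> isclosed B ->
        Y `<=` A `|` B -> Y `<=` A \/ Y `<=` B].

Section Affine.
Variables (K : numFieldType) (N : nat).
Local Notation V := 'cV[K]_N.
Implicit Types (Y Z : set V) (x v : V) (p : mpoly N K).

Definition peval p v : K := meval (fun i => v i 0) p.

Definition zariski_closed Y : Prop :=
  exists F : set (mpoly N K), Y = [set v | forall p, F p -> peval p v = 0].

Definition vanishing_ideal Y : set (mpoly N K) :=
  [set p | forall v, Y v -> peval p v = 0].

Definition differential p x v : K := \sum_(i < N) peval (mderiv i p) x * v i 0.

Definition tangent_space Y x : set V :=
  [set v | forall p, vanishing_ideal Y p -> differential p x v = 0].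

(* Algebraic independence of f_1, ..., f_k in the coordinate ring of Y. *)
Definition algebraically_independent Y (k : nat) (f : 'I_k -> mpoly N K) : Prop :=
  forall q : mpoly k K,
    (forall v, Y v -> meval (fun i => peval (f i) v) q = 0) -> q = 0.

(* The dimension of an irreducible variety is the transcendence degree of its
   function field, which is attained in the coordinate ring; the dimension of Y
   at x is the largest dimension of an irreducible closed subset of Y through x. *)
Definition local_dimension Y x (d : nat) : Prop :=
  let indep k := exists Z,
    [/\ irreducible_in zariski_closed Z, Z `<=` Y, Z x &
        exists f : 'I_k -> mpoly N K, algebraically_independent Z f] in
  indep d /\ forall k, indep k -> (k <= d)%N.

Definition smooth_at Y x : Prop :=
  Y x /\ exists W : {vspace V},
    [set` W] = tangent_space Y x /\ local_dimension Y x (\dim W).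

End Affine.

(* The points of P(V) are the one-dimensional linear subspaces of V. *)
Section Projective.
Variables (K : numFieldType) (N : nat).
Local Notation V := 'cV[K]_N.
Implicit Types (X : set {vspace V}) (L : {vspace V}).

Definition proj_closed X : Prop :=
  exists F : set (mpoly N K),
    (forall p, F p -> exists d : nat, p \is ishomog1 d (@mdeg N)) /\
    X = [set L | \dim L = 1%N /\
                 forall p, F p -> forall v, v \in L -> peval p v = 0].

Definition affine_cone X : set V :=
  [set v | v = 0 \/ exists2 L, X L & v \in L].

(* The ideal generated by the homogeneous polynomials vanishing on X is the
   ideal of all polynomials vanishing on the cone. *)
Definition homogeneous_ideal X : set (mpoly N K) :=
  vanishing_ideal (affine_cone X).

Definition quadratic_part X : set (mpoly N K) :=
  [set p | homogeneous_ideal X p /\ p \is ishomog1 2 (@mdeg N)].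

Definition generated_by_quadrics X : Prop :=
  forall p, homogeneous_ideal X p ->
    exists (k : nat) (a f : 'I_k -> mpoly N K),
      (forall i, quadratic_part X (f i)) /\ p = \sum_(i < k) a i * f i.

(* At [x], the projective tangent space is P(T_x (cone X)) and the dimension of X
   is one less than that of its cone: [x] is smooth on X when x is smooth on the
   cone. *)
Definition smooth_locus X : set {vspace V} :=
  [set L | X L /\ exists x, [/\ x \in L, x != 0 & smooth_at (affine_cone X) x]].

Definition proj_act (g : 'M[K]_N) L : {vspace V} := (linfun (mulmx g : V -> V) @: L)%VS.

Definition orbit_of (G : set 'M[K]_N) L : set {vspace V} :=
  [set proj_act g L | g in G].

End Projective.

Section Symplectic.
Variables (K : numFieldType) (N : nat).
Local Notation V := 'cV[K]_N.
Implicit Types (Om : 'M[K]_N) (W : {vspace V}) (X : set {vspace V}).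

(* The bilinear form on V with matrix Om. *)
Definition bilin Om (u v : V) : K := (u^T *m Om *m v) 0 0.

Definition symplectic_form Om : Prop :=
  (forall v, bilin Om v v = 0) /\
  (forall u, (forall v, bilin Om u v = 0) -> u = 0).

Definition symplectic_group Om : set 'M[K]_N :=
  [set g | forall u v : V, bilin Om (g *m u) (g *m v) = bilin Om u v].

Definition isotropic Om W : Prop :=
  forall u v, u \in W -> v \in W -> bilin Om u v = 0.

Definition lagrangian Om W : Prop :=
  isotropic Om W /\ forall W', isotropic Om W' -> (W <= W')%VS -> W' = W.

Definition legendrian Om X : Prop :=
  forall x, smooth_at (affine_cone X) x -> x != 0 ->
    exists W : {vspace V},
      [set` W] = tangent_space (affine_cone X) x /\ lagrangian Om W.

(* The quadratic polynomial x^T A x. *)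
Definition quadratic_poly (A : 'M[K]_N) : mpoly N K :=
  \sum_(i < N) \sum_(j < N) A i j *: (mpolyX K (mnm1 i) * mpolyX K (mnm1 j)).

End Symplectic.

Section Rho.
Variables (K : numFieldType) (n : nat).
Local Notation V := 'cV[K]_(n + n).
Implicit Types (Om S : 'M[K]_(n + n)) (X : set {vspace V}).

Definition Jmx : 'M[K]_(n + n) := block_mx 0 1%:M (- 1%:M) 0.

(* The columns of S form a basis of V in which the form has matrix J. *)
Definition symplectic_basis Om S : Prop := S \in unitmx /\ S^T *m Om *m S = Jmx.

(* The image of the quadratic part under rho. In the basis S a vector x has
   coordinates y = S^-1 x; the polynomial f = y^T A y is sent to the endomorphism
   whose matrix in the basis S is 2 J A. *)
Definition rho_quadratic_part S X : set 'M[K]_(n + n) :=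
  [set M | exists A : 'M[K]_(n + n),
     [/\ A^T = A,
         quadratic_part X (quadratic_poly ((invmx S)^T *m A *m invmx S)) &
         M = S *m (2%:R *: (Jmx *m A)) *m invmx S]].

End Rho.

Section LieSubgroup.
Variables (K : numFieldType) (N : nat).

Definition expmx (A : 'M[K]_N) : 'M[K]_N :=
  lim (series (fun k => (k`!%:R)^-1 *: A ^+ k) @ \oo).

(* A not necessarily closed (immersed) Lie subgroup of GL_N(K) with Lie algebra h:
   a topological group H (whose topology may be finer than that of its image)
   with an injective continuous homomorphism to GL_N(K), such that the matrix
   exponential lifts on a neighbourhood of 0 in h to a homeomorphism onto a
   neighbourhood of the unit of H. *)
Record lie_subgroup (h : set 'M[K]_N) := LieSubgroup {
  lie_carrier : topologicalType;
  lie_one : lie_carrier;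
  lie_mul : lie_carrier -> lie_carrier -> lie_carrier;
  lie_inv : lie_carrier -> lie_carrier;
  lie_val : lie_carrier -> 'M[K]_N;
  lie_val_inj : injective lie_val;
  lie_val1 : lie_val lie_one = 1%:M;
  lie_valM : forall x y, lie_val (lie_mul x y) = lie_val x *m lie_val y;
  lie_valV : forall x, lie_val (lie_inv x) *m lie_val x = 1%:M;
  lie_val_continuous : continuous lie_val;
  lie_mul_continuous :
    continuous (fun p : lie_carrier * lie_carrier => lie_mul p.1 p.2);
  lie_inv_continuous : continuous lie_inv;
  lie_dom : set 'M[K]_N;
  lie_dom_open : open lie_dom;
  lie_dom0 : lie_dom 0;
  lie_exp : 'M[K]_N -> lie_carrier;
  lie_expE : forall A, (lie_dom `&` h) A -> lie_val (lie_exp A) = expmx A;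
  lie_exp_inj : forall A B, (lie_dom `&` h) A -> (lie_dom `&` h) B ->
    lie_exp A = lie_exp B -> A = B;
  lie_exp_continuous : {within lie_dom `&` h, continuous lie_exp};
  lie_exp_open : forall O : set 'M[K]_N, open O ->
    open (lie_exp @` (O `&` (lie_dom `&` h)))
}.

Definition connected_lie_subgroup (h G : set 'M[K]_N) : Prop :=
  exists H : lie_subgroup h,
    connected [set: lie_carrier H] /\ G = range (@lie_val h H).

End LieSubgroup.

(* Main.v *)
From HB Require Import structures.
Require Import Defs.
From mathcomp Require Import all_boot all_order all_algebra.
From mathcomp Require Import complex closed_field.
From mathcomp Require mpoly.
Import -(notations) mpoly.
From mathcomp Require Import all_classical all_reals all_analysis.
From mathcomp Require Import ring zify.

Set Implicit Arguments.
Unset Strict Implicit.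
Unset Printing Implicit Defensive.

Import Order.TTheory GRing.Theory Num.Theory.
Import numFieldNormedType.Exports.
Local Open Scope classical_set_scope.
Local Open Scope ring_scope.
Local Open Scope complex_scope.

(** Write Y for the affine cone over X, I for its ideal and h for the Lie algebra
    of G. Since I is generated by quadrics, the tangent space of Y at a smooth
    point x is the common kernel of the differentials at x of the quadrics
    through X. The symplectic orthogonal of this kernel is h x, and a Lagrangian
    space is its own orthogonal, so the tangent space is h x
    (tangent_hamiltonian). Hence every orbit of G in the smooth locus is open in
    it, and what remains to be seen is that there is only one.

    The connectedness of the smooth locus in the classical topology is avoided:
    the orbit of each smooth point contains, up to scalars, a nonempty Zariski
    open subset of Y (orbit_contains_open), and two such subsets of an
    irreducible variety meet.

    To reach the orbit by polynomial maps, one first recognizes h as the algebra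
    of all infinitesimal symplectic symmetries of the space of quadrics
    (hamiltonianP). It follows that h contains, with an element M, every
    endomorphism obtained from the semisimple part of M by a change of the
    eigenvalues that respects their additive relations (hamiltonian_replica), so
    that h is spanned by nilpotent elements and by diagonalizable elements with
    integral eigenvalues (hamiltonian_decomp). The one-parameter groups of these
    elements are polynomial, up to scalars and a change of parameter. A suitable
    product of such curves, applied to x, is a polynomial map into the cone over
    the orbit whose differential is onto the tangent space. It is dominant by a
    count of dimensions (act_curves_dominant), and its image, which is
    constructible by quantifier elimination, contains an open set
    (act_curves_open).

    Smooth points exist and are dense because tangent spaces are never smaller
    than the transcendence degree (tangent_vspace) and generically not larger
    (generic_smooth). This and the dominance argument rest on one remark: in a
    polynomial relation, the part of lowest degree in some functions that vanish
    at a point gives a relation for their differentials at that point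
    (lowest_part).

    The group G enters through two facts: it contains the exponentials of h
    (exp_lie_group) and is generated by them (lie_group_ind). The Jordan form
    makes these exponentials explicit (expmx_jordan) and shows that they preserve
    the quadrics through X (expmx_preserves). *)

(** * Polynomials along curves *)

Section Substitution.
Variables (K : numFieldType) (n : nat).
Implicit Types (p q : mpoly n K).

Lemma mpoly_ring_ind (P : mpoly n K -> Prop) :
  (forall c, P (mpolyC n c)) -> (forall i, P (mpolyX K (mnm1 i))) ->
  (forall p q, P p -> P q -> P (p + q)) ->
  (forall p q, P p -> P q -> P (p * q)) -> forall p, P p.
Proof.
move=> PC PX PD PM p; rewrite (mpolyE p).
have P0 : P 0 by have := PC 0; rewrite mpolyC0.
have P1 : P 1 by have := PC 1; rewrite mpolyC1.
elim/big_rec: _ => // m q _ Pq; apply: (PD) => //.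
rewrite -mul_mpolyC; apply: (PM) => //; rewrite mpolyXE_id.
elim/big_rec: _ => // i r _ Pr; apply: (PM) => //.
by elim: (m i : nat) => [|k IH]; rewrite ?expr0 // exprS; apply: (PM).
Qed.

(** Restriction to polynomial curves reduces questions on several variables to
    polynomials in one variable. *)
Definition along (u : 'I_n -> {poly K}) p : {poly K} := mmap (@polyC K) u p.

Lemma alongC u c : along u (mpolyC n c) = c%:P.
Proof. exact: mmapC. Qed.
Lemma alongX u i : along u (mpolyX K (mnm1 i)) = u i.
Proof. by rewrite /along mmapX mmap1U. Qed.
Lemma alongD u p q : along u (p + q) = along u p + along u q.
Proof. exact: mmapD. Qed.
Lemma alongM u p q : along u (p * q) = along u p * along u q.
Proof. by rewrite /along rmorphM. Qed.

Lemma horner_along u p t : (along u p).[t] = meval (fun i => (u i).[t]) p.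
Proof.
elim/mpoly_ring_ind: p => [c|i|p q IHp IHq|p q IHp IHq].
- by rewrite alongC hornerC mevalC.
- by rewrite alongX mevalXU.
- by rewrite alongD hornerD mevalD IHp IHq.
- by rewrite alongM hornerM mevalM IHp IHq.
Qed.

Lemma deriv_along u p :
  (along u p)^`() = \sum_i along u (mderiv i p) * (u i)^`().
Proof.
elim/mpoly_ring_ind: p => [c|i|p q IHp IHq|p q IHp IHq].
- rewrite alongC derivC big1 // => i _.
  by rewrite mderivC /along mmap0 mul0r.
- rewrite alongX (bigD1 i) //= big1 => [|j ji].
    rewrite mderivX mnm1E eqxx scale1r (_ : mnm_sub _ _ = @mnm0 n).
      by rewrite mpolyX0 -mpolyC1 alongC mul1r addr0.
    by apply/mnmP=> j; rewrite mnmBE mnm0E subnn.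
  by rewrite mderivX mnm1E eq_sym (negbTE ji) scale0r /along mmap0 mul0r.
- rewrite alongD derivD IHp IHq -big_split; apply: eq_bigr => i _.
  by rewrite mderivD alongD mulrDl.
- rewrite alongM derivM IHp IHq mulr_sumr mulr_suml -big_split /=.
  apply: eq_bigr => i _.
  by rewrite mderivM alongD !alongM mulrDl; congr (_ + _); rewrite ?mulrA // mulrAC.
Qed.

Lemma meval_ext (v w : 'I_n -> K) p : v =1 w -> meval v p = meval w p.
Proof. exact: meval_eq. Qed.

Lemma poly_fun_eq0 (P : {poly K}) : (forall t, P.[t] = 0) -> P = 0.
Proof.
move=> P0; apply/eqP; apply: contraT => Pn0.
pose rs := [seq i%:R : K | i <- iota 0 (size P)].
have rsP : all (root P) rs by apply/allP => x _; rewrite /root P0.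
have rsU : uniq rs.
  by rewrite map_inj_uniq ?iota_uniq // => i j /eqP; rewrite eqr_nat => /eqP.
by have := max_poly_roots Pn0 rsP rsU; rewrite size_map size_iota ltnn.
Qed.

Lemma msize_mderiv (i : 'I_n) p : p != 0 ->
  (mmeasure (@mdeg n) (mderiv i p) < mmeasure (@mdeg n) p)%N.
Proof.
move=> p0; rewrite [in X in (X < _)%N]msizeE.
have p_gt0 : (0 < mmeasure (@mdeg n) p)%N by rewrite lt0n msize_poly_eq0.
rewrite -(prednK p_gt0) ltnS; apply/bigmax_leqP_seq => m + _.
rewrite mcoeff_msupp mcoeff_deriv => c0.
have : mnm_add m (mnm1 i) \in msupp p.
  by rewrite mcoeff_msupp; apply: contraNneq c0 => ->; rewrite mul0rn.
by move/msize_mdeg_lt; rewrite mdegD mdeg1 addn1 => h; rewrite -ltnS prednK.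
Qed.

Lemma mderiv_all0 p : (forall i, mderiv i p = 0) -> p = mpolyC n (meval (fun=> 0) p).
Proof.
move=> d0; have pC : p = mpolyC n (mcoeff (@mnm0 n) p).
  apply/mpolyP => m; rewrite mcoeffC.
  have [->|m0] := eqVneq m (@mnm0 n); first by rewrite mulr1.
  rewrite mulr0.
  have [i mi] : exists i, m i != 0%N.
    apply/existsP; rewrite -negb_forall; apply: contraNN m0 => /forallP h.
    by apply/eqP/mnmP => i; rewrite mnm0E; apply/eqP; have := h i.
  have := congr1 (mcoeff (mnm_sub m (mnm1 i))) (d0 i).
  rewrite mcoeff_deriv mcoeff0 submK; last by rewrite lep1mP.
  by move/eqP; rewrite mulrn_eq0 /= => /eqP.
by rewrite {2}pC mevalC -pC.
Qed.

(** A polynomial that vanishes at every point vanishes: so do its derivatives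
    along lines, which have smaller size. *)
Lemma mpoly_fun_eq0 p : (forall v, meval v p = 0) -> p = 0.
Proof.
have [k] := ubnP (mmeasure (@mdeg n) p); elim: k p => // k IH p pk p0.
have [->//|pn0] := eqVneq p 0.
suff d0 i : mderiv i p = 0.
  by rewrite (mderiv_all0 d0) p0 mpolyC0.
apply: IH => [|v]; first exact: leq_trans (msize_mderiv i pn0) pk.
pose u j := (v j)%:P + ((j == i)%:R *: 'X).
have := deriv_along u p.
rewrite (_ : along u p = 0); last first.
  by apply: poly_fun_eq0 => t; rewrite horner_along p0.
rewrite deriv0 (bigD1 i) //= big1 => [|j ji].
  rewrite /u eqxx derivD derivC add0r derivZ derivX scale1r mulr1 addr0.
  move/(congr1 (horner^~ 0)); rewrite horner0 horner_along => h.
  rewrite [RHS]h; apply: meval_ext => j; rewrite hornerD hornerC hornerZ hornerX mulr0.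
  by rewrite addr0.
by rewrite /u derivD derivC add0r derivZ derivX (negbTE ji) scale0r mulr0.
Qed.

End Substitution.

(** * Lowest-degree parts and algebraic dependence *)

Section Lowest.
Variables (K : numFieldType) (M : nat) (w : 'I_M -> nat).

Definition weight (m : multinom M) : nat := \sum_(i < M) (w i * m i)%N.

(** The leading term argument behind all the independence statements: when each
    variable i is replaced by b ^+ w i times a value, dividing by b ^+ s and then
    setting b to 0 leaves only the terms of lowest weight. The element b will be
    the parameter of a curve, or an equation of a variety. *)
Lemma lowest_part (q : mpoly M K) : q != 0 ->
  exists s (qs : mpoly M K), qs != 0 /\
    forall (B : comNzRingType) (h : {rmorphism K -> B}) (b : B) (d : 'I_M -> B),
    mmap h (fun i => b ^+ w i * d i) qs = b ^+ s * mmap h d qs /\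
    exists r, mmap h (fun i => b ^+ w i * d i) q = b ^+ s * (mmap h d qs + b * r).
Proof.
move=> q0.
have ex : exists s, has (fun m => weight m == s) (msupp q).
  exists (weight (mlead q)); apply/hasP; exists (mlead q) => //.
  exact: mlead_supp.
case: (ex_minnP ex) => s /hasP[m0 m0q /eqP wm0] smin.
pose qs : mpoly M K :=
  \sum_(m <- msupp q | weight m == s) mcoeff m q *: mpolyX K m.
exists s, qs; split.
  apply: contraTneq m0q => /(congr1 (mcoeff m0)).
  rewrite /qs raddf_sum mcoeff0 /= -big_filter.
  rewrite mcoeff_msupp negbK; case: (boolP (m0 \in msupp q)) => [m0q|]; last first.
    by rewrite mcoeff_msupp negbK => /eqP ->.
  rewrite (bigD1_seq m0) /=; last by rewrite filter_uniq // msupp_uniq.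
    rewrite mcoeffZ mcoeffX eqxx mulr1 big1 ?addr0 => [->//|m mm0].
    by rewrite mcoeffZ mcoeffX (negbTE mm0) mulr0.
  by rewrite mem_filter wm0 eqxx.
move=> B h b d.
have mono m : mmap1 (fun i => b ^+ w i * d i) m = b ^+ weight m * mmap1 d m.
  rewrite /mmap1 /weight -prodrXr -big_split /=.
  by apply: eq_bigr => i _; rewrite exprMn -exprM.
have qsE d' : mmap h d' qs =
    \sum_(m <- msupp q | weight m == s) h (mcoeff m q) * mmap1 d' m.
  rewrite raddf_sum; apply: eq_bigr => m _ /=.
  by rewrite -mul_mpolyC rmorphM /= mmapC mmapX.
rewrite !qsE; split.
  by rewrite mulr_sumr; apply: eq_bigr => m /eqP <-; rewrite mono mulrCA.
exists (\sum_(m <- msupp q | weight m != s)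
          h (mcoeff m q) * (b ^+ (weight m - s.+1) * mmap1 d m)).
rewrite {1}/mmap (bigID (fun m => weight m == s)) /= mulrDr; congr (_ + _).
  rewrite mulr_sumr; apply: eq_bigr => m /eqP <-.
  by rewrite mono mulrCA.
rewrite mulrA -exprSr mulr_sumr big_seq_cond [RHS]big_seq_cond; apply: eq_bigr => m /andP[mq ms].
have lt : (s < weight m)%N.
  by rewrite ltn_neqAle eq_sym ms smin //; apply/hasP; exists m.
by rewrite mono -{1}(subnKC lt) exprD -!mulrA; rewrite mulrCA.
Qed.

Lemma lowest_along (q : mpoly M K) : q != 0 ->
  exists2 qs : mpoly M K, qs != 0 &
    forall d : 'I_M -> {poly K}, along (fun i => 'X ^+ w i * d i) q = 0 ->
      meval (fun i => (d i).[0]) qs = 0.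
Proof.
move=> /lowest_part[s [qs [qs0 h]]]; exists qs => // d.
have [_ [r]] := h _ (@polyC K) 'X d; rewrite -/(along _ _) -/(along d qs) => -> /eqP.
rewrite mulf_eq0 expf_eq0 polyX_eq0 andbF /= => /eqP/(congr1 (horner^~ 0)).
by rewrite hornerD hornerM hornerX mul0r addr0 horner0 horner_along.
Qed.

End Lowest.

Section Counting.
Variables (K : numFieldType) (M N : nat).

Lemma msizeM_bound (p q : mpoly N K) a b :
  (mmeasure (@mdeg N) p <= a.+1)%N -> (mmeasure (@mdeg N) q <= b.+1)%N ->
  (mmeasure (@mdeg N) (p * q) <= (a + b).+1)%N.
Proof.
move=> pa qb; have [->|p0] := eqVneq p 0; first by rewrite mul0r mmeasure0.
have [->|q0] := eqVneq q 0; first by rewrite mulr0 mmeasure0.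
rewrite msizeM // -subn1 leq_subLR add1n.
by apply: leq_trans (leq_add pa qb) _; rewrite addSn addnS.
Qed.

(** There are more monomials in M variables than in N variables, at a large
    degree, so a linear relation exists between the products of the f_i. *)
Lemma algebraic_dependence (f : 'I_M -> mpoly N K) : (N < M)%N ->
  exists2 q : mpoly M K, q != 0 & mmap (@mpolyC N K) f q = 0.
Proof.
move=> NM.
pose D := (\max_(i < M) mmeasure (@mdeg N) (f i))%N.
have fD i : (mmeasure (@mdeg N) (f i) <= D.+1)%N.
  by apply: leqW; apply: (leq_bigmax (F := fun i => mmeasure (@mdeg N) (f i))).
(* With this s one has (M s D + 1)^N <= ((M D + 1) (s + 1))^N < (s + 1)^(N + 1). *)
pose s := ((M * D).+1 ^ N)%N.
pose src := {ffun 'I_M -> 'I_s.+1}.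
pose tgt := {ffun 'I_N -> 'I_(M * s * D).+1}.
pose mon (phi : src) : multinom M := Multinom [tuple phi i : nat | i < M].
pose mon' (psi : tgt) : multinom N := Multinom [tuple psi i : nat | i < N].
have monE phi i : mon phi i = phi i by rewrite mnmE.
have mon'E phi i : mon' phi i = phi i by rewrite mnmE.
have mon_inj : injective mon.
  move=> phi phi' /mnmP e; apply/ffunP => i; apply/val_inj.
  by have := e i; rewrite !monE.
have powD i k : (mmeasure (@mdeg N) (f i ^+ k) <= (k * D).+1)%N.
  elim: k => [|k IH]; first by rewrite expr0 msize1.
  by rewrite exprS mulSn; apply: msizeM_bound.
have prodD phi : (mmeasure (@mdeg N) (mmap1 f (mon phi)) <= (M * s * D).+1)%N.
  have -> : (M * s * D = \sum_(i < M) (s * D))%N by rewrite sum_nat_const card_ord mulnA.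
  rewrite /mmap1; elim/big_rec2: _ => [|i a b _ IH]; first by rewrite msize1.
  apply: msizeM_bound IH; apply: leq_trans (powD _ _) _.
  by rewrite ltnS leq_mul2r monE -ltnS ltn_ord orbT.
pose A := \matrix_(i < #|src|, j < #|tgt|)
  mcoeff (mon' (enum_val j)) (mmap1 f (mon (enum_val i))).
have card_lt : (#|tgt| < #|src|)%N.
  rewrite !card_ffun !card_ord.
  apply: (@leq_ltn_trans (((M * D).+1 * s.+1) ^ N)%N).
    have pow_le a b k : (a <= b)%N -> (a ^ k <= b ^ k)%N.
      by move=> ab; case: k => // k; rewrite leq_exp2r.
    apply: pow_le; rewrite mulSn mulnS addSn ltnS.
    by rewrite mulnAC; lia.
  rewrite expnMn -/s; apply: (@leq_trans (s.+1 ^ N.+1)%N).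
    by rewrite expnS ltn_pmul2r // expn_gt0.
  by rewrite leq_pexp2l.
have ker0 : kermx A != 0.
  rewrite -mxrank_eq0 mxrank_ker subn_eq0 -ltnNge.
  exact: leq_ltn_trans (rank_leq_col A) card_lt.
have /rowV0Pn[v /sub_kermxP vA v0] := ker0.
pose q : mpoly M K := \sum_(i < #|src|) v 0 i *: mpolyX K (mon (enum_val i)).
exists q.
  apply: contraNneq v0 => q0; apply/eqP/rowP => i; rewrite mxE.
  have := congr1 (mcoeff (mon (enum_val i))) q0.
  rewrite mcoeff0 /q raddf_sum (bigD1 i) //= big1 => [|j ji].
    by rewrite mcoeffZ mcoeffX eqxx mulr1 addr0.
  rewrite mcoeffZ mcoeffX (inj_eq mon_inj) (inj_eq enum_val_inj).
  by rewrite (negbTE ji) mulr0.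
have -> : mmap (@mpolyC N K) f q =
    \sum_(i < #|src|) v 0 i *: mmap1 f (mon (enum_val i)).
  rewrite /q raddf_sum; apply: eq_bigr => i _ /=.
  by rewrite -mul_mpolyC rmorphM /= mmapC mmapX mul_mpolyC.
apply/mpolyP => m; rewrite mcoeff0 raddf_sum /=.
have [|big] := leqP (mdeg m) (M * s * D).
  move=> small.
  have lti i : (m i < (M * s * D).+1)%N.
    rewrite ltnS; apply: leq_trans small; rewrite mdegE.
    by rewrite (bigD1 i) //= leq_addr.
  pose psi : tgt := [ffun i => Ordinal (lti i)].
  have -> : m = mon' psi by apply/mnmP => i; rewrite mon'E ffunE.
  have := congr1 (fun B : 'rV_#|tgt| => B 0 (enum_rank psi)) vA.
  rewrite mxE [in RHS]mxE => vA0; rewrite -[RHS]vA0; apply: eq_bigr => i _.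
  by rewrite mcoeffZ mxE enum_rankK.
rewrite big1 // => i _; rewrite mcoeffZ [mcoeff _ _]memN_msupp_eq0 ?mulr0 //.
by apply: msize_mdeg_ge; apply: leq_trans (prodD _) big.
Qed.

End Counting.

(** * Tangent spaces and algebraic independence *)

Section Points.
Variables (K : numFieldType) (N : nat).
Local Notation V := 'cV[K]_N.
Implicit Types (p q : mpoly N K) (x v : V) (Y : set V).

Definition mpcomp (k : nat) (f : 'I_k -> mpoly N K) : mpoly k K -> mpoly N K :=
  mmap (@mpolyC N K) f.

Lemma peval_mpcomp k (f : 'I_k -> mpoly N K) (q : mpoly k K) v :
  peval (mpcomp f q) v = meval (fun i => peval (f i) v) q.
Proof.
rewrite /peval /mpcomp; elim/mpoly_ring_ind: q => [c|i|p q IHp IHq|p q IHp IHq].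
- by rewrite mmapC !mevalC.
- by rewrite mmapX mmap1U mevalXU.
- by rewrite mmapD !mevalD IHp IHq.
- by rewrite rmorphM !mevalM /= IHp IHq.
Qed.

Lemma along_mpcomp (u : 'I_N -> {poly K}) k (f : 'I_k -> mpoly N K) (q : mpoly k K) :
  along u (mpcomp f q) = along (fun i => along u (f i)) q.
Proof.
rewrite /mpcomp; elim/mpoly_ring_ind: q => [c|i|p q IHp IHq|p q IHp IHq].
- by rewrite mmapC !alongC.
- by rewrite mmapX mmap1U alongX.
- by rewrite mmapD !alongD IHp IHq.
- by rewrite rmorphM !alongM /= IHp IHq.
Qed.

Definition line x v (i : 'I_N) : {poly K} := (x i 0)%:P + v i 0 *: 'X.

Lemma horner_line x v i t : (line x v i).[t] = (x + t *: v) i 0.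
Proof. by rewrite /line !hornerE !mxE mulrC. Qed.

Lemma along_line x v p t : (along (line x v) p).[t] = peval p (x + t *: v).
Proof. by rewrite horner_along; apply: meval_ext => i; rewrite horner_line. Qed.

Lemma along_line0 x v p : (along (line x v) p).[0] = peval p x.
Proof. by rewrite along_line scale0r addr0. Qed.

Lemma differential_line x v p :
  (along (line x v) p)^`().[0] = differential p x v.
Proof.
rewrite deriv_along horner_sum; apply: eq_bigr => i _.
rewrite hornerM along_line0; congr (_ * _).
by rewrite /line derivD derivC add0r derivZ derivX hornerZ hornerC mulr1.
Qed.

Lemma differential_lin p x a v w :
  differential p x (a *: v + w) = a * differential p x v + differential p x w.
Proof.
rewrite /differential mulr_sumr -big_split; apply: eq_bigr => i _ /=.
by rewrite !mxE mulrDr mulrCA.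
Qed.

Lemma differential_sum p x (I : Type) (r : seq I) (c : I -> K) (v : I -> V) :
  differential p x (\sum_(i <- r) c i *: v i) =
  \sum_(i <- r) c i * differential p x (v i).
Proof.
elim: r => [|i r IH]; last by rewrite !big_cons differential_lin IH.
by rewrite !big_nil /differential big1 // => i _; rewrite mxE mulr0.
Qed.

Lemma differentialD p q x v :
  differential (p + q) x v = differential p x v + differential q x v.
Proof. by rewrite -!differential_line alongD derivD hornerD. Qed.

Lemma differentialM p q x v :
  differential (p * q) x v =
  differential p x v * peval q x + peval p x * differential q x v.
Proof.
by rewrite -!differential_line alongM derivM hornerD !hornerM !along_line0.
Qed.

Lemma differentialC c x v : differential (mpolyC N c) x v = 0.
Proof. by rewrite -differential_line alongC derivC horner0. Qed.

Lemma differentialXi i x v : differential (mpolyX K (mnm1 i)) x v = v i 0.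
Proof.
rewrite -differential_line alongX /line derivD derivC add0r derivZ derivX.
by rewrite hornerZ hornerC mulr1.
Qed.

Lemma differential_comb x v (J : Type) (r : seq J) (c : J -> K) (g : J -> mpoly N K) :
  differential (\sum_(i <- r) mpolyC N (c i) * g i) x v =
  \sum_(i <- r) c i * differential (g i) x v.
Proof.
elim: r => [|i r IH]; last first.
  by rewrite !big_cons differentialD IH differentialM differentialC mul0r add0r
             /peval mevalC.
by rewrite !big_nil -mpolyC0 differentialC.
Qed.

Lemma differential_mpcomp k (f : 'I_k -> mpoly N K) (q : mpoly k K) x v :
  differential (mpcomp f q) x v =
  \sum_i peval (mpcomp f (mderiv i q)) x * differential (f i) x v.
Proof.
rewrite -differential_line along_mpcomp deriv_along horner_sum.
apply: eq_bigr => i _; rewrite hornerM differential_line; congr (_ * _).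
rewrite horner_along peval_mpcomp; apply: meval_ext => j.
exact: along_line0.
Qed.

Lemma pevalD p q v : peval (p + q) v = peval p v + peval q v.
Proof. exact: mevalD. Qed.
Lemma pevalM p q v : peval (p * q) v = peval p v * peval q v.
Proof. exact: mevalM. Qed.
Lemma pevalC c v : peval (mpolyC N c) v = c.
Proof. exact: mevalC. Qed.
Lemma pevalX i v : peval (mpolyX K (mnm1 i)) v = v i 0.
Proof. exact: mevalXU. Qed.
Lemma peval0 v : peval (0 : mpoly N K) v = 0.
Proof. exact: meval0. Qed.
Lemma peval1 v : peval (1 : mpoly N K) v = 1.
Proof. exact: meval1. Qed.

Lemma closed_zeros Y : zariski_closed Y ->
  forall v, (forall p, vanishing_ideal Y p -> peval p v = 0) -> Y v.
Proof. by move=> [F ->] v h p Fp; apply: h => w; apply. Qed.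

Lemma zero_locus_closed p : zariski_closed [set v : V | peval p v = 0].
Proof.
exists [set p]; apply/seteqP; split => v /=; first by move=> h _ ->.
by apply.
Qed.

(** The algebraic form of irreducibility: the vanishing ideal is prime. *)
Definition prime_locus Y := (exists x, Y x) /\
  forall p q, vanishing_ideal Y (p * q) -> vanishing_ideal Y p \/ vanishing_ideal Y q.

Lemma irreducible_prime Y : irreducible_in (@zariski_closed K N) Y -> prime_locus Y.
Proof.
move=> [_ Y0 irr]; split=> // p q pq.
apply: (irr _ _ (zero_locus_closed p) (zero_locus_closed q)) => v Yv /=.
by have /eqP := pq v Yv; rewrite pevalM mulf_eq0 => /orP[] /eqP; [left|right].
Qed.

Lemma prime_prod Y (J : Type) (r : seq J) (g : J -> mpoly N K) : prime_locus Y ->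
  (forall i, ~ vanishing_ideal Y (g i)) -> ~ vanishing_ideal Y (\prod_(i <- r) g i).
Proof.
move=> [[x Yx] pr] gY; elim: r => [|i r IH].
  by rewrite big_nil => /(_ x Yx); rewrite peval1 => /eqP; rewrite oner_eq0.
by rewrite big_cons => /pr[/gY|/IH].
Qed.

Lemma nvanishing Y p : ~ vanishing_ideal Y p -> exists2 x, Y x & peval p x != 0.
Proof.
move=> /existsNP[x /not_implyP[Yx /eqP px]]; by exists x.
Qed.

Lemma poly_root0 (P : {poly K}) : P.[0] = 0 ->
  exists2 b, P = 'X * b & b.[0] = P^`().[0].
Proof.
move=> /eqP; rewrite -/(root P 0) => /factor_theorem[b].
rewrite subr0 => ->; exists b; first by rewrite mulrC.
by rewrite derivM derivX hornerD !hornerM hornerX mulr0 add0r hornerC mulr1.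
Qed.

Lemma poly_deriv0 (P : {poly K}) : P^`() = 0 -> forall t, P.[t] = P.[0].
Proof.
move=> dP t; suff -> : P = (P`_0)%:P by rewrite !hornerC.
apply/polyP => -[|i]; rewrite coefC //=; have := congr1 (fun P : {poly K} => P`_i) dP.
by rewrite coef_deriv coef0 => /eqP; rewrite mulrn_eq0 /= => /eqP.
Qed.

End Points.

Section Cat.
Variables (T : Type) (k r : nat).
Definition cat2 (f : 'I_k -> T) (g : 'I_r -> T) (i : 'I_(k + r)) : T :=
  match fintype.split i with inl a => f a | inr b => g b end.

Lemma cat2l f g a : cat2 f g (lshift r a) = f a.
Proof.
by rewrite /cat2; case: split_ordP => b; [move/lshift_inj->|move/eqP; rewrite eq_lrshift].
Qed.
Lemma cat2r f g b : cat2 f g (rshift k b) = g b.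
Proof.
by rewrite /cat2; case: split_ordP => a; [move/eqP; rewrite eq_rlshift|move/rshift_inj->].
Qed.
Lemma cat2E (P : 'I_(k + r) -> T -> Prop) f g :
  (forall a, P (lshift r a) (f a)) -> (forall b, P (rshift k b) (g b)) ->
  forall i, P i (cat2 f g i).
Proof.
by move=> Pf Pg i; rewrite -(splitK i); case: (fintype.split i) => a /=; rewrite ?cat2l ?cat2r.
Qed.
End Cat.

Section Dimension.
Variables (K : numFieldType) (N : nat).
Local Notation V := 'cV[K]_N.
Implicit Types (p q : mpoly N K) (x v : V) (Y : set V).

(** The two families define matrices with product the identity. *)
Lemma dual_system_bound x r (p : 'I_r -> mpoly N K) (v : 'I_r -> V) :
  (forall i j, differential (p i) x (v j) = (i == j)%:R) -> (r <= N)%N.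
Proof.
move=> pv; pose A := \matrix_(i < r, l < N) peval (mderiv l (p i)) x.
pose B := \matrix_(l < N, j < r) v j l 0.
apply: (@mulmx1_min _ _ _ A B); apply/matrixP => i j; rewrite !mxE -pv.
by apply: eq_bigr => l _; rewrite !mxE.
Qed.

(** A system of equations with dual vectors has at most N members, and as long
    as some equation has a nonzero differential on the common kernel of the
    system, it can be corrected so as to enlarge the system. *)
Lemma dual_system Y x :
  exists r (p : 'I_r -> mpoly N K) (v : 'I_r -> V),
  [/\ forall i, vanishing_ideal Y (p i),
      forall i j, differential (p i) x (v j) = (i == j)%:R &
      forall w, (forall i, differential (p i) x w = 0) -> tangent_space Y x w].
Proof.
apply: contrapT => nex.
have [p [v [_ pv]]] : exists (p : 'I_N.+1 -> mpoly N K) (v : 'I_N.+1 -> V),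
    (forall i, vanishing_ideal Y (p i)) /\
    (forall i j, differential (p i) x (v j) = (i == j)%:R); last first.
  by have := dual_system_bound pv; rewrite ltnn.
elim: (N.+1) => [|r [p [v [pI pv]]]].
  by exists (fun=> 0), (fun=> 0); split=> [[]|[]].
have /existsNP[w /not_implyP[w0 /existsNP[q /not_implyP[qI /eqP qw]]]] :
    ~ forall w, (forall i, differential (p i) x w = 0) -> tangent_space Y x w.
  by move=> h; apply: nex; exists r, p, v.
pose c := differential q x w.
pose q' := q + \sum_(i < r) mpolyC N (- differential q x (v i)) * p i.
have q'I : vanishing_ideal Y q'.
  move=> y Yy; rewrite /q' pevalD qI // add0r.
  have S0 : forall s : seq 'I_r,
      peval (\sum_(i <- s) mpolyC N (- differential q x (v i)) * p i) y = 0.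
    elim=> [|i s IH]; first by rewrite big_nil peval0.
    by rewrite big_cons pevalD IH pevalM pI // mulr0 addr0.
  exact: S0.
pose p' := fun i : 'I_r.+1 => oapp p q' (unlift ord0 i).
pose v' := fun i : 'I_r.+1 => oapp v (c^-1 *: w) (unlift ord0 i).
have wE p0 : differential p0 x (c^-1 *: w) = c^-1 * differential p0 x w.
  have := differential_lin p0 x c^-1 w 0; rewrite addr0 => ->.
  have := differential_lin p0 x 0 w 0; rewrite scale0r add0r mul0r => e.
  by rewrite [X in _ + X](_ : _ = 0) ?addr0 // e add0r /differential big1 // => i _; rewrite mxE mulr0.
exists p', v'; split=> [i|i j]; rewrite /p' /v'.
  by case: unliftP => [i' _|_] /=.
case: (unliftP ord0 i) => [i' ->|->]; case: (unliftP ord0 j) => [j' ->|->] /=.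
- by rewrite pv (inj_eq lift_inj).
- by rewrite wE w0 mulr0.
- rewrite /q' differentialD differential_comb (bigD1 j') //=.
  rewrite pv eqxx mulr1 big1 ?addr0 ?subrr // => l lj.
  by rewrite pv (negbTE lj) mulr0.
- rewrite wE /q' differentialD differential_comb big1 => [|i' _]; last by rewrite w0 mulr0.
  by rewrite addr0 mulVf.
Qed.

(** Functions independent on Y and equations of Y with independent
    differentials are together independent on the whole space: the terms of
    lowest degree in the equations of a relation can be tested along the lines
    through the points of Y. *)
Lemma independent_add_equations Y x k (f : 'I_k -> mpoly N K) r
    (p : 'I_r -> mpoly N K) (v : 'I_r -> V) :
  prime_locus Y -> Y x -> algebraically_independent Y f ->
  (forall i, vanishing_ideal Y (p i)) ->
  (forall i j, differential (p i) x (v j) = (i == j)%:R) -> (k + r <= N)%N.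
Proof.
move=> [_ prY] Yx find pI pv; rewrite leqNgt; apply/negP => lt.
have [q q0 rel] := algebraic_dependence (cat2 f p) lt.
have [qs qs0 low] := lowest_along (cat2 (fun=> 0%N) (fun=> 1%N)) q0.
(* Where the minor D does not vanish, the differentials of the p i take arbitrary
   values on a common vector. *)
pose D := \det (\matrix_(i < r, j < r)
  \sum_(l < N) mderiv l (p i) * mpolyC N (v j l 0)).
have DE y : peval D y = \det (\matrix_(i < r, j < r) differential (p i) y (v j)).
  rewrite /D /peval -det_map_mx; congr (\det _); apply/matrixP => i j.
  rewrite !mxE raddf_sum; apply: eq_bigr => l _ /=.
  by rewrite rmorphM /= mevalC.
have nD : ~ vanishing_ideal Y D.
  move=> /(_ x Yx); rewrite DE (_ : matrix_of_fun _ _ = 1%:M) ?det1.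
    by move/eqP; rewrite oner_eq0.
  by apply/matrixP => i j; rewrite !mxE pv.
have tang y w : Y y ->
    meval (cat2 (fun a => peval (f a) y) (fun b => differential (p b) y w)) qs = 0.
  move=> Yy.
  have /choice[b bP] : forall j, exists b, along (line y w) (p j) = 'X * b /\
      b.[0] = differential (p j) y w.
    move=> j; have [|b b1 b2] := @poly_root0 _ (along (line y w) (p j)).
      by rewrite along_line0 pI.
    by exists b; rewrite b2 differential_line.
  rewrite -(low (cat2 (fun a => along (line y w) (f a)) b)).
    apply: meval_ext; apply: (cat2E (P := fun i c => c = _)) => a.
      by rewrite cat2l along_line0.
    by rewrite cat2r (bP a).2.
  transitivity (along (fun i => along (line y w) (cat2 f p i)) q).
    congr (mmap _ _ _); apply/funext.
    move=> i; rewrite -(splitK i); case: (fintype.split i) => a /=.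
      by rewrite !cat2l expr0 mul1r.
    by rewrite !cat2r expr1 (bP a).1.
  by rewrite -along_mpcomp /mpcomp rel /along mmap0.
pose Q z := mmap (@mpolyC k K)
  (cat2 (fun a => mpolyX K (mnm1 a)) (fun b : 'I_r => mpolyC k (z b))) qs.
have QE z y : meval y (Q z) = meval (cat2 y z) qs.
  rewrite /Q; elim/mpoly_ring_ind: (qs) => [c|i|p1 q1 IHp IHq|p1 q1 IHp IHq].
  - by rewrite mmapC !mevalC.
  - rewrite mmapX mmap1U mevalXU -(splitK i); case: (fintype.split i) => a /=.
      by rewrite !cat2l mevalXU.
    by rewrite !cat2r mevalC.
  - by rewrite mmapD !mevalD IHp IHq.
  - by rewrite rmorphM !mevalM /= IHp IHq.
have Q0 z : Q z = 0.
  apply: find => y Yy; rewrite -peval_mpcomp.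
  suff /prY[//|] : vanishing_ideal Y (D * mpcomp f (Q z)) by apply.
  move=> {Yy}y Yy; rewrite pevalM; have [->|Dy] := eqVneq (peval D y) 0.
    by rewrite mul0r.
  rewrite peval_mpcomp QE.
  pose A := \matrix_(i < r, j < r) differential (p i) y (v j).
  have uA : A \in unitmx by rewrite unitmxE unitfE -DE.
  pose c := invmx A *m \col_i z i.
  rewrite [X in _ * X](_ : _ = 0) ?mulr0 //.
  rewrite -(tang y (\sum_(j <- enum 'I_r) c j 0 *: v j) Yy).
  congr (meval _ _); apply/funext => i; rewrite /cat2.
  case: (fintype.split i) => // b; rewrite differential_sum.
  have := congr1 (fun M : 'cV_r => M b 0) (mulKVmx uA (\col_i z i)).
  rewrite !mxE => <-; rewrite big_enum /=.
  by apply: eq_bigr => j _; rewrite !mxE mulrC.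
move/eqP: qs0; apply; apply: mpoly_fun_eq0 => y.
have := QE (fun b => y (rshift k b)) (fun a => y (lshift r a)).
rewrite Q0 meval0 => /esym; rewrite (meval_ext (w := y)) // => i.
by rewrite -(splitK i); case: (fintype.split i) => a /=; rewrite ?cat2l ?cat2r.
Qed.

(** The equations of a dual system cut out the tangent space, and together with
    the functions f they number at most N. *)
Lemma tangent_vspace Y x k (f : 'I_k -> mpoly N K) :
  prime_locus Y -> Y x -> algebraically_independent Y f ->
  exists W : {vspace V}, [set` W] = tangent_space Y x /\ (k <= \dim W)%N.
Proof.
move=> prY Yx find.
have [r [p [v [pI pv pT]]]] := dual_system Y x.
have krN := independent_add_equations prY Yx find pI pv.
pose G := \matrix_(i < r, l < N) peval (mderiv l (p i)) x.
have GE w i : (G *m w) i 0 = differential (p i) x w.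
  by rewrite mxE; apply: eq_bigr => l _; rewrite mxE.
pose DL := linfun (mulmx G : V -> 'cV[K]_r).
exists (lker DL); split.
  apply/seteqP; split => w /=; rewrite memv_ker lfunE /=.
    by move=> /eqP/matrixP Dw; apply: pT => i; have := Dw i 0; rewrite GE mxE.
  by move=> Tw; apply/eqP/matrixP => i j; rewrite ord1 GE mxE; apply: Tw.
have dimKI : (\dim (lker DL) + \dim (limg DL) = N)%N.
  by have := limg_ker_dim DL fullv; rewrite capfv dimvf /dim /= muln1.
have dimI : (\dim (limg DL) <= r)%N.
  by apply: leq_trans (dimvS (subvf _)) _; rewrite dimvf /dim /= muln1.
rewrite -(leq_add2r r); apply: (leq_trans krN).
by apply: (@leq_trans (\dim (lker DL) + \dim (limg DL))); [rewrite dimKI|rewrite leq_add2l].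
Qed.

Lemma independent_bound Y k (f : 'I_k -> mpoly N K) : prime_locus Y ->
  algebraically_independent Y f -> (k <= N)%N.
Proof.
move=> prY find; have [x Yx] := prY.1.
have := @independent_add_equations Y x k f 0 (fun=> 0) (fun=> 0) prY Yx find.
by rewrite addn0; apply; case.
Qed.

End Dimension.

(** * Generic smoothness *)

Section GenericSmoothness.
Variables (K : numFieldType) (N : nat).
Local Notation V := 'cV[K]_N.
Implicit Types (p q : mpoly N K) (x v : V) (Y : set V).

(** Over a maximal independent family f each coordinate satisfies a polynomial
    relation; for one of minimal degree the derivative with respect to the
    coordinate does not vanish identically on Y, and where it is nonzero, a tangent
    vector killed by the differentials of f has that coordinate equal to 0. *)
Lemma generic_tangent_small Y d (f : 'I_d -> mpoly N K) :
  prime_locus Y -> algebraically_independent Y f ->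
  (forall g : 'I_(d + 1) -> mpoly N K, ~ algebraically_independent Y g) ->
  exists D, ~ vanishing_ideal Y D /\ forall x, Y x -> peval D x != 0 ->
    forall v, tangent_space Y x v -> (forall i, differential (f i) x v = 0) -> v = 0.
Proof.
move=> prY find fmax.
have /choice[D DP] : forall j, exists D, ~ vanishing_ideal Y D /\
    forall x, Y x -> peval D x != 0 -> forall v, tangent_space Y x v ->
    (forall i, differential (f i) x v = 0) -> v j 0 = 0.
  move=> j; pose g := cat2 f (fun _ : 'I_1 => mpolyX K (mnm1 j)).
  pose rel (q : mpoly (d + 1) K) := q != 0 /\ vanishing_ideal Y (mpcomp g q).
  have relE (q : mpoly (d + 1) K) : rel q <-> q != 0 /\
      forall v, Y v -> meval (fun i => peval (g i) v) q = 0.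
    by split=> -[q0 h]; split=> // v Yv; have := h v Yv; rewrite peval_mpcomp.
  have : exists n, `[< exists2 q, rel q & mmeasure (@mdeg _) q = n >].
    have /existsNP[q /not_implyP[h /eqP q0]] := fmax g.
    by exists (mmeasure (@mdeg _) q); apply/asboolP; exists q => //; apply/relE.
  move=> ex; case: (ex_minnP ex) => n /asboolP[q [q0 qI] <-] qmin {ex n}.
  pose l : 'I_(d + 1) := rshift d ord0.
  exists (mpcomp g (mderiv l q)); split.
    move=> dI.
    have dq0 : mderiv l q = 0.
      apply/eqP; apply: contraT => dq0.
      have : (mmeasure (@mdeg _) q <= mmeasure (@mdeg _) (mderiv l q))%N.
        by apply: qmin; apply/asboolP; exists (mderiv l q).
      by rewrite leqNgt msize_mderiv.
    have cst y t : meval (cat2 y (fun=> t)) q = meval (cat2 y (fun=> 0)) q.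
      pose u := cat2 (fun a => (y a)%:P) (fun _ : 'I_1 => 'X : {poly K}).
      have uE s : (along u q).[s] = meval (cat2 y (fun=> s)) q.
        rewrite horner_along; apply: meval_ext => i; rewrite /u /cat2.
        by case: (fintype.split i) => a; rewrite ?hornerC ?hornerX.
      rewrite -!uE; apply: poly_deriv0; rewrite deriv_along big1 // => i _.
      rewrite /u -(splitK i); case: (fintype.split i) => a /=.
        by rewrite cat2l derivC mulr0.
      by rewrite (ord1 a) dq0 /along mmap0 mul0r.
    pose q' := mmap (@mpolyC d K) (cat2 (fun a => mpolyX K (mnm1 a)) (fun=> 0)) q.
    have q'E y : meval y q' = meval (cat2 y (fun=> 0)) q.
      rewrite /q'; elim/mpoly_ring_ind: (q) => [c|i|p1 q1 IHp IHq|p1 q1 IHp IHq].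
      - by rewrite mmapC !mevalC.
      - rewrite mmapX mmap1U mevalXU -(splitK i); case: (fintype.split i) => a /=.
          by rewrite !cat2l mevalXU.
        by rewrite !cat2r meval0.
      - by rewrite mmapD !mevalD IHp IHq.
      - by rewrite rmorphM !mevalM /= IHp IHq.
    have q'0 : q' = 0.
      apply: find => v Yv; rewrite q'E -(cst _ (v j 0)).
      have := qI v Yv; rewrite peval_mpcomp => h; rewrite -[RHS]h.
      apply: meval_ext => i; rewrite /g /cat2; case: (fintype.split i) => a //.
      by rewrite pevalX.
    move/eqP: q0; apply; apply: mpoly_fun_eq0 => v.
    rewrite (meval_ext (w := cat2 (fun a => v (lshift 1 a)) (fun=> v l))).
      by rewrite cst -q'E q'0 meval0.
    move=> i; rewrite -(splitK i); case: (fintype.split i) => a /=; rewrite ?cat2l //.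
    by rewrite cat2r (ord1 a).
  move=> x Yx Dx v Tv fv.
  have := Tv _ qI; rewrite differential_mpcomp big_split_ord /= big1 => [|i _].
    rewrite add0r big_ord1 /g cat2r differentialXi => /eqP.
    by rewrite mulf_eq0 (negbTE Dx) /= => /eqP.
  by rewrite /g cat2l fv mulr0.
exists (\prod_(j <- enum 'I_N) D j); split.
  by apply: prime_prod => // j; case: (DP j).
move=> x Yx; rewrite /peval rmorph_prod /= prodf_seq_neq0 => /allP Dx v Tv fv.
apply/matrixP => j k; rewrite ord1 mxE.
apply: (DP j).2 fv => //; apply: Dx; exact: mem_enum.
Qed.

(** With d the size of a maximal independent family, tangent spaces have
    dimension at least d at all points and at most d on a nonempty open set. *)
Lemma generic_smooth Y : irreducible_in (@zariski_closed K N) Y ->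
  exists d, [/\ exists f : 'I_d -> mpoly N K, algebraically_independent Y f,
    forall k (f : 'I_k -> mpoly N K), algebraically_independent Y f -> (k <= d)%N,
    forall x, Y x -> local_dimension Y x d &
    exists D, ~ vanishing_ideal Y D /\
      forall x, Y x -> peval D x != 0 -> smooth_at Y x].
Proof.
move=> irrY; have prY := irreducible_prime irrY.
pose ind k := `[< exists f : 'I_k -> mpoly N K, algebraically_independent Y f >].
have ind0 : exists k, ind k.
  exists 0%N; apply/asboolP; exists (fun=> 0) => Q h.
  have [x Yx] := prY.1; rewrite (mderiv_all0 (p := Q)) ; last by case.
    suff -> : meval (fun=> 0) Q = 0 by rewrite mpolyC0.
  by rewrite -(h x Yx); apply: meval_ext => -[].
have indN k : ind k -> (k <= N)%N.
  by move=> /asboolP[f find]; apply: independent_bound find.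
case: (ex_maxnP ind0 indN) => d /asboolP[f find] dmax; exists d.
have dmax' k (g : 'I_k -> mpoly N K) : algebraically_independent Y g -> (k <= d)%N.
  by move=> gind; apply: dmax; apply/asboolP; exists g.
have locd x : Y x -> local_dimension Y x d.
  move=> Yx; split; first by exists Y; split=> //; exists f.
  move=> k [Z [_ ZY _ [g gind]]]; apply: (dmax' k g) => q qY.
  by apply: gind => v /ZY; apply: qY.
split=> //; first by exists f.
have [|D [nD Dgen]] := generic_tangent_small prY find.
  by move=> g /dmax'; rewrite addn1 ltnn.
exists D; split=> // x Yx Dx; split=> //.
have [W [WT dW]] := tangent_vspace prY Yx find.
exists W; split=> //; suff -> : \dim W = d by apply: locd.
apply/eqP; rewrite eqn_leq dW andbT.
pose G := \matrix_(i < d, l < N) peval (mderiv l (f i)) x.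
have GE w i : (G *m w) i 0 = differential (f i) x w.
  by rewrite mxE; apply: eq_bigr => l _; rewrite mxE.
pose DL := linfun (mulmx G : V -> 'cV[K]_d).
have dimKI := limg_ker_dim DL W.
have dimI : (\dim (DL @: W) <= d)%N.
  by apply: leq_trans (dimvS (subvf _)) _; rewrite dimvf /dim /= muln1.
suff K0 : (W :&: lker DL = 0)%VS by rewrite K0 dimv0 add0n in dimKI; rewrite -dimKI.
apply/eqP; rewrite -subv0; apply/subvP => v; rewrite memv_cap memv_ker lfunE /=.
move=> /andP[Wv /eqP/matrixP Gv]; rewrite memv0; apply/eqP.
apply: (Dgen x Yx Dx); first by rewrite -WT.
by move=> i; have := Gv i 0; rewrite GE mxE.
Qed.

End GenericSmoothness.

(** * Affine cones *)

Section Cone.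
Variables (K : numFieldType) (N : nat).
Local Notation V := 'cV[K]_N.
Implicit Types (p q : mpoly N K) (x v : V) (X : set {vspace V}).

Lemma peval_homog p k t v : p \is ishomog1 k (@mdeg N) ->
  peval p (t *: v) = t ^+ k * peval p v.
Proof.
move=> /dhomogP hp; rewrite /peval !mevalE mulr_sumr !big_seq.
apply: eq_bigr => m mp; rewrite mulrCA; congr (_ * _).
have -> : k = mdeg m by rewrite (hp m mp).
rewrite mdegE -prodrXr -big_split /=; apply: eq_bigr => i _.
by rewrite mxE exprMn.
Qed.

Lemma peval_scale p v t : (\poly_(k < mmeasure (@mdeg N) p) peval (pihomog (@mdeg N) k p) v).[t]
  = peval p (t *: v).
Proof.
rewrite horner_poly.
rewrite [in RHS](pihomog_partitionE (leqnn (mmeasure (@mdeg N) p))).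
rewrite [RHS]raddf_sum; apply: eq_bigr => k _.
by rewrite mulrC -(peval_homog t v (pihomogP (@mdeg N) k p)).
Qed.

Lemma memv_line_dim1 (L : {vspace V}) v : \dim L = 1%N -> v \in L -> v != 0 ->
  L = <[v]>%VS.
Proof.
move=> L1 vL v0; apply/esym/eqP; rewrite eqEdim L1 dim_vline v0 andbT.
by rewrite -memvE.
Qed.

Lemma line_scale (L : {vspace V}) v w : \dim L = 1%N -> v \in L -> v != 0 ->
  w \in L -> exists t, w = t *: v.
Proof.
move=> L1 vL v0; rewrite (memv_line_dim1 L1 vL v0) => /vlineP[t ->]; by exists t.
Qed.

Lemma line_neq0 (L : {vspace V}) : \dim L = 1%N -> exists2 v, v \in L & v != 0.
Proof.
move=> L1; exists (vpick L); first exact: memv_pick.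
by rewrite vpick0 -dimv_eq0 L1.
Qed.

Lemma proj_closed_dim X L : proj_closed X -> X L -> \dim L = 1%N.
Proof. by move=> [F [_ ->]] []. Qed.

Lemma affine_cone_line X v : proj_closed X -> v != 0 ->
  affine_cone X v <-> X <[v]>%VS.
Proof.
move=> clX v0; split=> [[/eqP|[L XL vL]]|Xv]; first by rewrite (negbTE v0).
  by rewrite -(memv_line_dim1 _ vL v0) // (proj_closed_dim clX XL).
by right; exists <[v]>%VS => //; exact: memv_line.
Qed.

Lemma affine_cone_scale X t v : affine_cone X v -> affine_cone X (t *: v).
Proof.
move=> [->|[L XL vL]]; first by left; rewrite scaler0.
by right; exists L; rewrite ?memvZ.
Qed.

Lemma affine_cone_closed X : proj_closed X -> X !=set0 ->
  zariski_closed (affine_cone X).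
Proof.
move=> clX [L0 XL0]; have [F [Fh XE]] := clX; exists F.
have F0 p : F p -> peval p 0 = 0.
  by move=> Fp; move: XL0; rewrite XE => -[_ /(_ p Fp 0)]; apply; rewrite mem0v.
apply/seteqP; split => v /=.
  move=> [->|[L]]; first exact: F0.
  by rewrite XE => -[L1 LF] vL p Fp; apply: LF.
move=> Fv; have [->|v0] := eqVneq v 0; first by left.
right; exists <[v]>%VS; last exact: memv_line.
rewrite XE; split; first by rewrite dim_vline v0.
move=> p Fp w /vlineP[t ->]; have [k hp] := Fh p Fp.
by rewrite (peval_homog _ _ hp) Fv // mulr0.
Qed.

(** A line through 0 contained in the union of two closed sets is contained in
    one of them, since a product of nonzero polynomials in the parameter of the
    line is nonzero; and the lines contained in a closed set form a projective
    closed set, defined by the homogeneous parts of the equations. *)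
Lemma affine_cone_irreducible X : irreducible_in (@proj_closed K N) X ->
  irreducible_in (@zariski_closed K N) (affine_cone X).
Proof.
move=> [clX X0 irr]; split; first exact: affine_cone_closed.
  by exists 0; left.
have coneX (A : set V) : zariski_closed A -> exists2 A' : set {vspace V}, proj_closed A' &
    forall L, A' L <-> \dim L = 1%N /\ forall v, v \in L -> A v.
  move=> [F ->]; pose F' := [set q | exists p k, F p /\ q = pihomog (@mdeg N) k p].
  exists [set L | \dim L = 1%N /\ forall p, F' p -> forall v, v \in L -> peval p v = 0].
    exists F'; split=> // _ [p [k [_ ->]]]; exists k; exact: pihomogP.
  move=> L /=; split=> -[L1 h]; split=> //.
    move=> v vL p Fp; rewrite -[v]scale1r -peval_scale horner_poly big1 // => k _.
    by rewrite h ?mul0r //; exists p, k.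
  move=> _ [p [k [Fp ->]]] v vL.
  have [kp|pk] := ltnP k (mmeasure (@mdeg N) p).
    have : \poly_(k < mmeasure (@mdeg N) p) peval (pihomog (@mdeg N) k p) v = 0.
      by apply: poly_fun_eq0 => t; rewrite peval_scale h // memvZ.
    by move=> /(congr1 (fun P : {poly K} => P`_k)); rewrite coef_poly kp coef0.
  rewrite pihomogE big_seq_cond big1 ?peval0 // => m /andP[/msize_mdeg_lt mp /eqP mk].
  by move: mp; rewrite mk ltnNge pk.
move=> A B clA clB XAB.
have [A' clA' A'E] := coneX A clA; have [B' clB' B'E] := coneX B clB.
have incl (C : set V) C' : (forall L, C' L <-> \dim L = 1%N /\ forall v, v \in L -> C v) ->
    X `<=` C' -> affine_cone X `<=` C.
  move=> C'E XC v [->|[L XL vL]]; last by have /C'E[_] := XC L XL; apply.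
  by have [L XL] := X0; have /C'E[_] := XC L XL; apply; rewrite mem0v.
suff XAB' : X `<=` A' `|` B'.
  have [XA|XB] := irr A' B' clA' clB' XAB'; first by left; apply: incl XA.
  by right; apply: incl XB.
move=> L XL; have L1 := proj_closed_dim clX XL; apply: contrapT.
move=> /not_orP[nA nB].
have /existsNP[v1 /not_implyP[v1L v1A]] : ~ forall v, v \in L -> A v.
  by move=> h; apply: nA; apply/A'E.
have /existsNP[v2 /not_implyP[v2L v2B]] : ~ forall v, v \in L -> B v.
  by move=> h; apply: nB; apply/B'E.
have [v vL v0] := line_neq0 L1.
have [t1 v1E] := line_scale L1 vL v0 v1L; have [t2 v2E] := line_scale L1 vL v0 v2L.
have pol (C : set V) w t : zariski_closed C -> ~ C w -> w = t *: v ->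
    exists2 P : {poly K}, P != 0 & forall t, C (t *: v) -> P.[t] = 0.
  move=> [F ->] /existsNP[p /not_implyP[Fp pw]] wE.
  exists (\poly_(k < mmeasure (@mdeg N) p) peval (pihomog (@mdeg N) k p) v).
    by apply: contra_notN pw => /eqP P0; rewrite wE -peval_scale P0 horner0.
  by move=> s /= h; rewrite peval_scale h.
have [P P0 PA] := pol A v1 t1 clA v1A v1E; have [Q Q0 QB] := pol B v2 t2 clB v2B v2E.
have /eqP : P * Q = 0.
  apply: poly_fun_eq0 => t; rewrite hornerM.
  have [/PA ->|/QB ->] : (A `|` B) (t *: v); rewrite ?mul0r ?mulr0 //.
  by apply: XAB; right; exists L; rewrite ?memvZ.
by rewrite mulf_eq0 (negbTE P0) (negbTE Q0).
Qed.

End Cone.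

(** * Quadrics and bilinear forms *)

(** A subspace of maximal dimension among those contained in P is all of P. *)
Lemma subspace_vspace (K : fieldType) (vT : vectType K) (P : vT -> Prop) :
  P 0 -> (forall a u v, P u -> P v -> P (a *: u + v)) ->
  exists W : {vspace vT}, forall u, u \in W <-> P u.
Proof.
move=> P0 Plin.
pose sub k := `[< exists2 W : {vspace vT}, (forall u, u \in W -> P u) & \dim W = k >].
have ex0 : exists k, sub k.
  exists 0%N; apply/asboolP; exists 0%VS; last exact: dimv0.
  by move=> u; rewrite memv0 => /eqP ->.
have le k : sub k -> (k <= \dim (fullv : {vspace vT}))%N.
  by move=> /asboolP[W _ <-]; apply: dimvS; apply: subvf.
case: (ex_maxnP ex0 le) => k /asboolP[W WP Wk] kmax; exists W => u; split; first exact: WP.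
move=> Pu; suff -> : W = (W + <[u]>)%VS by rewrite memvE addvSr.
apply/eqP; rewrite eqEdim addvSl Wk; apply: kmax; apply/asboolP.
exists (W + <[u]>)%VS => // _ /memv_addP[w wW [_ /vlineP[a ->] ->]].
by rewrite addrC; apply: Plin => //; apply: WP.
Qed.

Section Quadrics.
Variables (K : numFieldType) (N : nat).
Local Notation V := 'cV[K]_N.
Implicit Types (A B M : 'M[K]_N) (x u v w : V) (X : set {vspace V}).

Lemma bilinE A u v : bilin A u v = \sum_i \sum_j A i j * (u i 0 * v j 0).
Proof.
rewrite /bilin mxE exchange_big; apply: eq_bigr => j _ /=.
rewrite mxE mulr_suml; apply: eq_bigr => i _; rewrite mxE.
by rewrite -mulrA mulrCA.
Qed.

Lemma bilinDl A u v w : bilin A (u + v) w = bilin A u w + bilin A v w.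
Proof. by rewrite /bilin linearD /= !mulmxDl mxE. Qed.
Lemma bilinDr A u v w : bilin A w (u + v) = bilin A w u + bilin A w v.
Proof. by rewrite /bilin mulmxDr mxE. Qed.
Lemma bilinZl A a u w : bilin A (a *: u) w = a * bilin A u w.
Proof. by rewrite /bilin linearZ /= -!scalemxAl mxE. Qed.
Lemma bilinZr A a u w : bilin A w (a *: u) = a * bilin A w u.
Proof. by rewrite /bilin -scalemxAr mxE. Qed.
Lemma bilinDm A B u v : bilin (A + B) u v = bilin A u v + bilin B u v.
Proof. by rewrite /bilin mulmxDr mulmxDl mxE. Qed.
Lemma bilinZm A a u v : bilin (a *: A) u v = a * bilin A u v.
Proof. by rewrite /bilin -scalemxAr -scalemxAl mxE. Qed.
Lemma bilin0m u v : bilin 0 u v = 0.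
Proof. by rewrite /bilin mulmx0 mul0mx mxE. Qed.
Lemma bilin_mulr A M u v : bilin A u (M *m v) = bilin (A *m M) u v.
Proof. by rewrite /bilin !mulmxA. Qed.
Lemma bilin_mull A M u v : bilin A (M *m u) v = bilin (M^T *m A) u v.
Proof. by rewrite /bilin trmx_mul !mulmxA. Qed.
Lemma bilinT A u v : bilin A^T u v = bilin A v u.
Proof.
by rewrite /bilin -[in RHS](mxE trmx_key (fun i j => _ j i)) -/(trmx _) !trmx_mul trmxK !mulmxA.
Qed.
Lemma bilin_sym A u v : A^T = A -> bilin A u v = bilin A v u.
Proof. by move=> sA; rewrite -[in LHS]sA bilinT. Qed.

Lemma bilin_ext A B : (forall u v, bilin A u v = bilin B u v) -> A = B.
Proof.
move=> h; apply/matrixP => i j; have := h (delta_mx i 0) (delta_mx j 0).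
have E C : bilin C (delta_mx i 0) (delta_mx j 0) = C i j.
  rewrite /bilin trmx_delta -rowE -colE !mxE //.
by rewrite !E.
Qed.

Lemma peval_quadratic_poly A v : peval (quadratic_poly A) v = bilin A v v.
Proof.
rewrite bilinE /peval /quadratic_poly raddf_sum; apply: eq_bigr => i _ /=.
rewrite raddf_sum; apply: eq_bigr => j _ /=.
by rewrite mevalZ mevalM !mevalXU.
Qed.

Lemma quadratic_poly_homog A : quadratic_poly A \is ishomog1 2 (@mdeg N).
Proof.
rewrite /quadratic_poly; apply: rpred_sum => i _; apply: rpred_sum => j _.
apply: rpredZ; rewrite -mpolyXD dhomogX /= mdegD !mdeg1 //.
Qed.

Lemma differential_quadratic_poly A x v : A^T = A ->
  differential (quadratic_poly A) x v = 2 * bilin A x v.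
Proof.
move=> sA; rewrite -differential_line.
have -> : along (line x v) (quadratic_poly A) =
    (bilin A x x)%:P + (2 * bilin A x v) *: 'X + bilin A v v *: 'X ^+ 2.
  apply/eqP; rewrite -subr_eq0; apply/eqP/poly_fun_eq0 => t.
  rewrite hornerD hornerN along_line peval_quadratic_poly !hornerE /=.
  rewrite !(bilinDl, bilinDr, bilinZl, bilinZr) (bilin_sym v x sA).
  by ring.
rewrite !derivD derivC !derivZ derivX derivXn !hornerE /= ?mulr0n; ring.
Qed.

Lemma homog2_quadratic (p : mpoly N K) : p \is ishomog1 2 (@mdeg N) ->
  exists2 B, B^T = B & p = quadratic_poly B.
Proof.
move=> /dhomogP hp.
suff [B sB pB] : exists2 B, B^T = B & forall v, peval p v = bilin B v v.
  exists B => //; apply/eqP; rewrite -subr_eq0; apply/eqP/mpoly_fun_eq0 => v.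
  rewrite mevalB; apply/eqP; rewrite subr_eq0; apply/eqP.
  pose v' : V := \col_i v i.
  have := pB v'; rewrite -peval_quadratic_poly /peval.
  by rewrite !(meval_ext (v := fun i => v' i 0) (w := v)) // => i; rewrite mxE.
rewrite (mpolyE p) /peval.
have : {subset msupp p <= [pred m | mdeg m == 2%N]} by move=> m /hp /eqP.
elim: (msupp p) => [|m s IH] sub.
  by exists 0 => [|v]; rewrite ?trmx0 // big_nil bilin0m meval0.
have [B sB pB] := IH (fun m' m's => sub m' (mem_behead (s := m :: s) m's)).
have /= /eqP m2 := sub m (mem_head _ _).
have [i mi] : exists i, m i != 0%N.
  apply/existsP; rewrite -negb_forall; apply/negP => /forallP m0.
  suff : mdeg m = 0%N by rewrite m2.
  by rewrite mdegE big1 // => i _; apply/eqP; have := m0 i.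
have [j /eqP mj] : exists j, mnm_sub m (mnm1 i) == mnm1 j.
  apply/mdeg1P/eqP; have := congr1 (fun k => k.-1) m2.
  have le : mnm_add (mnm_sub m (mnm1 i)) (mnm1 i) = m by apply: submK; rewrite lep1mP.
  by rewrite -{1}le mdegD mdeg1 addn1.
have mE : m = mnm_add (mnm1 j) (mnm1 i) by rewrite -mj submK // lep1mP.
pose E : 'M[K]_N := (mcoeff m p / 2) *: (delta_mx i j + delta_mx j i).
exists (E + B) => [|v].
  by rewrite linearD /= sB /E linearZ /= linearD /= !trmx_delta addrC [_ + delta_mx j i]addrC addrC.
rewrite big_cons mevalD pB bilinDm; congr (_ + _).
have -> : mpolyX K m = mpolyX K (mnm1 j) * mpolyX K (mnm1 i) by rewrite -mpolyXD -mE.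
rewrite mevalZ mevalM !mevalXU /E bilinZm bilinDm.
have dE a b : bilin (delta_mx a b) v v = v a 0 * v b 0.
  rewrite bilinE (bigD1 a) //= (bigD1 b) //= mxE !eqxx mul1r.
  rewrite !big1 ?addr0 // => [c ca|c cb].
    by rewrite big1 // => d _; rewrite mxE (negbTE ca) mul0r.
  by rewrite mxE (negbTE cb) andbF mul0r.
by rewrite !dE; field.
Qed.

Definition quadrics X : set 'M[K]_N :=
  [set B | B^T = B /\ forall v, affine_cone X v -> bilin B v v = 0].

Lemma quadrics_part X B : B^T = B ->
  quadratic_part X (quadratic_poly B) <-> quadrics X B.
Proof.
move=> sB; split=> [[h _]|[_ h]]; split=> //.
- by move=> v Xv; rewrite -peval_quadratic_poly; apply: h.
- by move=> v Xv; rewrite peval_quadratic_poly; apply: h.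
- exact: quadratic_poly_homog.
Qed.

Lemma quadrics0 X : quadrics X 0.
Proof. by split=> [|v _]; rewrite ?trmx0 ?bilin0m. Qed.

Lemma quadrics_lin X a A B : quadrics X A -> quadrics X B -> quadrics X (a *: A + B).
Proof.
move=> [sA hA] [sB hB]; split=> [|v Xv]; first by rewrite linearD linearZ /= sA sB.
by rewrite bilinDm bilinZm hA // hB // mulr0 addr0.
Qed.

(** At a point of X the differential of a combination of quadrics is the same
    combination of their differentials. *)
Lemma tangent_quadrics X x v : generated_by_quadrics X -> affine_cone X x ->
  tangent_space (affine_cone X) x v <-> forall B, quadrics X B -> bilin B x v = 0.
Proof.
move=> gX Xx; split=> [Tv B qB|h p pI].
  have [pB _] := (quadrics_part X qB.1).2 qB.
  have := Tv _ pB; rewrite differential_quadratic_poly; last exact: qB.1.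
  by move/eqP; rewrite mulf_eq0 pnatr_eq0 /= => /eqP.
have [k [a [f [fq ->]]]] := gX p pI.
elim/big_rec: _ => [|i q _ IH].
  by rewrite /differential big1 // => i _; rewrite mderiv0 peval0 mul0r.
rewrite differentialD IH addr0 differentialM.
have [B sB fB] := homog2_quadratic (fq i).2.
have qB : quadrics X B by apply/(quadrics_part X sB); rewrite -fB.
by rewrite fB peval_quadratic_poly qB.2 // differential_quadratic_poly // h // !mulr0 addr0.
Qed.

Lemma double_perp (P : V -> Prop) u : P 0 -> (forall a u v, P u -> P v -> P (a *: u + v)) ->
  (forall w, (forall b, P b -> (w^T *m b) 0 0 = 0) -> (w^T *m u) 0 0 = 0) -> P u.
Proof.
move=> P0 Plin h; have [W WP] := subspace_vspace P0 Plin; apply/WP.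
pose A := \matrix_(i < \dim W) ((vbasis W)`_i)^T.
have uA : (u^T <= A)%MS.
  rewrite submxE; apply/eqP/matrixP => i j; rewrite ord1 [RHS]mxE.
  pose w := col j (cokermx A).
  have -> : (u^T *m cokermx A) 0 j = (w^T *m u) 0 0.
    by rewrite !mxE; apply: eq_bigr => l _; rewrite !mxE mulrC.
  apply: h => b /WP bW; rewrite (coord_vbasis bW).
  rewrite mulmx_sumr summxE big1 // => k _; rewrite -scalemxAr mxE.
  suff -> : (w^T *m (vbasis W)`_k) 0 0 = 0 by rewrite mulr0.
  have /matrixP/(_ k j) := mulmx_coker A; rewrite [RHS]mxE => h'; rewrite -[RHS]h'.
  by rewrite !mxE; apply: eq_bigr => l _; rewrite !mxE mulrC.
have [D uD] := submxP uA.
have -> : u = \sum_(i < \dim W) D 0 i *: (vbasis W)`_i.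
  apply/matrixP => l c; rewrite ord1 summxE.
  have := congr1 (fun B : 'rV_N => B 0 l) uD; rewrite !mxE => ->.
  by apply: eq_bigr => i _; rewrite !mxE.
by apply: memv_suml => i _; apply: memvZ; apply: vbasis_mem; apply: mem_nth; rewrite size_tuple.
Qed.

End Quadrics.

(** * The infinitesimal action on bilinear forms *)

Lemma sum_triangle (V : nmodType) n (F : nat -> nat -> V) :
  \sum_(k < n) \sum_(i < k.+1) F i (k - i)%N =
  \sum_(i < n) \sum_(j < n | (i + j < n)%N) F i j.
Proof.
transitivity (\sum_(k < n) \sum_(i < n) if (i <= k)%N then F i (k - i)%N else 0).
  apply: eq_bigr => k _.
  rewrite (big_ord_widen n (fun i => F i (k - i)%N) (ltn_ord k)) big_mkcond /=.
  by apply: eq_bigr => i _; rewrite ltnS.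
rewrite exchange_big; apply: eq_bigr => i _.
rewrite -(big_mkord xpredT (fun k => if (i <= k)%N then F i (k - i)%N else 0)).
rewrite (big_cat_nat (leq0n i) (ltnW (ltn_ord i))) /= big1_seq ?add0r; last first.
  move=> k; rewrite mem_index_iota => /andP[_ ki].
  by move: ki; rewrite /= ltnNge => /negbTE ->.
rewrite -[X in index_iota X _]add0n big_addn big_mkord.
rewrite (eq_bigr (fun j : 'I_(n - i) => F i j)); last by move=> j _; rewrite leq_addl addnK.
rewrite (big_ord_widen n (F i) (leq_subr i n)); apply: eq_bigl => j.
by rewrite ltn_subRL.
Qed.

Section LieAct.
Variables (K : fieldType) (N : nat).
Implicit Types (A B M P : 'M[K]_N).

(** The infinitesimal form of the change of variables B |-> g^T B g. *)
Definition lie_act M B : 'M[K]_N := M^T *m B + B *m M.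

Lemma lie_act_is_linear M : linear (lie_act M).
Proof.
move=> a A B; rewrite /lie_act mulmxDr mulmxDl -scalemxAr -scalemxAl scalerDr.
by rewrite addrACA.
Qed.
HB.instance Definition _ M :=
  GRing.isLinear.Build K 'M[K]_N 'M[K]_N _ (lie_act M) (lie_act_is_linear M).

Lemma lie_actDm M1 M2 B : lie_act (M1 + M2) B = lie_act M1 B + lie_act M2 B.
Proof. by rewrite /lie_act linearD /= mulmxDl mulmxDr addrACA. Qed.
Lemma lie_act_conj M A B C : A *m M = M *m A -> C *m M = M *m C ->
  lie_act M (A^T *m B *m C) = A^T *m lie_act M B *m C.
Proof.
move=> cA cC; rewrite /lie_act mulmxDr mulmxDl; congr (_ + _).
  by rewrite !mulmxA -!trmx_mul cA.
by rewrite -!mulmxA cC.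
Qed.

Section Stable.
Variables (M : 'M[K]_N) (S : set 'M[K]_N).
Hypothesis S0 : S 0.
Hypothesis Slin : forall a A B, S A -> S B -> S (a *: A + B).
Hypothesis SM : forall A, S A -> S (lie_act M A).

Lemma linear_add A B : S A -> S B -> S (A + B).
Proof. by move=> SA SB; rewrite -[A]scale1r; apply: Slin. Qed.
Lemma linear_scale a A : S A -> S (a *: A).
Proof. by move=> SA; rewrite -[_ *: _]addr0; apply: Slin. Qed.
Lemma linear_sub A B : S A -> S B -> S (A - B).
Proof. by move=> SA SB; rewrite addrC -scaleN1r; apply: Slin. Qed.
Lemma linear_sum_closed (I : eqType) (r : seq I) (p : pred I) (F : I -> 'M[K]_N) :
  (forall i, i \in r -> p i -> S (F i)) -> S (\sum_(i <- r | p i) F i).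
Proof.
move=> h; rewrite big_seq_cond; elim/big_rec: _ => // i A /andP[ir pi] SA.
by apply: linear_add => //; apply: h.
Qed.

Definition lie_shift c A := lie_act M A - c *: A.

Lemma lie_shift_is_linear c : linear (lie_shift c).
Proof.
move=> a A B; rewrite /lie_shift linearP scalerDr opprD scalerBr !scalerA mulrC.
by rewrite addrACA.
Qed.
HB.instance Definition _ c :=
  GRing.isLinear.Build K 'M[K]_N 'M[K]_N _ (lie_shift c) (lie_shift_is_linear c).

Lemma lie_shift2 c d A :
  lie_shift c (lie_shift d A) = lie_act M (lie_act M A) - (c + d) *: lie_act M A + (c * d) *: A.
Proof.
rewrite {1}/lie_shift /(lie_shift d A) linearB linearZ /= scalerBr scalerA opprB scalerDl opprD.
by rewrite [_ *: A - _]addrC addrA; congr (_ + _); rewrite -!addrA [- _ - _]addrC.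
Qed.

Lemma lie_shiftC c d A : lie_shift c (lie_shift d A) = lie_shift d (lie_shift c A).
Proof. by rewrite !lie_shift2 [c + d]addrC [c * d]mulrC. Qed.

Lemma iter_lie_shiftC c d k A : iter k (lie_shift c) (lie_shift d A) = lie_shift d (iter k (lie_shift c) A).
Proof. by elim: k A => //= k IH A; rewrite IH lie_shiftC. Qed.

Lemma iter_lie_shiftCC c d k l A :
  iter k (lie_shift c) (iter l (lie_shift d) A) = iter l (lie_shift d) (iter k (lie_shift c) A).
Proof. by elim: l => //= l IH; rewrite iter_lie_shiftC IH. Qed.

Lemma iter_lie_shift_sum (I : Type) (r : seq I) (p : pred I) (F : I -> 'M[K]_N) c k :
  iter k (lie_shift c) (\sum_(i <- r | p i) F i) = \sum_(i <- r | p i) iter k (lie_shift c) (F i).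
Proof. by elim: k => //= k ->; rewrite linear_sum. Qed.

Lemma lie_shift_stable c A : S A -> S (lie_shift c A).
Proof. by move=> SA; apply: linear_sub; [apply: SM|apply: linear_scale]. Qed.

(** On the generalized eigenspace of c the operator lie_shift d is invertible,
    so nothing is lost modulo S by applying it. *)
Lemma eigen_descend1 c d k A : c != d -> iter k (lie_shift c) A = 0 -> S (lie_shift d A) -> S A.
Proof.
move=> cd; elim: k A => [|k IH] A /=; first by move=> ->.
rewrite -iterS iterSr => Ak Sd.
have Sc : S (lie_shift c A) by apply: IH => //; rewrite lie_shiftC; apply: lie_shift_stable.
have -> : A = (c - d)^-1 *: (lie_shift d A - lie_shift c A).
  have -> : lie_shift d A - lie_shift c A = (c - d) *: A.
    by rewrite scalerBl /lie_shift opprB addrC addrA subrK.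
  by rewrite scalerA mulVf ?subr_eq0 // scale1r.
by apply: linear_scale; apply: linear_sub.
Qed.

Lemma eigen_descend c d k l A : c != d -> iter k (lie_shift c) A = 0 ->
  S (iter l (lie_shift d) A) -> S A.
Proof.
move=> cd; elim: l A => [//|l IH] A Ak; rewrite iterSr => Sl.
apply: (eigen_descend1 cd Ak); apply: IH => //.
by rewrite iter_lie_shiftC Ak linear0.
Qed.

(** A stable subspace contains the components of its elements in the
    generalized eigenspaces: a power of lie_shift d removes the component of d,
    the induction applies to what remains, and eigen_descend leads back to A. *)
Lemma eigencomponents_stable (t : seq K) (A : K -> 'M[K]_N) k : uniq t ->
  (forall c, c \in t -> iter k (lie_shift c) (A c) = 0) -> S (\sum_(c <- t) A c) ->
  forall c, c \in t -> S (A c).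
Proof.
elim: t A => [//|d t IH] A /= /andP[dt ut] Ak; rewrite big_cons => SA.
have St c : c \in t -> S (A c).
  move=> ct; apply: (@eigen_descend c d k k).
  - by apply: contraNneq dt => <-.
  - by apply: Ak; rewrite inE ct orbT.
  apply: (IH (fun c => iter k (lie_shift d) (A c))) => // [c' c't|].
    rewrite iter_lie_shiftCC Ak ?inE ?c't ?orbT //.
    by elim: (k) => //= k' ->; rewrite linear0.
  have : S (iter k (lie_shift d) (A d + \sum_(c <- t) A c)).
    by elim: (k) => //= k' IHk; apply: lie_shift_stable.
  have -> : forall B C, iter k (lie_shift d) (B + C) = iter k (lie_shift d) B + iter k (lie_shift d) C.
    by move=> B C; elim: (k) => //= k' ->; rewrite linearD.
  by rewrite Ak ?mem_head // add0r iter_lie_shift_sum.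
move=> c; rewrite inE => /predU1P[->|]; last exact: St.
rewrite -[A d](addrK (\sum_(c <- t) A c)); apply: linear_sub => //.
by apply: linear_sum_closed => c' c't _; apply: St.
Qed.

End Stable.
End LieAct.

Section DividedPowers.
Variables (K : numFieldType) (N : nat).
Implicit Types (A B M P : 'M[K]_N).

Definition dpow P k : 'M[K]_N := (k`!%:R)^-1 *: P ^+ k.

Lemma dpowSr P k : dpow P k *m P = k.+1%:R *: dpow P k.+1.
Proof.
rewrite /dpow scalerA factS natrM invfM mulrA mulfV ?pnatr_eq0 // mul1r.
by rewrite -scalemxAl exprSr.
Qed.

Lemma dpow0 P : dpow P 0 = 1%:M.
Proof. by rewrite /dpow fact0 invr1 scale1r expr0. Qed.

Lemma dpow_nil P m k : P ^+ m = 0 -> (m <= k)%N -> dpow P k = 0.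
Proof. by move=> Pm mk; rewrite /dpow -(subnK mk) exprD Pm mulr0 scaler0. Qed.

(** The part of degree k in P of exp(P)^T A exp(P). It is computed from the
    action of P by the differential equation exp_partS. *)
Definition exp_part P A k := \sum_(i < k.+1) (dpow P i)^T *m A *m dpow P (k - i).

Lemma exp_partS P A k : lie_act P (exp_part P A k) = k.+1%:R *: exp_part P A k.+1.
Proof.
rewrite /exp_part /lie_act mulmx_sumr mulmx_suml.
have -> : k.+1%:R *: \sum_(i < k.+2) (dpow P i)^T *m A *m dpow P (k.+1 - i) =
    \sum_(i < k.+2) i%:R *: ((dpow P i)^T *m A *m dpow P (k.+1 - i)) +
    \sum_(i < k.+2) (k.+1 - i)%:R *: ((dpow P i)^T *m A *m dpow P (k.+1 - i)).
  rewrite scaler_sumr -big_split /=; apply: eq_bigr => i _.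
  by rewrite -scalerDl -natrD subnKC // -ltnS.
congr (_ + _).
  rewrite [RHS]big_ord_recl /= scale0r add0r; apply: eq_bigr => i _.
  rewrite !mulmxA -trmx_mul dpowSr [(_ *: _)^T]linearZ /=.
  by rewrite -!scalemxAl subSS.
rewrite [RHS]big_ord_recr /= subnn scale0r addr0; apply: eq_bigr => i _.
by rewrite -!mulmxA dpowSr -!scalemxAr subSn // -ltnS.
Qed.

Lemma iter_lie_act P A k : iter k (lie_act P) A = k`!%:R *: exp_part P A k.
Proof.
elim: k => [|k IH].
  by rewrite /exp_part big_ord1 /= dpow0 trmx1 mul1mx mulmx1 scale1r.
by rewrite iterS IH linearZ /= exp_partS scalerA -natrM mulnC.
Qed.

Lemma iter_lie_act_nil P A m : P ^+ m = 0 -> iter (m + m) (lie_act P) A = 0.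
Proof.
move=> Pm; rewrite iter_lie_act /exp_part big1 ?scaler0 // => i _.
have [mi|im] := leqP m i; first by rewrite (dpow_nil Pm mi) trmx0 !mul0mx.
by rewrite (dpow_nil Pm (k := _ - _)) ?mulmx0 //; lia.
Qed.

(** The exponential of a matrix P such that P ^+ m = 0. *)
Definition expnil m P := \sum_(i < m) dpow P i.

Lemma expnil_act m P A : P ^+ m = 0 ->
  (expnil m P)^T *m A *m expnil m P = \sum_(k < m + m) exp_part P A k.
Proof.
move=> Pm; pose F i j := (dpow P i)^T *m A *m dpow P j.
have F0l i j : (m <= i)%N -> F i j = 0.
  by move=> mi; rewrite /F (dpow_nil Pm mi) trmx0 !mul0mx.
have F0r i j : (m <= j)%N -> F i j = 0.
  by move=> mj; rewrite /F (dpow_nil Pm mj) mulmx0.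
have -> : (expnil m P)^T *m A *m expnil m P = \sum_(i < m) \sum_(j < m) F i j.
  rewrite /expnil [(\sum_(_ < _) _)^T]linear_sum /= !mulmx_suml; apply: eq_bigr => i _.
  by rewrite mulmx_sumr.
rewrite (sum_triangle _ F) (big_ord_widen _ (fun i => \sum_(j < m) F i j) (leq_addr m m)).
rewrite big_mkcond /=; apply: eq_bigr => i _; case: ltnP => mi; last first.
  by rewrite big1 // => j _; apply: F0l.
rewrite (big_ord_widen _ (F i) (leq_addr m m)) big_mkcond [RHS]big_mkcond /=.
apply: eq_bigr => j _; case: ltnP => mj; last by rewrite F0r // if_same.
by rewrite (_ : (i + j < m + m)%N) // -addSn leq_add // ltnW.
Qed.

Lemma expnil_stable (S : set 'M[K]_N) m P A : S 0 ->
  (forall a A B, S A -> S B -> S (a *: A + B)) ->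
  (forall A, S A -> S (lie_act P A)) -> P ^+ m = 0 ->
  S A -> S ((expnil m P)^T *m A *m expnil m P).
Proof.
move=> S0 Slin SP Pm SA; rewrite expnil_act //.
apply: (linear_sum_closed S0 Slin) => k _ _.
have -> : exp_part P A k = (k`!%:R)^-1 *: iter k (lie_act P) A.
  by rewrite iter_lie_act scalerA mulVf ?scale1r // pnatr_eq0 -lt0n fact_gt0.
apply: linear_scale => //; elim: (k : nat) => //= k' IH; exact: SP.
Qed.

End DividedPowers.

(** * Jordan decomposition and integral coordinates *)

Section Jordan.
Variable K : closedFieldType.

Lemma coprime_factor (s : seq K) (y : K) m : y \notin s ->
  coprimep (\prod_(x <- s) ('X - x%:P) ^+ m) (('X - y%:P) ^+ m).
Proof.
move=> ys; apply: coprimep_expr; rewrite coprimep_XsubC /root horner_prod.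
rewrite prodf_seq_neq0; apply/allP => x xs /=.
rewrite horner_exp hornerXsubC expf_neq0 // subr_eq0.
by apply: contraNneq ys => ->.
Qed.

(** The Chinese remainder theorem for powers of distinct linear factors. *)
Lemma interpolation (s : seq K) (c : K -> {poly K}) m : uniq s ->
  exists p, forall x, x \in s -> ('X - x%:P) ^+ m %| p - c x.
Proof.
elim: s => [|y s IH] /=; first by exists 0.
move=> /andP[ys /IH[p0 p0P]]; pose Q := \prod_(x <- s) ('X - x%:P) ^+ m.
have /Bezout_eq1_coprimepP[[u v] /= uv] := coprime_factor m ys.
exists (p0 + (c y - p0) * (u * Q)) => x; rewrite inE => /predU1P[->|xs].
  rewrite (_ : _ - c y = (p0 - c y) * v * ('X - y%:P) ^+ m) ?dvdp_mull //.
  have -> : u * Q = 1 - v * ('X - y%:P) ^+ m by rewrite -uv addrK.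
  by ring.
rewrite addrAC dvdp_addr ?p0P // !dvdp_mull //.
by rewrite /Q (big_rem x) //= dvdp_mulr.
Qed.

Lemma dvdp_factors (s : seq K) m (p : {poly K}) : uniq s ->
  (forall x, x \in s -> ('X - x%:P) ^+ m %| p) ->
  \prod_(x <- s) ('X - x%:P) ^+ m %| p.
Proof.
elim: s => [|y s IH] /=; first by rewrite big_nil dvd1p.
move=> /andP[ys us] h; rewrite big_cons mulrC Gauss_dvdp ?coprime_factor //.
by rewrite IH // ?h ?mem_head // => x xs; rewrite h // inE xs orbT.
Qed.

(** The spectral projectors E, indexed by the eigenvalues s, and the nilpotent
    part P of the matrix M. *)
Definition jordan_form N (M : 'M[K]_N) (s : seq K) (E : K -> 'M[K]_N) (m : nat)
    (P : 'M[K]_N) : Prop :=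
  [/\ uniq s, \sum_(x <- s) E x = 1%:M,
      forall x y, x \in s -> y \in s -> E x *m E y = if x == y then E x else 0,
      forall x, E x *m P = P *m E x &
      M = \sum_(x <- s) x *: E x + P /\ P ^+ m = 0].

(** The projectors and the semisimple part are polynomials in M: modulo each
    factor (X - x)^m of a multiple of the characteristic polynomial they are
    congruent to constants. *)
Lemma jordan_exists N (M : 'M[K]_N) : exists s E m P, jordan_form M s E m P.
Proof.
case: N M => [|N] M.
  have all_eq (A B : 'M[K]_0) : A = B by apply/matrixP => -[].
  by exists [::], (fun=> 0), 0%N, M; split=> //; do ?split; apply: all_eq.
have [r0 chiE] := closed_field_poly_normal (char_poly M).
rewrite (monicP (char_poly_monic M)) scale1r in chiE.
pose m := size r0; pose s := undup r0; have us : uniq s := undup_uniq r0.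
have kill p : (forall x, x \in s -> ('X - x%:P) ^+ m %| p) -> horner_mx M p = 0.
  move=> h; suff : char_poly M %| p.
    by move=> /dvdpP[q ->]; rewrite rmorphM /= Cayley_Hamilton mulr0.
  apply: dvdp_trans (dvdp_factors us h).
  rewrite chiE -prodr_undup_exp_count -/s.
  elim/big_rec2: _ => [|x q1 q2 _ IH]; first exact: dvdpp.
  by apply: dvdp_mul IH; apply: dvdp_exp2l; apply: count_size.
pose c (x y : K) : {poly K} := (x == y)%:R.
have /choice[e eP] : forall x, exists p, forall y, y \in s -> ('X - y%:P) ^+ m %| p - c x y.
  by move=> x; apply: interpolation.
have [p pP] := interpolation (fun y => y%:P) m us.
have eqM p1 p2 : (forall x, x \in s -> ('X - x%:P) ^+ m %| p1 - p2) ->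
    horner_mx M p1 = horner_mx M p2.
  by move=> /kill h; apply/eqP; rewrite -subr_eq0 -rmorphB /= h.
have sum_e : forall y, y \in s -> ('X - y%:P) ^+ m %| \sum_(x <- s) e x - 1.
  move=> y ys; have -> : 1 = \sum_(x <- s) c x y.
    rewrite (bigD1_seq y) //= big1 => [|x xy]; first by rewrite /c eqxx addr0.
    by rewrite /c (negbTE xy).
  rewrite -sumrB; elim/big_rec: _ => [|x q _ IH]; first exact: dvdp0.
  by rewrite dvdp_addr ?eP.
exists s, (fun x => horner_mx M (e x)), m, (horner_mx M ('X - p)); split=> //.
- by rewrite -rmorph_sum /= (eqM _ 1 sum_e) rmorph1.
- move=> x y xs ys; rewrite mulmxE -rmorphM.
  have -> : (if x == y then horner_mx M (e x) else 0) = horner_mx M (c x y * e x).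
    by rewrite /c; case: ifP => _; rewrite ?mul1r ?mul0r ?rmorph0.
  apply: eqM => z zs.
  rewrite [X in _ %| X](_ : _ = e x * (e y - c y z) + (e x - c x z) * (c y z - c x y)
     + c x z * (c y z - c x y)); last by ring.
  rewrite [c x z * _](_ : _ = 0); last first.
    by rewrite /c; case: (x =P z) => [->|]; rewrite ?mul0r // (eq_sym z y) subrr mulr0.
  by rewrite addr0 dvdp_addr; [apply: dvdp_mulr|apply: dvdp_mull]; apply: eP.
- by move=> x; rewrite !mulmxE -!rmorphM /= mulrC.
split; last first.
  rewrite -rmorphXn; apply: kill => x xs; rewrite dvdp_exp2r //.
  rewrite (_ : 'X - p = 'X - x%:P - (p - x%:P)); last by ring.
  have [m0|m0] := posnP m; first by move: xs; rewrite /s (size0nil m0).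
  rewrite dvdp_subr //; apply: dvdp_trans (pP x xs).
  by rewrite -{1}(expr1 ('X - _)); apply: dvdp_exp2l.
rewrite -{1}(horner_mx_X M) rmorphB /= addrCA; apply/eqP; rewrite -subr_eq0.
rewrite opprD addrA subrr add0r.
rewrite (_ : \sum_(x <- s) _ = horner_mx M (\sum_(x <- s) x%:P * e x)); last first.
  rewrite rmorph_sum; apply: eq_bigr => x _.
  by rewrite rmorphM /= horner_mx_C -mulmxE mul_scalar_mx.
rewrite oppr_eq0 subr_eq0; apply/eqP; apply: eqM => y ys.
rewrite [X in _ %| X](_ : _ = \sum_(x <- s) (x%:P * (e x - c x y)) - (p - y%:P)).
  rewrite dvdp_subl ?pP //.
  elim/big_rec: _ => [|x q _ IH]; first exact: dvdp0.
  by rewrite dvdp_addr // dvdp_mull ?eP.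
under [in RHS]eq_bigr do rewrite mulrBr.
rewrite sumrB [X in _ - X - _](_ : _ = y%:P); first by ring.
rewrite (bigD1_seq y) //= big1 => [|x xy]; first by rewrite /c eqxx addr0 mulr1.
by rewrite /c (negbTE xy) mulr0.
Qed.

End Jordan.

(** The additive group spanned by finitely many scalars is free: a family b of
    minimal size over which they have integral coordinates satisfies no
    relation, since a relation would express the scalars over a smaller family. *)
Lemma integral_coordinates (K : numFieldType) (s : seq K) :
  exists r (b : 'I_r -> K) (z : K -> 'I_r -> int),
    (forall x, x \in s -> x = \sum_j b j *~ z x j) /\
    (forall c : 'I_r -> int, \sum_j b j *~ c j = 0 -> forall j, c j = 0).
Proof.
pose rep r := `[< exists (b : 'I_r -> K) (z : K -> 'I_r -> int),
  forall x, x \in s -> x = \sum_j b j *~ z x j >].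
have ex : exists r, rep r.
  exists (size s); apply/asboolP.
  exists (fun j => nth 0 s j), (fun x (j : 'I_(size s)) => (index x s == j :> nat)%:R) => x xs.
  have lt : (index x s < size s)%N by rewrite index_mem.
  rewrite (bigD1 (Ordinal lt)) //= eqxx mulr1z nth_index // big1 ?addr0 // => j jx.
  rewrite (_ : _ == _ = false) ?mulr0z //; apply/eqP => e; case/eqP: jx.
  exact/val_inj.
case: (ex_minnP ex) => r /asboolP[b [z bz]] rmin; exists r, b, z; split=> // c c0.
apply: contrapT => /existsNP[j0 /eqP cj0].
case: r b z bz rmin c c0 j0 cj0 => [|r] b z bz rmin c c0 j0 cj0; first by case: j0 cj0.
suff : (r.+1 <= r)%N by rewrite ltnn.
apply: rmin; apply/asboolP.
have cK : (c j0)%:~R != 0 :> K by rewrite intr_eq0.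
exists (fun j => b (lift j0 j) / (c j0)%:~R),
  (fun x j => z x (lift j0 j) * c j0 - z x j0 * c (lift j0 j)) => x xs.
rewrite {1}(bz x xs) (bigD1_ord j0) //=.
move: c0; rewrite (bigD1_ord j0) //= => /eqP; rewrite addr_eq0 => /eqP c0.
have bj0 : b j0 = - (\sum_(j < r) b (lift j0 j) *~ c (lift j0 j)) / (c j0)%:~R.
  by rewrite -c0 -mulrzr mulfK.
rewrite bj0 -mulrzr !mulNr !mulr_suml -sumrN -big_split /=.
apply: eq_bigr => j _.
rewrite -[b _ *~ c _]mulrzr -[b _ *~ z _ _]mulrzr -[_ *~ (_ - _)]mulrzr.
by rewrite rmorphB !rmorphM /=; field.
Qed.

(** * Tangent spaces of Legendrian cones *)

Section Legendrian.
Variables (K : numFieldType) (N : nat).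
Local Notation V := 'cV[K]_N.
Implicit Types (A B M : 'M[K]_N) (x u v w : V).
Variables (Om : 'M[K]_N) (X : set {vspace V}).
Hypothesis symOm : symplectic_form Om.
Hypothesis irrX : irreducible_in (@proj_closed K N) X.
Hypothesis legX : legendrian Om X.
Hypothesis genX : generated_by_quadrics X.
Local Notation Y := (affine_cone X).


(** The Lie algebra of the quadrics through X: under rho the endomorphism M
    comes from the quadratic form v |-> - Om (v, M v) / 2. *)
Definition hamiltonian : set 'M[K]_N := [set M | quadrics X (Om *m M)].

Lemma Om_skew u v : bilin Om u v = - bilin Om v u.
Proof.
have := symOm.1 (u + v); rewrite !(bilinDl, bilinDr) !symOm.1 add0r addr0.
by move/eqP; rewrite addr_eq0 => /eqP.
Qed.

Lemma Om_tr : Om^T = - Om.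
Proof.
apply: bilin_ext => u v; rewrite bilinT Om_skew -[- Om]scaleN1r bilinZm.
by rewrite mulN1r.
Qed.

Lemma lagrangian_perp W u : lagrangian Om W ->
  (forall w, w \in W -> bilin Om u w = 0) -> u \in W.
Proof.
move=> [isoW maxW] uW; have <- : (W + <[u]>)%VS = W.
  apply: maxW; last exact: addvSl.
  move=> _ _ /memv_addP[w1 w1W [_ /vlineP[a ->] ->]] /memv_addP[w2 w2W [_ /vlineP[b ->] ->]].
  rewrite !(bilinDl, bilinDr, bilinZl, bilinZr) (isoW _ _ w1W w2W) uW // symOm.1.
  by rewrite Om_skew uW // !(mulr0, oppr0, addr0).
by rewrite memvE addvSr.
Qed.

(** The tangent space of the cone at a smooth point is swept out by the
    Hamiltonian endomorphisms: it is the common kernel of the differentials of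
    the quadrics, hence the symplectic orthogonal of their Hamiltonian vectors,
    and it equals its own orthogonal. *)
Lemma tangent_hamiltonian x v : smooth_at Y x -> x != 0 ->
  tangent_space Y x v <-> exists2 M, hamiltonian M & v = M *m x.
Proof.
move=> smx x0; have [W [WT lagW]] := legX smx x0; have Yx := smx.1.
have WE w : w \in W <-> tangent_space Y x w by rewrite -WT.
split=> [Tv|[M hM ->]]; last first.
  apply/WE; apply: (lagrangian_perp lagW) => w /WE Tw.
  rewrite Om_skew bilin_mulr bilin_sym; last exact: hM.1.
  by rewrite ((tangent_quadrics _ genX Yx).1 Tw) ?oppr0.
pose P u := exists2 M, hamiltonian M & u = M *m x.
have uOm : Om \in unitmx.
  rewrite -unitmx_tr -row_free_unit -kermx_eq0; apply/rowV0P => u /sub_kermxP uO.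
  have : u^T = 0 :> V.
    apply: symOm.2 => w; rewrite Om_skew /bilin -mulmxA.
    have -> : Om *m u^T = 0 by rewrite -[Om]trmxK -trmx_mul uO trmx0.
    by rewrite mulmx0 mxE oppr0.
  by move/(congr1 trmx); rewrite trmxK trmx0.
suff [B qB BE] : exists2 B, quadrics X B & Om *m v = B *m x.
  exists (invmx Om *m B); first by rewrite /hamiltonian /= mulKVmx.
  by rewrite -mulmxA -BE mulKmx.
apply: (double_perp (P := fun b => exists2 B, quadrics X B & b = B *m x)).
- by exists 0; [exact: quadrics0|rewrite mul0mx].
- move=> a _ _ [A qA ->] [B qB ->]; exists (a *: A + B); first exact: quadrics_lin.
  by rewrite mulmxDl scalemxAl.
move=> w hw; rewrite mulmxA -/(bilin Om w v); apply: lagW.1; apply/WE => //.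
apply/(tangent_quadrics _ genX Yx) => B qB.
rewrite bilin_sym; last exact: qB.1.
by rewrite /bilin -mulmxA; apply: hw; exists B.
Qed.

Lemma cone_irreducible : irreducible_in (@zariski_closed K N) Y.
Proof. exact: affine_cone_irreducible. Qed.

Lemma smooth_dense : exists D, ~ vanishing_ideal Y D /\
  forall x, Y x -> peval D x != 0 -> smooth_at Y x /\ x != 0.
Proof.
have prY := irreducible_prime cone_irreducible.
have [d [_ _ _ [D [nD Dsm]]]] := generic_smooth cone_irreducible.
have [clX [L XL] _] := irrX.
have [v vL v0] := line_neq0 (proj_closed_dim clX XL).
have [i vi] : exists i, v i 0 != 0.
  apply/existsP; rewrite -negb_forall; apply: contraNN v0 => /forallP v0.
  by apply/eqP/matrixP => i j; rewrite ord1 mxE; apply/eqP; have := v0 i.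
exists (D * mpolyX K (mnm1 i)); split.
  move=> /prY.2[//|] /(_ v); rewrite pevalX => vi0.
  by move/eqP: vi; apply; apply: vi0; right; exists L.
move=> x Yx; rewrite pevalM mulf_eq0 negb_or pevalX => /andP[Dx xi].
by split; [apply: Dsm|apply: contraNneq xi => ->; rewrite mxE].
Qed.

Lemma vanishing_on_smooth p :
  (forall x, smooth_at Y x -> x != 0 -> peval p x = 0) -> vanishing_ideal Y p.
Proof.
move=> psm; have prY := irreducible_prime cone_irreducible.
have [D [nD Dsm]] := smooth_dense.
suff /prY.2[//|] : vanishing_ideal Y (p * D) by [].
move=> x Yx; rewrite pevalM; have [->|Dx] := eqVneq (peval D x) 0; first by rewrite mulr0.
by have [sx x0] := Dsm x Yx Dx; rewrite psm // mul0r.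
Qed.

Lemma quadrics_on_smooth B : B^T = B ->
  (forall x, smooth_at Y x -> x != 0 -> bilin B x x = 0) -> quadrics X B.
Proof.
move=> sB h; apply/(quadrics_part X sB); split; last exact: quadratic_poly_homog.
by apply: vanishing_on_smooth => x sx x0; rewrite peval_quadratic_poly h.
Qed.

Lemma lie_act_sym M B : B^T = B -> (lie_act M B)^T = lie_act M B.
Proof. by move=> sB; rewrite /lie_act linearD /= !trmx_mul trmxK sB addrC. Qed.

Lemma bilin_lie_act M B x : B^T = B -> bilin (lie_act M B) x x = 2 * bilin B x (M *m x).
Proof.
move=> sB; rewrite /lie_act bilinDm -bilin_mull -bilin_mulr (bilin_sym _ _ sB).
by ring.
Qed.

(** If M is Hamiltonian, M x is tangent to the cone at a smooth point x, so the
    derivatives of the quadrics along M vanish at all smooth points, which are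
    dense. Conversely, if M preserves the quadrics, both x and M x are tangent at
    x, so Om (x, M x) = 0. This description of the Hamiltonian endomorphisms
    makes sense for each part of a Jordan decomposition. *)
Lemma hamiltonianP M : hamiltonian M <->
  lie_act M Om = 0 /\ forall B, quadrics X B -> quadrics X (lie_act M B).
Proof.
split=> [hM|[MO MB]].
  split=> [|B qB].
    have sM := hM.1; rewrite trmx_mul Om_tr mulmxN in sM.
    by rewrite /lie_act -[Om *m M]sM subrr.
  apply: quadrics_on_smooth; first by apply: lie_act_sym; exact: qB.1.
  move=> x sx x0; rewrite bilin_lie_act; last exact: qB.1.
  rewrite ((tangent_quadrics _ genX sx.1).1 _ B qB) ?mulr0 //.
  by apply/tangent_hamiltonian => //; exists M.
apply: quadrics_on_smooth.
  rewrite trmx_mul Om_tr mulmxN; apply/eqP; rewrite eq_sym -addr_eq0 addrC.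
  by rewrite -/(lie_act M Om) MO.
move=> x sx x0; rewrite -bilin_mulr.
have [W [WT lagW]] := legX sx x0.
have WE w : w \in W <-> tangent_space Y x w by rewrite -WT.
apply: lagW.1; apply/WE; apply/(tangent_quadrics _ genX sx.1) => B qB.
  by rewrite qB.2 //; exact: sx.1.
have := (MB B qB).2 x sx.1; rewrite bilin_lie_act; last exact: qB.1.
by move/eqP; rewrite mulf_eq0 pnatr_eq0 /= => /eqP.
Qed.

Lemma hamiltonian0 : hamiltonian 0.
Proof. by rewrite /hamiltonian /= mulmx0; exact: quadrics0. Qed.

Lemma hamiltonian_lin a M1 M2 : hamiltonian M1 -> hamiltonian M2 ->
  hamiltonian (a *: M1 + M2).
Proof.
by move=> h1 h2; rewrite /hamiltonian /= mulmxDr -scalemxAr; apply: quadrics_lin.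
Qed.

End Legendrian.

Lemma rho_hamiltonian (K : numFieldType) (n : nat) (Om S : 'M[K]_(n + n))
    (X : set {vspace 'cV[K]_(n + n)}) : symplectic_basis Om S ->
  rho_quadratic_part S X = hamiltonian Om X.
Proof.
move=> [uS SOm].
have uST : S^T \in unitmx by rewrite unitmx_tr.
have JJ : Jmx K n *m Jmx K n = - 1%:M.
  rewrite /Jmx mulmx_block !mul0mx !mulmx0 !mul1mx !mulmx1 !add0r !addr0.
  by rewrite (@scalar_mx_block _ n n 1) opp_block_mx !oppr0.
have OmE : Om = (invmx S)^T *m Jmx K n *m invmx S.
  by rewrite -SOm trmx_inv -!mulmxA mulmxV // mulmx1 mulKmx.
have OmM A : Om *m (S *m (2%:R *: (Jmx K n *m A)) *m invmx S) =
    (- 2) *: ((invmx S)^T *m A *m invmx S).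
  rewrite OmE -!mulmxA mulKmx // -scalemxAl -!scalemxAr !mulmxA.
  rewrite -[_ *m Jmx K n *m Jmx K n]mulmxA JJ mulmxN mulmx1 !mulNmx scalerN.
  by rewrite scaleNr.
apply/seteqP; split=> M.
  move=> [A [sA /quadrics_part qA ->]]; rewrite /hamiltonian /= OmM.
  rewrite -[_ *: _]addr0; apply: quadrics_lin; last exact: quadrics0.
  by apply: qA; rewrite !trmx_mul trmxK sA mulmxA.
rewrite /hamiltonian /= => qM.
pose B := Om *m M; pose A := S^T *m (- 2^-1 *: B) *m S.
have AB : (invmx S)^T *m A *m invmx S = - 2^-1 *: B.
  by rewrite /A trmx_inv !mulmxA mulVmx // mul1mx -mulmxA mulmxV // mulmx1.
exists A; split.
- by rewrite /A !trmx_mul trmxK linearZ /= qM.1 mulmxA.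
- rewrite AB; apply/quadrics_part; first by rewrite linearZ /= qM.1.
  by rewrite -[_ *: _]addr0; apply: quadrics_lin qM _; exact: quadrics0.
have uOm : Om \in unitmx.
  rewrite OmE !unitmx_mul trmx_inv !unitmx_inv uST uS andbT /=.
  have JN : Jmx K n *m (- Jmx K n) = 1%:M by rewrite mulmxN JJ opprK.
  by have [-> _] := mulmx1_unit JN.
rewrite -[LHS](mulKmx uOm) -[RHS](mulKmx uOm) OmM AB scalerA.
by rewrite mulrNN mulfV ?pnatr_eq0 // scale1r.
Qed.

(** * Replicas of infinitesimal symmetries *)

Definition projectors (K : fieldType) N (s : seq K) (E : K -> 'M[K]_N) : Prop :=
  [/\ uniq s, \sum_(x <- s) E x = 1%:M &
      forall x y, x \in s -> y \in s -> E x *m E y = if x == y then E x else 0].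

Section Projectors.
Variables (K : fieldType) (N : nat) (s : seq K) (E : K -> 'M[K]_N).
Implicit Types (A B M P : 'M[K]_N) (f g : K -> K).
Hypothesis prE : projectors s E.

Definition spectral f : 'M[K]_N := \sum_(x <- s) f x *: E x.

Lemma spectral_mul f x : x \in s -> E x *m spectral f = f x *: E x.
Proof.
move=> xs; have [us _ orth] := prE.
rewrite /spectral mulmx_sumr (bigD1_seq x) //= big1_seq => [|y /andP[yx ys]].
  by rewrite -scalemxAr orth // eqxx addr0.
by rewrite -scalemxAr orth // eq_sym (negbTE yx) scaler0.
Qed.

Lemma mul_spectral f x : x \in s -> spectral f *m E x = f x *: E x.
Proof.
move=> xs; have [us _ orth] := prE.
rewrite /spectral mulmx_suml (bigD1_seq x) //= big1_seq => [|y /andP[yx ys]].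
  by rewrite -scalemxAl orth // eqxx addr0.
by rewrite -scalemxAl orth // (negbTE yx) scaler0.
Qed.

Lemma spectralM f g : spectral f *m spectral g = spectral (fun x => f x * g x).
Proof.
rewrite {1}/spectral mulmx_suml [LHS]big_seq [RHS]big_seq; apply: eq_bigr => x xs.
by rewrite -scalemxAl spectral_mul // scalerA.
Qed.

Lemma spectral1 : spectral (fun=> 1) = 1%:M.
Proof.
have [_ <- _] := prE; rewrite /spectral; apply: eq_bigr => x _.
by rewrite scale1r.
Qed.

Lemma eq_spectral f g : (forall x, x \in s -> f x = g x) -> spectral f = spectral g.
Proof. by move=> fg; rewrite /spectral !big_seq; apply: eq_bigr => x /fg ->. Qed.

(** The part of the bilinear form A of weight x + y. *)
Definition block A x y := (E x)^T *m A *m E y.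

Lemma block_decomp A : A = \sum_(x <- s) \sum_(y <- s) block A x y.
Proof.
have [_ E1 _] := prE; rewrite -{1}[A]mulmx1 -{1}E1 -{1}[A]mul1mx -trmx1 -{1}E1.
rewrite [(\sum_(_ <- _) _)^T]linear_sum /= !mulmx_suml; apply: eq_bigr => x _.
by rewrite mulmx_sumr.
Qed.

Lemma spectral_conj f g A : (spectral f)^T *m A *m spectral g =
  \sum_(x <- s) \sum_(y <- s) (f x * g y) *: block A x y.
Proof.
rewrite {1}/spectral [(\sum_(_ <- _) _)^T]linear_sum /= !mulmx_suml.
apply: eq_bigr => x _; rewrite mulmx_sumr; apply: eq_bigr => y _.
by rewrite [(_ *: _)^T]linearZ /= -!scalemxAl -scalemxAr scalerA.
Qed.

Lemma lie_act_spectral f A : lie_act (spectral f) A =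
  \sum_(x <- s) \sum_(y <- s) (f x + f y) *: block A x y.
Proof.
have -> : lie_act (spectral f) A = (spectral f)^T *m A *m spectral (fun=> 1) +
    (spectral (fun=> 1))^T *m A *m spectral f.
  by rewrite spectral1 trmx1 mul1mx mulmx1.
rewrite !spectral_conj -big_split; apply: eq_bigr => x _ /=.
rewrite -big_split; apply: eq_bigr => y _ /=.
by rewrite -scalerDl mulr1 mul1r.
Qed.

End Projectors.

Section Replica.
Variables (K : numClosedFieldType) (N : nat) (M : 'M[K]_N).
Variables (s : seq K) (E : K -> 'M[K]_N) (m : nat) (P : 'M[K]_N).
Hypothesis jM : jordan_form M s E m P.

Lemma jordan_projectors : projectors s E.
Proof. by case: jM. Qed.

Lemma jordan_spectral : M = spectral s E id + P.
Proof. by case: jM => _ _ _ _ []. Qed.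

Lemma lie_shift_block A x y : x \in s -> y \in s ->
  lie_shift M (x + y) (block E A x y) = block E (lie_act P A) x y.
Proof.
move=> xs ys; have [_ _ _ comEP _] := jM.
rewrite /lie_shift {1}jordan_spectral lie_actDm.
rewrite [lie_act P _]lie_act_conj ?comEP // addrAC -[RHS]add0r; congr (_ + _).
rewrite /lie_act /block !mulmxA -trmx_mul -(mulmxA _ (E y)).
rewrite !(spectral_mul jordan_projectors) // linearZ /= -!scalemxAl -scalemxAr.
by rewrite scalerDl subrr.
Qed.

Lemma iter_lie_shift_block A x y : x \in s -> y \in s ->
  iter (m + m) (lie_shift M (x + y)) (block E A x y) = 0.
Proof.
move=> xs ys; have [_ _ _ _ [_ Pm]] := jM.
have H k : iter k (lie_shift M (x + y)) (block E A x y) = block E (iter k (lie_act P) A) x y.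
  by elim: k => //= k ->; rewrite lie_shift_block.
by rewrite H iter_lie_act_nil // /block mulmx0 mul0mx.
Qed.

(** The blocks with a given sum x + y add up to a component of A in a
    generalized eigenspace of lie_act M, and these components stay in S. *)
Lemma weight_combination (S : set 'M[K]_N) (w : K -> K -> K) A :
  S 0 -> (forall a A B, S A -> S B -> S (a *: A + B)) ->
  (forall A, S A -> S (lie_act M A)) ->
  (forall x y x' y', x \in s -> y \in s -> x' \in s -> y' \in s ->
    x + y = x' + y' -> w x y = w x' y') ->
  S A -> S (\sum_(x <- s) \sum_(y <- s) w x y *: block E A x y).
Proof.
move=> S0 Slin SM wE SA.
pose prs := [seq (x, y) | x <- s, y <- s].
pose t := undup [seq p.1 + p.2 | p <- prs].
have sumE (F : K -> K -> 'M[K]_N) : \sum_(x <- s) \sum_(y <- s) F x y =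
    \sum_(c <- t) \sum_(p <- prs | p.1 + p.2 == c) F p.1 p.2.
  rewrite [RHS](exchange_big_dep xpredT) //= [RHS]big_seq.
  transitivity (\sum_(p <- prs) F p.1 p.2).
    by rewrite big_allpairs.
  rewrite big_seq; apply: eq_bigr => p pp.
  rewrite -big_filter (eq_filter (a2 := pred1 (p.1 + p.2))); last first.
    by move=> c /=; rewrite eq_sym.
  rewrite filter_pred1_uniq ?undup_uniq ?big_seq1 // mem_undup.
  exact: (map_f (fun p => p.1 + p.2)).
have mem_prs p : p \in prs -> p.1 \in s /\ p.2 \in s.
  by move=> /allpairsP[q [q1 q2 ->]].
pose Ac c := \sum_(p <- prs | p.1 + p.2 == c) block E A p.1 p.2.
have SAc c : c \in t -> S (Ac c).
  apply: (eigencomponents_stable S0 Slin SM (k := m + m) (undup_uniq _)).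
    move=> c' _; rewrite /Ac iter_lie_shift_sum big_seq_cond big1 // => p /andP[/mem_prs[p1 p2]].
    by move=> /eqP <-; apply: iter_lie_shift_block.
  by rewrite -sumE -block_decomp //; exact: jordan_projectors.
rewrite sumE; apply: (linear_sum_closed S0 Slin) => c ct _.
have : c \in [seq p.1 + p.2 | p <- prs] by rewrite -mem_undup.
move=> /mapP[p0 /mem_prs[p01 p02] c0].
rewrite (_ : \sum_(p <- _ | _) _ = w p0.1 p0.2 *: Ac c).
  by apply: linear_scale => //; apply: SAc.
rewrite /Ac scaler_sumr big_seq_cond [RHS]big_seq_cond; apply: eq_bigr => p.
move=> /andP[/mem_prs[p1 p2] /eqP pc]; congr (_ *: _); apply: wE => //.
by rewrite pc.
Qed.

Lemma weight_null A x y : lie_act M A = 0 -> x \in s -> y \in s -> x + y != 0 ->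
  block E A x y = 0.
Proof.
move=> MA xs ys xy; have [_ _ _ comEP _] := jM.
have comEM z : z \in s -> E z *m M = M *m E z.
  move=> zs; rewrite {1}jordan_spectral mulmxDr (spectral_mul jordan_projectors) //.
  rewrite -(mul_spectral jordan_projectors) // comEP -mulmxDl.
  by rewrite -jordan_spectral.
have Z0 : [set B : 'M[K]_N | B = 0] 0 by [].
have Zlin a (A' B' : 'M[K]_N) : [set B | B = 0] A' -> [set B | B = 0] B' ->
    [set B : 'M[K]_N | B = 0] (a *: A' + B').
  by move=> /= -> ->; rewrite scaler0 addr0.
have ZM A' : [set B : 'M[K]_N | B = 0] A' -> [set B | B = 0] (lie_act M A').
  by move=> /= ->; rewrite linear0.
apply: (eigen_descend1 Z0 Zlin ZM xy (iter_lie_shift_block A xs ys)).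
rewrite /= /lie_shift scale0r subr0 /block lie_act_conj ?comEM //.
by rewrite MA mulmx0 mul0mx.
Qed.

(** The block (x, y) is multiplied by f x + f y, which depends on x + y only. *)
Lemma replica_stable (S : set 'M[K]_N) (f : K -> K) A :
  S 0 -> (forall a A B, S A -> S B -> S (a *: A + B)) ->
  (forall A, S A -> S (lie_act M A)) ->
  (forall x y x' y', x \in s -> y \in s -> x' \in s -> y' \in s ->
    x + y = x' + y' -> f x + f y = f x' + f y') ->
  S A -> S (lie_act (spectral s E f) A).
Proof.
move=> S0 Slin SM fE SA; rewrite (lie_act_spectral jordan_projectors).
exact: (weight_combination (w := fun x y => f x + f y)).
Qed.

Lemma replica_null (f : K -> K) A : lie_act M A = 0 ->
  (forall x y, x \in s -> y \in s -> x + y = 0 -> f x + f y = 0) ->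
  lie_act (spectral s E f) A = 0.
Proof.
move=> MA f0; rewrite (lie_act_spectral jordan_projectors).
rewrite big_seq big1 // => x xs; rewrite big_seq big1 // => y ys.
have [xy|xy] := eqVneq (x + y) 0; first by rewrite f0 // scale0r.
by rewrite weight_null // scaler0.
Qed.

End Replica.

Section HamiltonianParts.
Variables (K : numClosedFieldType) (N : nat) (Om : 'M[K]_N).
Local Notation V := 'cV[K]_N.
Variables (X : set {vspace V}).
Hypothesis symOm : symplectic_form Om.
Hypothesis irrX : irreducible_in (@proj_closed K N) X.
Hypothesis legX : legendrian Om X.
Hypothesis genX : generated_by_quadrics X.

(** Both conditions of hamiltonianP are inherited by the replicas of M: the
    quadrics form a stable subspace, and Om is annihilated by M. *)
Lemma hamiltonian_replica M s E m P (f : K -> K) : hamiltonian Om X M ->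
  jordan_form M s E m P ->
  (forall x y x' y', x \in s -> y \in s -> x' \in s -> y' \in s ->
    x + y = x' + y' -> f x + f y = f x' + f y') ->
  (forall x y, x \in s -> y \in s -> x + y = 0 -> f x + f y = 0) ->
  hamiltonian Om X (spectral s E f).
Proof.
move=> /(hamiltonianP symOm irrX legX genX)[MO MQ] jM f1 f2.
apply/(hamiltonianP symOm irrX legX genX); split.
  exact: (replica_null jM).
move=> B; apply: (replica_stable jM) => //; first exact: quadrics0.
by move=> *; apply: quadrics_lin.
Qed.

(** Taking as functions of the eigenvalues their coordinates in the additive
    group that they span, one gets diagonalizable parts with integral eigenvalues,
    whose one-parameter groups are algebraic. *)
Lemma hamiltonian_decomp M s E m P : hamiltonian Om X M -> jordan_form M s E m P ->
  exists r (b : 'I_r -> K) (z : K -> 'I_r -> int),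
  [/\ hamiltonian Om X P,
      forall j, hamiltonian Om X (spectral s E (fun x => (z x j)%:~R)) &
      M = \sum_j b j *: spectral s E (fun x => (z x j)%:~R) + P].
Proof.
move=> hM jM; have [r [b [z [bz bfree]]]] := integral_coordinates s.
exists r, b, z; split.
- have hS : hamiltonian Om X (spectral s E id).
    by apply: (hamiltonian_replica hM jM).
  rewrite (_ : P = - 1 *: spectral s E id + M); first exact: hamiltonian_lin.
  by rewrite (jordan_spectral jM) scaleN1r addKr.
- move=> j; apply: (hamiltonian_replica hM jM).
    move=> x y x' y' xs ys x's y's e; rewrite -!rmorphD /=; congr (_%:~R).
    apply/eqP; rewrite -subr_eq0; apply/eqP.
    apply: (bfree (fun j => z x j + z y j - (z x' j + z y' j))).
    under eq_bigr do rewrite mulrzBr !mulrzDr.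
    rewrite sumrB !big_split /= -!bz //; apply/eqP.
    by rewrite subr_eq0 e.
  move=> x y xs ys e; rewrite -rmorphD /= (_ : _ + _ = 0) //.
  apply: (bfree (fun j => z x j + z y j)).
  by under eq_bigr do rewrite mulrzDr; rewrite big_split /= -!bz.
rewrite {1}(jordan_spectral jM); congr (_ + _).
under eq_bigr do rewrite /spectral scaler_sumr.
rewrite exchange_big /= /spectral [LHS]big_seq [RHS]big_seq.
apply: eq_bigr => x xs; rewrite {1}(bz x xs) scaler_suml.
by apply: eq_bigr => j _; rewrite scalerA mulrzr.
Qed.

End HamiltonianParts.

(** * The exponential *)

Section ExpSeries.
Variable K : numFieldType.
Implicit Types (x y : K).

Definition expsum x n : K := \sum_(k < n) (k`!%:R)^-1 * x ^+ k.

Lemma expsumM x y n : expsum x n * expsum y n - expsum (x + y) n =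
  \sum_(i < n) \sum_(j < n | (n <= i + j)%N)
    ((i`!%:R)^-1 * x ^+ i) * ((j`!%:R)^-1 * y ^+ j).
Proof.
pose F i j := ((i`!%:R)^-1 * x ^+ i) * ((j`!%:R)^-1 * y ^+ j).
have -> : expsum (x + y) n = \sum_(i < n) \sum_(j < n | (i + j < n)%N) F i j.
  rewrite -sum_triangle; apply: eq_bigr => k _.
  rewrite addrC exprDn mulr_sumr; apply: eq_bigr => i _.
  have ik : (i <= k)%N by rewrite -ltnS.
  rewrite /F -mulr_natr -(bin_fact ik) !natrM.
  have f0 a : a`!%:R != 0 :> K by rewrite pnatr_eq0 -lt0n fact_gt0.
  have c0 : 'C(k, i)%:R != 0 :> K by rewrite pnatr_eq0 -lt0n bin_gt0.
  by field; rewrite !f0 c0.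
rewrite /expsum big_distrlr /= -sumrB; apply: eq_bigr => i _.
rewrite (bigID (fun j : 'I_n => (n <= i + j)%N)) /= [X in _ + X - _](eq_bigl _ _ (fun j => esym (ltnNge _ _))).
by rewrite addrK.
Qed.

Lemma expsum_norm x y n : `|expsum x n * expsum y n - expsum (x + y) n| <=
  expsum `|x| n * expsum `|y| n - expsum (`|x| + `|y|) n.
Proof.
rewrite !expsumM; apply: (le_trans (ler_norm_sum _ _ _)); apply: ler_sum => i _.
apply: (le_trans (ler_norm_sum _ _ _)); apply: ler_sum => j _.
by rewrite !normrM !normrX !normfV !normr_nat.
Qed.

(** The missing terms of the Cauchy product are dominated by those of the series
    at |x| and |y|, which tend to 0 because the functional equation is known
    there. *)
Lemma expsumD x y (a b c d : K) : 
  expsum x @ \oo --> a -> expsum y @ \oo --> b ->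
  expsum `|x| @ \oo --> c -> expsum `|y| @ \oo --> d ->
  expsum (`|x| + `|y|) @ \oo --> c * d -> expsum (x + y) @ \oo --> a * b.
Proof.
move=> xa yb xc yd xycd.
have gap : (fun n => expsum `|x| n * expsum `|y| n - expsum (`|x| + `|y|) n) @ \oo --> (0 : K).
  rewrite -(subrr (c * d)); apply: cvgB => //; exact: cvgM.
have diff : (fun n => expsum x n * expsum y n - expsum (x + y) n) @ \oo --> (0 : K).
  apply/cvgrPdist_lt => e e0; move/cvgrPdist_lt : gap => /(_ e e0).
  apply: filterS => n /=; rewrite !sub0r !normrN => h.
  apply: le_lt_trans h; have xyn := expsum_norm x y n.
  by rewrite [leRHS]ger0_norm // (le_trans _ xyn).
rewrite (_ : expsum (x + y) = fun n => expsum x n * expsum y n -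
    (expsum x n * expsum y n - expsum (x + y) n)); last first.
  by apply/funext => n; rewrite subKr.
by rewrite -[a * b]subr0; apply: cvgB => //; exact: cvgM.
Qed.

Lemma expsum0 : expsum 0 @ \oo --> (1 : K).
Proof.
apply/cvgrPdist_lt => e e0; near=> n; rewrite (_ : expsum 0 n = 1) ?subrr ?normr0 //.
have n0 : (0 < n)%N by near: n; exact: nbhs_infty_gt.
rewrite /expsum -(prednK n0) big_ord_recl /= fact0 expr0 invr1 mulr1.
by rewrite big1 ?addr0 // => i _; rewrite expr0n mulr0.
Unshelve. all: by end_near. Qed.

End ExpSeries.

Section ExpMatrix.
Variables (K : numFieldType) (N : nat).
Implicit Types (A B P : 'M[K]_N).

Lemma dpowD A B k : A *m B = B *m A ->
  dpow (A + B) k = \sum_(j < k.+1) dpow A (k - j) *m dpow B j.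
Proof.
move=> AB; rewrite /dpow exprDn_comm // scaler_sumr; apply: eq_bigr => j _.
have jk : (j <= k)%N by rewrite -ltnS.
rewrite -[RHS]scalemxAl -[X in _ = _ *: X]scalemxAr.
rewrite [RHS]scalerA -[_ *+ 'C(k, j)]scaler_nat [LHS]scalerA; congr (_ *: _).
rewrite -(bin_fact jk) !natrM.
have f0 a : a`!%:R != 0 :> K by rewrite pnatr_eq0 -lt0n fact_gt0.
have c0 : 'C(k, j)%:R != 0 :> K by rewrite pnatr_eq0 -lt0n bin_gt0.
by field; rewrite !f0 c0.
Qed.

Lemma dpow_spectral s E (f : K -> K) k : projectors s E ->
  dpow (spectral s E f : 'M[K]_N) k = spectral s E (fun x => (k`!%:R)^-1 * f x ^+ k).
Proof.
move=> prE; rewrite /dpow.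
have -> : spectral s E f ^+ k = spectral s E (fun x => f x ^+ k).
  elim: k => [|k IH]; first by rewrite expr0 (spectral1 prE).
  by rewrite exprS IH -mulmxE (spectralM prE); apply: eq_spectral => x _; rewrite exprS.
by rewrite /spectral scaler_sumr; apply: eq_bigr => x _; rewrite scalerA.
Qed.

Lemma cvg_subn (u : nat -> K) (l : K) j : u @ \oo --> l -> (fun n => u (n - j)%N) @ \oo --> l.
Proof. by move=> ul; rewrite -(cvg_shiftn j) /=; under eq_fun do rewrite addnK. Qed.

(** On a matrix in Jordan form the partial sums of the exponential are finite
    combinations of fixed matrices, with scalar exponential sums as coefficients. *)
Lemma expmx_jordan s E (f e : K -> K) m P : projectors s E ->
  (forall x, E x *m P = P *m E x) -> P ^+ m = 0 ->
  (forall x, expsum (f x) @ \oo --> e x) ->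
  expmx (spectral s E f + P : 'M[K]_N) = spectral s E e *m expnil m P.
Proof.
move=> prE comEP Pm fe; apply: cvg_lim; first exact: norm_hausdorff.
have comSP : spectral s E f *m P = P *m spectral s E f.
  rewrite /spectral mulmx_suml mulmx_sumr; apply: eq_bigr => x _.
  by rewrite -scalemxAl -scalemxAr comEP.
rewrite (_ : series _ = fun n => \sum_(j < m) \sum_(x <- s)
    expsum (f x) (n - j)%N *: (E x *m dpow P j)); last first.
  apply/funext => n; rewrite /series /= big_mkord.
  transitivity (\sum_(k < n) \sum_(j < m | (j <= k)%N)
      dpow (spectral s E f) (k - j) *m dpow P j).
    apply: eq_bigr => k _; rewrite -/(dpow _ _) dpowD //.
    have [km|mk] := leqP k.+1 m.
      by rewrite (big_ord_widen m (fun j => dpow _ (k - j) *m dpow P j) km).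
    rewrite -(big_mkord xpredT (fun j => dpow _ (k - j) *m dpow P j)).
    rewrite (big_cat_nat (leq0n m) (ltnW mk)) /= [X in _ + X]big1_seq ?addr0; last first.
      move=> j; rewrite mem_index_iota => /andP[_ /andP[mj _]].
      by rewrite (dpow_nil Pm mj) mulmx0.
    rewrite big_mkord; apply: eq_bigl => j /=.
    by rewrite -ltnS (leq_trans (ltn_ord j)) // ltnW.
  rewrite (exchange_big_dep xpredT) //=; apply: eq_bigr => j _.
  rewrite -mulmx_suml.
  rewrite (_ : \sum_(k < n | (j <= k)%N) _ = \sum_(k < n - j) dpow (spectral s E f) k).
    have -> : \sum_(k < n - j) dpow (spectral s E f) k =
        \sum_(k < n - j) spectral s E (fun x => (k`!%:R)^-1 * f x ^+ k).
      by apply: eq_bigr => k _; exact: dpow_spectral.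
    rewrite /spectral exchange_big /= mulmx_suml; apply: eq_bigr => x _.
    by rewrite -scaler_suml scalemxAl.
  have [nj|jn] := leqP n j.
    rewrite big1 => [|k jk]; last by have := ltn_ord k; rewrite ltnNge (leq_trans nj jk).
    by rewrite (eqP (_ : (n - j == 0)%N)) ?big_ord0 // subn_eq0.
  rewrite big_mkcond /=.
  rewrite -(big_mkord xpredT (fun k => if (j <= k)%N then dpow (spectral s E f) (k - j)%N else 0)).
  rewrite (big_cat_nat (leq0n j) (ltnW jn)) /= big1_seq ?add0r; last first.
    move=> k; rewrite mem_index_iota => /andP[_ kj].
    by move: kj; rewrite /= ltnNge => /negbTE ->.
  rewrite -[X in index_iota X _]add0n big_addn big_mkord.
  by apply: eq_bigr => k _; rewrite leq_addl addnK.
rewrite /expnil mulmx_sumr.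
apply: cvg_big => [|j _]; first exact: add_continuous.
rewrite /spectral mulmx_suml; apply: cvg_big => [|x _]; first exact: add_continuous.
by rewrite -scalemxAl; apply: cvgZr_tmp; apply: cvg_subn.
Qed.

End ExpMatrix.

(** What is used of the exponential of the base field; the arguments that only
    depend on these properties are carried out over an abstract field. *)
Definition exponential (K : numFieldType) (e : K -> K) : Prop :=
  [/\ e 0 = 1, {morph e : x y / x + y >-> x * y},
      forall y, y != 0 -> exists x, e x = y,
      forall x, expsum x @ \oo --> e x &
      (fun k => (k.+1%:R)^-1 : K) @ \oo --> (0 : K)].

Section ComplexExp.
Variable R : realType.
Local Notation C := (R[i] : numFieldType).
Implicit Types (a b : R) (z : C).

(** Defined from real functions, so that the functional equation is immediate;
    the exponential series is then shown to converge to it. *)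
Definition cexp z : C := (expR (complex.Re z))%:C *
  (cos (complex.Im z) +i* sin (complex.Im z)).

Lemma cexpD z w : cexp (z + w) = cexp z * cexp w.
Proof.
case: z w => [a b] [c d]; rewrite /cexp /= expRD cosD sinD rmorphM /=.
rewrite mulrACA; congr (_ * _); apply/eqP; rewrite eq_complex /=.
by rewrite [cos b * sin d]mulrC addrC [sin b * _]mulrC !eqxx /= addrC eqxx.
Qed.

Lemma cexp0 : cexp 0 = 1.
Proof. by rewrite /cexp /= expR0 cos0 sin0 mul1r. Qed.

Lemma cexp_surj z : z != 0 -> exists w, cexp w = z.
Proof.
case: z => x y; rewrite eq_complex /= negb_and => xy0.
pose r := Num.sqrt (x ^+ 2 + y ^+ 2).
have s0 : 0 < x ^+ 2 + y ^+ 2.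
  have pos (t : R) : t != 0 -> 0 < t ^+ 2 by move=> t0; rewrite exprn_even_gt0.
  case/orP: xy0 => /pos h; first by apply: ltr_wpDr h; exact: sqr_ge0.
  by apply: ltr_wpDl h; exact: sqr_ge0.
have r0 : 0 < r by rewrite sqrtr_gt0.
have r2 : r ^+ 2 = x ^+ 2 + y ^+ 2 by rewrite sqr_sqrtr // ltW.
pose c := x / r; pose d := y / r.
have cd : c ^+ 2 + d ^+ 2 = 1.
  by rewrite /c /d !expr_div_n r2 -mulrDl divff // gt_eqF.
have c1 : -1 <= c <= 1.
  rewrite -ler_norml -(ler_pXn2r (n := 2)) ?nnegrE // expr1n -normrX ger0_norm ?sqr_ge0 //.
  by rewrite -cd lerDl sqr_ge0.
have [b [cb sb]] : exists b, cos b = c /\ sin b = d.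
  have sq : Num.sqrt (1 - c ^+ 2) = `|d|.
    by rewrite -cd addrAC subrr add0r sqrtr_sqr.
  have ca : cos (acos c) = c by rewrite acosK // in_itv.
  have [d0|d0] := lerP 0 d.
    by exists (acos c); rewrite sin_acos // sq ger0_norm.
  by exists (- acos c); rewrite cosN sinN sin_acos // sq ltr0_norm // opprK.
exists (ln r +i* b); rewrite /cexp /= lnK ?posrE // cb sb.
apply/eqP; rewrite eq_complex /= !mul0r subr0 addr0 /c /d.
have rK t : r * (t / r) = t by rewrite mulrC divfK ?gt_eqF.
by rewrite !rK !eqxx.
Qed.

Lemma cvg_real_complex (u : nat -> R) (l : R) : u @ \oo --> l ->
  (fun n => (u n)%:C : C) @ \oo --> (l%:C : C).
Proof.
move=> /cvgrPdist_lt ul; apply/cvgrPdist_lt => -[e1 e2].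
rewrite ltcE /= => /andP[/eqP e20 e10]; have := ul e1 e10.
apply: filterS => n h; rewrite -rmorphB normc_def /= expr0n addr0 sqrtr_sqr.
by rewrite ltcE /= e20 eqxx.
Qed.

Lemma expsum_real a : expsum (a%:C : C) @ \oo --> ((expR a)%:C : C).
Proof.
rewrite (_ : expsum _ = fun n => (series (exp_coeff a) n)%:C).
  by apply: cvg_real_complex; exact: is_cvg_series_exp_coeff.
apply/funext => n; rewrite /expsum /series /= big_mkord rmorph_sum.
apply: eq_bigr => k _; rewrite /exp_coeff /= rmorphM fmorphV rmorphXn rmorph_nat.
by rewrite mulrC.
Qed.

Lemma expsum_imaginary b : expsum ('i%C * b%:C : C) @ \oo --> (cos b +i* sin b : C).
Proof.
rewrite [X in _ --> X](_ : _ = (cos b)%:C + 'i%C * (sin b)%:C); last first.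
  exact: (complexE (cos b +i* sin b)).
rewrite (_ : expsum _ = fun n => (series (cos_coeff b) n)%:C +
    'i%C * (series (sin_coeff b) n)%:C).
  apply: cvgD; first by apply: cvg_real_complex; rewrite unlock; exact: is_cvg_series_cos_coeff.
  apply: cvgMl_tmp; apply: cvg_real_complex; rewrite unlock; exact: is_cvg_series_sin_coeff.
apply/funext => n; rewrite /expsum /series /= !big_mkord !rmorph_sum mulr_sumr -big_split /=.
apply: eq_bigr => k _.
have ik : ('i%C : C) ^+ k = (if odd k then 'i%C else 1) * (-1) ^+ k./2.
  rewrite -{1}(odd_double_half k) exprD -muln2 mulnC exprM sqr_i.
  by case: odd; rewrite ?expr1 ?expr0.
rewrite exprMn ik /cos_coeff /sin_coeff /=.
rewrite !(rmorphM, fmorphV, rmorphXn, rmorph_nat, rmorphN, rmorph1) /=.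
have [ok|ek] := boolP (odd k); rewrite /= ?mul0r ?mul1r ?mulr0 ?add0r ?addr0.
  have -> : k.-1./2 = k./2.
    by move: ok; case: (k : nat) => //= j; rewrite uphalf_half; case: (odd j).
  by ring.
by ring.
Qed.

Lemma cexp_cvg z : expsum z @ \oo --> cexp z.
Proof.
case: z => a b; rewrite [X in expsum X](_ : _ = a%:C + 'i%C * b%:C); last exact: (complexE (a +i* b)).
have na c : `|c%:C : C| = `|c|%:C by rewrite normc_def /= expr0n addr0 sqrtr_sqr.
have ni : `|'i%C * b%:C : C| = `|b|%:C.
  by rewrite normrM na normc_def /= expr0n expr1n add0r sqrtr1 mul1r.
apply: (expsumD (c := (expR `|a|)%:C) (d := (expR `|b|)%:C)).
- exact: expsum_real.
- exact: expsum_imaginary.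
- by rewrite na; exact: expsum_real.
- by rewrite ni; exact: expsum_real.
by rewrite na ni -rmorphD -rmorphM -expRD; exact: expsum_real.
Qed.

Lemma cexp_exponential : exponential cexp.
Proof.
split; [exact: cexp0|exact: cexpD|exact: cexp_surj|exact: cexp_cvg|].
have := @cvg_harmonic R => /cvg_real_complex.
rewrite (_ : (fun n => (harmonic n)%:C : C) = fun k => (k.+1%:R)^-1) //.
by apply/funext => k; rewrite /harmonic /= fmorphV rmorph_nat.
Qed.

End ComplexExp.

(** * Connected groups generated by exponentials *)

Section OneParameter.
Variables (C : numClosedFieldType) (N : nat) (cexp : C -> C).
Hypothesis expC : exponential cexp.
Implicit Types (M P : 'M[C]_N).

Lemma expr_scalemx P (a : C) k : (a *: P) ^+ k = a ^+ k *: P ^+ k.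
Proof.
elim: k => [|k IH]; first by rewrite !expr0 scale1r.
by rewrite !exprS IH -!mulmxE -scalemxAl -scalemxAr scalerA.
Qed.

Lemma dpowZ P (a : C) k : dpow (a *: P) k = a ^+ k *: dpow P k.
Proof. by rewrite /dpow expr_scalemx !scalerA mulrC. Qed.

Lemma expnilZD m P (a b : C) : P ^+ m = 0 ->
  expnil m (a *: P) *m expnil m (b *: P) = expnil m ((a + b) *: P).
Proof.
move=> Pm.
have aP_bP : (a *: P) *m (b *: P) = (b *: P) *m (a *: P).
  by rewrite -!scalemxAl -!scalemxAr !scalerA mulrC.
have comm i j : dpow (b *: P) j *m dpow (a *: P) i = dpow (a *: P) i *m dpow (b *: P) j.
  rewrite !dpowZ /dpow -!scalemxAl -!scalemxAr !mulmxE -!exprD addnC !scalerA.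
  by congr (_ *: _); ring.
pose F i j := dpow (a *: P) i *m dpow (b *: P) j.
have -> : expnil m ((a + b) *: P) = \sum_(k < m) \sum_(i < k.+1) F i (k - i)%N.
  rewrite /expnil scalerDl addrC; apply: eq_bigr => k _; rewrite dpowD //.
  by apply: eq_bigr => i _; rewrite comm.
rewrite sum_triangle /expnil mulmx_suml; apply: eq_bigr => i _.
rewrite mulmx_sumr (bigID (fun j : 'I_m => (i + j < m)%N)) /= [X in _ + X]big1 ?addr0 //.
move=> j; rewrite -leqNgt => ij.
rewrite !dpowZ /dpow -!scalemxAl -!scalemxAr mulmxE -exprD.
by rewrite -(subnK ij) exprD Pm mulr0 !scaler0.
Qed.

Lemma expmx_scale M : exists s (E : C -> 'M[C]_N) m P, jordan_form M s E m P /\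
  forall c, expmx (c *: M) = spectral s E (fun x => cexp (c * x)) *m expnil m (c *: P).
Proof.
have [s [E [m [P jM]]]] := jordan_exists M; exists s, E, m, P; split=> // c.
have [_ _ _ comEP [_ Pm]] := jM.
rewrite {1}(jordan_spectral jM) scalerDr.
have -> : c *: spectral s E id = spectral s E (fun x => c * x).
  by rewrite /spectral scaler_sumr; apply: eq_bigr => x _; rewrite scalerA.
apply: expmx_jordan; first exact: jordan_projectors jM.
- by move=> x; rewrite -scalemxAr -scalemxAl comEP.
- by rewrite expr_scalemx Pm scaler0.
- by move=> x; by case: expC.
Qed.

Lemma spectral_commute s (E : C -> 'M[C]_N) f P : (forall x, E x *m P = P *m E x) ->
  spectral s E f *m P = P *m spectral s E f.
Proof.
move=> comEP; rewrite /spectral mulmx_suml mulmx_sumr; apply: eq_bigr => x _.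
by rewrite -scalemxAl -scalemxAr comEP.
Qed.

Lemma expnil_commute A m P : A *m P = P *m A -> A *m expnil m P = expnil m P *m A.
Proof.
move=> AP; rewrite /expnil mulmx_suml mulmx_sumr; apply: eq_bigr => k _.
rewrite /dpow -scalemxAl -scalemxAr; congr (_ *: _).
by have := commrX k AP.
Qed.

Lemma expmx_scaleD M (c d : C) :
  expmx (c *: M) *m expmx (d *: M) = expmx ((c + d) *: M).
Proof.
have [s [E [m [P [jM eM]]]]] := expmx_scale M; rewrite !eM.
have [_ _ _ comEP [_ Pm]] := jM.
rewrite -!mulmxA [expnil m (c *: P) *m (_ *m _)]mulmxA -expnil_commute; last first.
  by rewrite -scalemxAl -scalemxAr spectral_commute.
rewrite -mulmxA expnilZD // mulmxA (spectralM (jordan_projectors jM)).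
by congr (_ *m _); apply: eq_spectral => x _; rewrite mulrDl; case: expC => _ ->.
Qed.

Lemma expmx0 : expmx (0 : 'M[C]_N) = 1%:M.
Proof.
have [s [E [m [P [jM eM]]]]] := expmx_scale 0.
have := eM 0; rewrite !scale0r => ->.
have [us E1 orth _ _] := jM; have prE := jordan_projectors jM.
rewrite [X in X *m _](_ : _ = 1%:M); last first.
  by rewrite -(spectral1 prE); apply: eq_spectral => x _; rewrite mul0r; case: expC => ->.
rewrite mul1mx; have [_ _ _ _ [_ Pm]] := jM.
case: m Pm {jM eM} => [|m] Pm.
  by rewrite /expnil big_ord0; move: Pm; rewrite expr0 => <-.
rewrite /expnil big_ord_recl /= dpow0 big1 ?addr0 // => i _.
by rewrite /dpow exprS mul0r scaler0.
Qed.

Lemma expmxV M : expmx (- M) *m expmx M = 1%:M.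
Proof. by rewrite -scaleN1r -{2}[M]scale1r expmx_scaleD addNr scale0r expmx0. Qed.

Lemma expmx_power M (c : C) k : expmx (c *: M) ^+ k = expmx ((k%:R * c) *: M).
Proof.
elim: k => [|k IH]; first by rewrite expr0 mul0r scale0r expmx0.
by rewrite exprS IH -mulmxE expmx_scaleD -natr1 mulrDl mul1r addrC.
Qed.

End OneParameter.

Section LieSubgroup.
Variables (C : numClosedFieldType) (N : nat) (cexp : C -> C).
Hypothesis expC : exponential cexp.
Variables (h G : set 'M[C]_N).
Hypothesis h0 : h 0.
Hypothesis hZ : forall a M, h M -> h (a *: M).
Hypothesis lieG : connected_lie_subgroup h G.

Lemma lie_group1 : G 1%:M.
Proof. by have [H [_ ->]] := lieG; exists (lie_one H); rewrite // lie_val1. Qed.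

Lemma lie_groupM g1 g2 : G g1 -> G g2 -> G (g1 *m g2).
Proof.
have [H [_ ->]] := lieG => -[x _ <-] [y _ <-].
by exists (lie_mul x y); rewrite ?lie_valM.
Qed.

Lemma lie_groupV g : G g -> exists2 g', G g' & g' *m g = 1%:M.
Proof.
have [H [_ ->]] := lieG => -[x _ <-].
by exists (lie_val (lie_inv x)); [exists (lie_inv x)|exact: lie_valV].
Qed.

Lemma lie_groupX g k : G g -> G (g ^+ k).
Proof.
move=> Gg; elim: k => [|k IH]; first by rewrite expr0; exact: lie_group1.
by rewrite exprS; apply: lie_groupM.
Qed.

(** The exponential is only known to lift near 0, so M is first divided by a
    large integer. *)
Lemma exp_lie_group M : h M -> G (expmx M).
Proof.
move=> hM; have [H [_ GE]] := lieG.
have [k dk] : exists k, lie_dom H ((k.+1%:R)^-1 *: M).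
  have cv : (fun k => (k.+1%:R)^-1 *: M) @ \oo --> (0 : 'M[C]_N).
    by rewrite -(scale0r M); apply: cvgZr_tmp; by case: expC.
  have nb : nbhs (0 : 'M[C]_N) (lie_dom H).
    by apply: open_nbhs_nbhs; split; [exact: lie_dom_open|exact: lie_dom0].
  have [k _ kP] := cv _ nb; exists k; exact: kP (leqnn k).
have -> : M = (k.+1%:R * (k.+1%:R)^-1) *: M by rewrite mulfV ?scale1r // pnatr_eq0.
rewrite -(expmx_power expC); apply: lie_groupX; rewrite GE.
by exists (lie_exp H ((k.+1%:R)^-1 *: M)) => //; rewrite lie_expE //; split=> //; apply: hZ.
Qed.

(** A connected group is generated by any neighbourhood of its unit, here by
    exponentials: the subgroup they generate is open, and so are its cosets. *)
Lemma lie_group_ind (P : 'M[C]_N -> Prop) :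
  (forall M, h M -> P (expmx M)) ->
  (forall g1 g2, P g1 -> P g2 -> P (g1 *m g2)) ->
  (forall g g', P g -> g' *m g = 1%:M -> P g') -> forall g, G g -> P g.
Proof.
move=> Pexp PM PV g; have [H [conH ->]] := lieG => -[x _ <-].
pose B := [set y : lie_carrier H | P (lie_val y)].
pose U := lie_exp H @` (setT `&` (lie_dom H `&` h)).
have oU : open U by apply: lie_exp_open; exact: openT.
have U1 : U (lie_one H).
  exists 0; first by split=> //; split=> //; exact: lie_dom0.
  apply: (@lie_val_inj _ _ _ H); rewrite lie_expE ?lie_val1 ?(expmx0 _ expC) //.
  by split=> //; exact: lie_dom0.
have UP y : U y -> P (lie_val y).
  by move=> [A [_ [dA hA]] <-]; rewrite lie_expE //; apply: Pexp.
have mulV y : lie_mul (lie_inv y) y = lie_one H.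
  by apply: (@lie_val_inj _ _ _ H); rewrite lie_valM lie_valV lie_val1.
pose nb y := [set z : lie_carrier H | U (lie_mul (lie_inv y) z)].
have onb y : open (nb y).
  apply: (@open_comp _ _ (fun z => lie_mul (lie_inv y) z) U) => // z _.
  apply: (@continuous_comp _ _ _ (fun z => (lie_inv y, z))
     (fun p : lie_carrier H * lie_carrier H => lie_mul p.1 p.2)).
    apply: cvg_pair => /=; first exact: cvg_cst.
    exact: cvg_id.
  exact: lie_mul_continuous.
have nby y : nb y y by rewrite /nb /= mulV.
have invmul (A A' : 'M[C]_N) : A' *m A = 1%:M -> A *m A' = 1%:M by exact: mulmx1C.
have nbE y z : nb y z -> exists2 u, P u & lie_val z = lie_val y *m u.
  move=> /UP; rewrite lie_valM; set u := _ *m _ => Pu; exists u => //.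
  by rewrite /u mulmxA (invmul _ _ (lie_valV y)) mul1mx.
have openP (D : set (lie_carrier H)) : (forall y, D y -> nb y `<=` D) -> open D.
  move=> hD; rewrite openE => y Dy; apply: filterS (hD y Dy) _.
  by apply: open_nbhs_nbhs; split; [exact: onb|exact: nby].
have oB : open B.
  by apply: openP => y By z /nbE[u Pu E]; rewrite /B /= E; apply: PM.
have oBC : open (~` B).
  apply: openP => y By z /nbE[u Pu E] Bz; apply: By; rewrite /B /=.
  have [u' u'u] : exists u', u' *m u = 1%:M.
    exists (lie_val (lie_inv z) *m lie_val y); rewrite -mulmxA -E; exact: lie_valV.
  have -> : lie_val y = lie_val z *m u' by rewrite E -mulmxA (invmul _ _ u'u) mulmx1.
  by apply: PM => //; apply: PV u'u.
have B1 : B (lie_one H) by apply: UP.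
have BT : B = setT.
  apply: conH; first by exists (lie_one H).
    by exists B => //; rewrite setTI.
  by exists B; rewrite ?setTI //; rewrite -openC.
by have : B x by rewrite BT.
Qed.

End LieSubgroup.

Section Preservation.
Variables (C : numClosedFieldType) (N : nat) (cexp : C -> C).
Hypothesis expC : exponential cexp.
Local Notation V := 'cV[C]_N.
Variables (Om : 'M[C]_N) (X : set {vspace V}).
Hypothesis symOm : symplectic_form Om.
Hypothesis irrX : irreducible_in (@proj_closed C N) X.
Hypothesis legX : legendrian Om X.
Hypothesis genX : generated_by_quadrics X.

Definition preserves_quadrics (g : 'M[C]_N) : Prop :=
  forall B, quadrics X B -> quadrics X (g^T *m B *m g).

(** The semisimple part multiplies the block (x, y) by cexp (x + y), which depends
    on the weight only, and the nilpotent part acts through powers of its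
    infinitesimal action. *)
Lemma expmx_preserves M : hamiltonian Om X M -> preserves_quadrics (expmx M).
Proof.
move=> hM B qB; have [s [E [m [P [jM eM]]]]] := expmx_scale expC M.
have := eM 1; rewrite !scale1r => ->.
have [r [b [z [hP _ _]]]] := hamiltonian_decomp symOm irrX legX genX hM jM.
have [_ MQ] := (hamiltonianP symOm irrX legX genX M).1 hM.
have [_ PQ] := (hamiltonianP symOm irrX legX genX P).1 hP.
set T := expnil m P; set L := spectral s E _.
have -> : (L *m T)^T *m B *m (L *m T) = T^T *m (L^T *m B *m L) *m T.
  by rewrite trmx_mul !mulmxA.
have [_ _ _ _ [_ Pm]] := jM.
apply: (expnil_stable (quadrics0 X)) => //; first by move=> *; apply: quadrics_lin.
rewrite /L spectral_conj.
apply: (weight_combination jM (w := fun x y => cexp (1 * x) * cexp (1 * y))) => //.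
- exact: quadrics0.
- by move=> *; apply: quadrics_lin.
- by move=> x y x' y' _ _ _ _ e; rewrite !mul1r; case: expC => _ D _ _ _; rewrite -!D e.
Qed.

End Preservation.


(** * Products of curves and dominance *)

Section Curves.
Variables (K : numClosedFieldType) (N : nat).
Local Notation V := 'cV[K]_N.
Implicit Types (x v w : V) (Gam : 'M[{poly K}]_N) (t u : nat -> K).

Definition mx_at Gam (c : K) : 'M[K]_N := \matrix_(i, j) (Gam i j).[c].
Definition mx_velocity Gam : 'M[K]_N := \matrix_(i, j) (Gam i j)^`().[0].

(** The scalars make it possible to clear the denominators of the Laurent
    polynomials in 1 + c that parametrize a torus; these denominators vanish at
    c = -1. *)
Definition group_curve (G : set 'M[K]_N) Gam : Prop :=
  mx_at Gam 0 = 1%:M /\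
  forall c, c != -1 -> exists a g, [/\ a != 0, G g & mx_at Gam c = a *: g].

Fixpoint act_curves (s : seq 'M[{poly K}]_N) t x : V :=
  if s is Gam :: s' then mx_at Gam (t 0%N) *m act_curves s' (fun i => t i.+1) x else x.

(** The coordinates of act_curves on a line of parameters through 0, as
    polynomials. *)
Fixpoint act_curves_line (s : seq 'M[{poly K}]_N) u x : 'cV[{poly K}]_N :=
  if s is Gam :: s' then
    map_mx (comp_poly (u 0%N *: 'X)) Gam *m act_curves_line s' (fun i => u i.+1) x
  else map_mx (@polyC K) x.

Lemma act_curves_lineE s u x i c :
  (act_curves_line s u x i 0).[c] = act_curves s (fun j => c * u j) x i 0.
Proof.
elim: s u i => [|Gam s IH] u i /=; first by rewrite mxE hornerC.
rewrite !mxE horner_sum; apply: eq_bigr => j _.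
rewrite !mxE hornerM IH horner_comp !hornerE. by rewrite [u 0%N * c]mulrC.
Qed.

Lemma act_curves0 s x : (forall Gam, Gam \in s -> mx_at Gam 0 = 1%:M) ->
  act_curves s (fun=> 0) x = x.
Proof.
elim: s => //= Gam s IH h; rewrite h ?mem_head // mul1mx IH // => Gam' Gs.
by apply: h; rewrite inE Gs orbT.
Qed.

Lemma act_curves_line_deriv s u x i : (forall Gam, Gam \in s -> mx_at Gam 0 = 1%:M) ->
  (act_curves_line s u x i 0)^`().[0] =
  (\sum_(j < size s) u j *: (mx_velocity (nth 0 s j) *m x)) i 0.
Proof.
elim: s u i => [|Gam s IH] u i h /=.
  by rewrite big_ord0 !mxE derivC horner0.
have hs Gam' : Gam' \in s -> mx_at Gam' 0 = 1%:M by move=> Gs; apply: h; rewrite inE Gs orbT.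
rewrite mxE (raddf_sum (@deriv K)) /= horner_sum big_ord_recl [RHS]mxE.
under eq_bigr => j _ do rewrite derivM hornerD !hornerM (IH _ _ hs).
rewrite big_split /=; congr (_ + _).
  rewrite !mxE mulr_sumr; apply: eq_bigr => j _.
  rewrite act_curves_lineE (_ : (fun j => 0 * u j.+1) = fun=> 0); last first.
    by apply/funext => k; rewrite mul0r.
  rewrite act_curves0 // !mxE deriv_comp hornerM horner_comp !hornerE /= derivZ derivX.
  by rewrite !hornerE /= mulr1 [u _ * _]mulrC.
have G0 j : (map_mx (comp_poly (u 0%N *: 'X)) Gam i j).[0] = (i == j)%:R.
  have := congr1 (fun A : 'M[K]_N => A i j) (h Gam (mem_head _ _)).
  by rewrite !mxE horner_comp !hornerE.
rewrite (bigD1 i) //= G0 eqxx mul1r [X in _ + X]big1 ?addr0 // => j ji.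
by rewrite G0 eq_sym (negbTE ji) mul0r.
Qed.

Lemma act_curves_orbit (G : set 'M[K]_N) s t x : G 1%:M ->
  (forall g1 g2, G g1 -> G g2 -> G (g1 *m g2)) ->
  (forall Gam, Gam \in s -> group_curve G Gam) ->
  (forall i, (i < size s)%N -> t i != -1) ->
  exists a g, [/\ a != 0, G g & act_curves s t x = a *: (g *m x)].
Proof.
move=> G1 GM; elim: s t => [|Gam s IH] t cs ts /=.
  by exists 1, 1%:M; rewrite oner_eq0 scale1r mul1mx.
have [a [g [a0 Gg ->]]] := (cs Gam (mem_head _ _)).2 (t 0%N) (ts 0%N isT).
have [||b [k [b0 Gk ->]]] := IH (fun i => t i.+1).
- by move=> Gam' Gs; apply: cs; rewrite inE Gs orbT.
- by move=> i si; apply: ts.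
exists (a * b), (g *m k); split; [by rewrite mulf_neq0|exact: GM|].
by rewrite -scalemxAl -scalemxAr scalerA mulmxA.
Qed.

End Curves.

Section Dominance.
Variables (K : numClosedFieldType) (N : nat).
Local Notation V := 'cV[K]_N.
Implicit Types (x v w : V) (Y : set V).

Lemma poly_eq0_generic (P Q : {poly K}) : Q != 0 ->
  (forall c, Q.[c] != 0 -> P.[c] = 0) -> P = 0.
Proof.
move=> Q0 h; have /eqP : P * Q = 0.
  apply: poly_fun_eq0 => c; rewrite hornerM; have [->|/h ->] := eqVneq Q.[c] 0.
    by rewrite mulr0.
  by rewrite mul0r.
by rewrite mulf_eq0 (negbTE Q0) orbF => /eqP.
Qed.

(** In a relation between f and p, factor out the largest power of p and restrict
    to O, where p vanishes: this leaves a relation between the f on O. *)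
Lemma independent_extend Y (O : set V) d (f : 'I_d -> mpoly N K) p :
  prime_locus Y -> O `<=` Y ->
  (forall q : mpoly d K, (forall v, O v -> meval (fun i => peval (f i) v) q = 0) -> q = 0) ->
  ~ vanishing_ideal Y p -> (forall v, O v -> peval p v = 0) ->
  algebraically_independent Y (cat2 f (fun _ : 'I_1 => p)).
Proof.
move=> [[x0 Yx0] prY] OY fO pY pO q qY; apply/eqP; apply: contraT => q0.
have [s [qs [qs0 low]]] := lowest_part (cat2 (fun _ : 'I_d => 0%N) (fun _ : 'I_1 => 1%N)) q0.
pose q1 := mmap (@mpolyC d K) (cat2 (fun a => mpolyX K (mnm1 a)) (fun _ : 'I_1 => 1)) qs.
have q1E y c : meval (cat2 y (fun _ : 'I_1 => c)) qs = c ^+ s * meval y q1.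
  have [e _] := low K idfun c (cat2 y (fun=> 1)).
  have -> : meval y q1 = mmap idfun (cat2 y (fun _ : 'I_1 => 1)) qs.
    rewrite /q1 -[RHS]/(meval _ _); elim/mpoly_ring_ind: (qs) => [k|i|p1 p2 IH1 IH2|p1 p2 IH1 IH2].
    - by rewrite mmapC !mevalC.
    - rewrite mmapX mmap1U mevalXU -(splitK i); case: (fintype.split i) => a /=.
        by rewrite !cat2l mevalXU.
      by rewrite !cat2r meval1.
    - by rewrite mmapD !mevalD IH1 IH2.
    - by rewrite rmorphM !mevalM /= IH1 IH2.
  rewrite -e -[RHS]/(meval _ _); apply: meval_ext => i; rewrite -(splitK i).
  case: (fintype.split i) => a /=; first by rewrite !cat2l expr0 mul1r.
  by rewrite !cat2r expr1 mulr1.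
suff q10 : q1 = 0.
  move/eqP: qs0; case; apply: mpoly_fun_eq0 => v.
  rewrite (meval_ext (w := cat2 (fun a => v (lshift 1 a)) (fun=> v (rshift d ord0)))).
    by rewrite q1E q10 meval0 mulr0.
  move=> i; rewrite -(splitK i); case: (fintype.split i) => a /=; rewrite ?cat2l //.
  by rewrite cat2r (ord1 a).
apply: fO => v Ov; have [_ [r rE]] := low _ (@mpolyC N K) p (cat2 f (fun=> 1)).
have I0 : vanishing_ideal Y (p ^+ s * (mmap (@mpolyC N K) (cat2 f (fun=> 1)) qs + p * r)).
  move=> y Yy; rewrite -rE -[mmap _ _ _]/(mpcomp _ _) peval_mpcomp -(qY y Yy).
  apply: meval_ext => i; rewrite -(splitK i).
  case: (fintype.split i) => a /=; first by rewrite !cat2l expr0 mul1r.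
  by rewrite !cat2r expr1 mulr1.
have I1 : vanishing_ideal Y (mmap (@mpolyC N K) (cat2 f (fun=> 1)) qs + p * r).
  elim: (s) I0 => [|k IH]; first by rewrite expr0 mul1r.
  by rewrite exprS -mulrA => /prY[//|].
have := I1 v (OY v Ov); rewrite pevalD pevalM pO // mul0r addr0.
rewrite -[mmap _ _ _]/(mpcomp _ _) peval_mpcomp => <-.
rewrite -[LHS]mul1r -(expr1n _ s) -q1E; apply: meval_ext => i; rewrite -(splitK i).
by case: (fintype.split i) => a /=; rewrite ?cat2l // !cat2r peval1.
Qed.

(** Coordinates on the tangent space W are independent on the image, because the
    differential is onto W. A function vanishing on the image but not on Y would
    then contradict the dimension of Y. *)
Lemma act_curves_dominant Y x (W : {vspace V}) (s : seq 'M[{poly K}]_N) p :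
  irreducible_in (@zariski_closed K N) Y -> Y x -> local_dimension Y x (\dim W) ->
  (forall Gam, Gam \in s -> mx_at Gam 0 = 1%:M) ->
  (W <= <<[seq mx_velocity Gam *m x | Gam <- s]>>)%VS ->
  (forall t : nat -> K, (forall i, (i < size s)%N -> t i != -1) -> Y (act_curves s t x)) ->
  (forall t : nat -> K, (forall i, (i < size s)%N -> t i != -1) -> peval p (act_curves s t x) = 0) ->
  vanishing_ideal Y p.
Proof.
move=> irrY Yx [_ dmax] cs Ws sY ps; apply: contrapT => pY.
pose O := [set y : V | exists2 t : nat -> K, (forall i, (i < size s)%N -> t i != -1) & y = act_curves s t x].
have OY : O `<=` Y by move=> _ [t ht ->]; apply: sY.
have pO v : O v -> peval p v = 0 by move=> [t ht ->]; apply: ps.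
pose co i : V -> K := coord (vbasis W) i.
pose f i : mpoly N K := \sum_(l <- enum 'I_N)
  mpolyC N (co i (delta_mx l 0)) * (mpolyX K (mnm1 l) - mpolyC N (x l 0)).
have fE i v : peval (f i) v = co i (v - x).
  rewrite /peval raddf_sum /= [v - x]matrix_sum_delta.
  rewrite /co linear_sum big_enum; apply: eq_bigr => l _ /=.
  rewrite big_ord1 linearZ /= mevalM mevalC mulrC mevalB mevalXU mevalC.
  by rewrite !mxE.
suff : (\dim W + 1 <= \dim W)%N by rewrite addn1 ltnn.
  apply: dmax; exists Y; split=> //.
  exists (cat2 f (fun _ : 'I_1 => p)); apply: (independent_extend (O := O)) => //.
    exact: irreducible_prime.
  move=> q qO; apply/eqP; apply: contraT => q0.
  have [qs qs0 low] := lowest_along (fun=> 1%N) q0.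
  move/eqP: qs0; case; apply: mpoly_fun_eq0 => z.
  have wW : \sum_i z i *: (vbasis W)`_i \in <<[seq mx_velocity Gam *m x | Gam <- s]>>%VS.
    apply: (subvP Ws); apply: memv_suml => i _; apply: memvZ.
    by apply: vbasis_mem; apply: mem_nth; rewrite size_tuple.
  pose T := map_tuple (fun Gam => mx_velocity Gam *m x) (in_tuple s).
  have wE : \sum_i z i *: (vbasis W)`_i =
      \sum_(j < size s) coord T j (\sum_i z i *: (vbasis W)`_i) *: T`_j.
    exact: coord_span.
  pose u j := if insub j is Some i then coord T i (\sum_i z i *: (vbasis W)`_i) else 0.
  have uE (i : 'I_(size s)) : u i = coord T i (\sum_i z i *: (vbasis W)`_i).
    by rewrite /u valK.
  pose c := act_curves_line s u x.
  have c0 i : (c i 0).[0] = x i 0.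
    rewrite act_curves_lineE.
    rewrite (_ : (fun j => 0 * u j) = fun=> 0) ?act_curves0 //.
    by apply/funext => k; rewrite mul0r.
  have vel i : (c i 0)^`().[0] = (\sum_i z i *: (vbasis W)`_i) i 0.
    rewrite act_curves_line_deriv // [in RHS]wE; congr (fun_of_matrix _ _ _).
    apply: eq_bigr => j _; rewrite uE (nth_map 0) ?size_tuple //.
  have along_f i : (along (fun l => c l 0) (f i)).[0] = 0.
    rewrite horner_along.
    have fx := fE i x; rewrite subrr /co linear0 in fx; rewrite -[RHS]fx; apply: meval_ext => l.
    exact: c0.
  have /choice[b bP] : forall i, exists b, along (fun l => c l 0) (f i) = 'X * b /\
      b.[0] = z i.
    move=> i; have [b bE b0] := poly_root0 (along_f i); exists b; split=> //.
    rewrite b0 deriv_along horner_sum.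
    transitivity (differential (f i) x (\sum_i z i *: (vbasis W)`_i)).
      apply: eq_bigr => l _; rewrite hornerM vel; congr (_ * _).
      by rewrite horner_along; apply: meval_ext => k; exact: c0.
    have dfE v : differential (f i) x v = co i v.
      rewrite (differential_comb x v (enum 'I_N) (fun l => co i (delta_mx l 0))
        (fun l => mpolyX K (mnm1 l) - mpolyC N (x l 0))) big_enum /= [in RHS](matrix_sum_delta v) /co linear_sum.
      apply: eq_bigr => l _; rewrite big_ord1 linearZ /= mulrC; congr (_ * _).
      by rewrite differentialD differentialXi -mpolyCN differentialC addr0.
    rewrite dfE /co linear_sum (bigD1 i) //= linearZ /= coord_free ?(basis_free (vbasisP W)) //.
    rewrite eqxx mulr1 big1 ?addr0 // => j ji.
    by rewrite linearZ /= coord_free ?(basis_free (vbasisP W)) // (negbTE ji) mulr0.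
  have -> : meval z qs = meval (fun i => (b i).[0]) qs.
    by apply: meval_ext => i; rewrite (bP i).2.
  apply: low; rewrite (_ : (fun i => _) = fun i => along (fun l => c l 0) (f i)); last first.
    by apply/funext => i; rewrite expr1 (bP i).1.
  pose Q : {poly K} := \prod_(i < size s) (u i *: 'X + 1).
  apply: (@poly_eq0_generic _ Q).
    rewrite prodf_seq_neq0; apply/allP => i _ /=; apply: contraTneq (oner_neq0 K) => /(congr1 (horner^~ 0)).
    by rewrite !hornerE => ->; rewrite eqxx.
  move=> e; rewrite horner_prod prodf_seq_neq0 => /allP Qe.
  rewrite -along_mpcomp horner_along.
  rewrite (_ : meval _ _ = peval (mpcomp f q) (act_curves s (fun j => e * u j) x)); last first.
    by apply: meval_ext => l; rewrite act_curves_lineE.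
  rewrite peval_mpcomp; apply: qO; exists (fun j => e * u j) => // j js.
  have := Qe (Ordinal js) (mem_index_enum _); rewrite /= !hornerE mulrC.
  by apply: contraNneq => ->; rewrite addNr.
Qed.

End Dominance.

(** * Constructible images *)

Section Constructible.
Variables (K : closedFieldType) (N : nat).
Import GRing.

Definition env (y : 'cV[K]_N) : seq K := [seq y i 0 | i <- enum 'I_N].

Lemma env_nth y (i : 'I_N) : nth 0 (env y) i = y i 0.
Proof. by rewrite (nth_map i) ?size_enum_ord // nth_ord_enum. Qed.

Lemma size_env y : size (env y) = N.
Proof. by rewrite size_map size_enum_ord. Qed.

Definition poly_term (p : {poly K}) (k : nat) : term K :=
  foldr (fun c (t : term K) => (t * 'X_k + c%:T)%T) (0%:R)%T p.

Lemma eval_poly_term e p k : eval e (poly_term p k) = p.[e`_k].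
Proof.
rewrite /poly_term /horner; elim: (p : seq K) => [|c r IH] //=.
by rewrite IH.
Qed.

Lemma rterm_poly_term p k : rterm (poly_term p k).
Proof. by rewrite /poly_term; elim: (p : seq K) => [|c r IH] //=; rewrite IH. Qed.

Definition sum_term (s : seq (term K)) : term K := foldr (@Add K) (0%:R)%T s.

Lemma eval_sum_term e s : eval e (sum_term s) = \sum_(t <- s) eval e t.
Proof. by elim: s => [|t s IH] /=; rewrite ?big_nil ?big_cons ?IH. Qed.

Lemma rterm_sum_term s : all (@rterm K) s -> rterm (sum_term s).
Proof. by elim: s => //= t s IH /andP[-> /IH ->]. Qed.

Definition and_form (s : seq (formula K)) : formula K := foldr (@And K) (Bool true) s.

Lemma holds_and_form (T : eqType) e (s : seq T) (f : T -> formula K) :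
  holds e (and_form (map f s)) <-> forall x, x \in s -> holds e (f x).
Proof.
elim: s => [|y s IH] /=; first by split.
split=> [[fy /IH fs] x|h]; first by rewrite inE => /predU1P[->|/fs].
by split; [apply: h; rewrite mem_head|apply/IH => x xs; apply: h; rewrite inE xs orbT].
Qed.

Lemma rformula_and_form (T : eqType) (s : seq T) (f : T -> formula K) :
  (forall x, rformula (f x)) -> rformula (and_form (map f s)).
Proof. by move=> h; elim: s => //= y s ->; rewrite h. Qed.

Fixpoint act_term (s : seq 'M[{poly K}]_N) (k : nat) (x : 'cV[K]_N) (i : 'I_N) : term K :=
  if s is Gam :: s' then
    sum_term [seq (poly_term (Gam i j) k * act_term s' k.+1 x j)%T | j <- enum 'I_N]
  else Const (x i 0).

Lemma rterm_act_term s k x i : rterm (act_term s k x i).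
Proof.
elim: s k i => //= Gam s IH k i; apply: rterm_sum_term; rewrite all_map; apply/allP => j _ /=.
by rewrite rterm_poly_term IH.
Qed.

End Constructible.

Section Generic.
Variables (K : numClosedFieldType) (N : nat).
Local Notation V := 'cV[K]_N.
Implicit Types (x y : V) (Y : set V).

Lemma eval_act_term e (s : seq 'M[{poly K}]_N) k x i :
  GRing.eval e (act_term s k x i) = act_curves s (fun j => e`_(k + j)) x i 0.
Proof.
elim: s k i => //= Gam s IH k i.
rewrite eval_sum_term big_map big_enum /= mxE; apply: eq_bigr => j _.
rewrite eval_poly_term IH mxE addn0; congr (_ * act_curves _ _ _ _ _).
by apply/funext => l; rewrite addSnnS.
Qed.

(** The formula asserts the existence of the parameters, numbered from N on; the
    variables below N are the coordinates of the point. *)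
Lemma act_curves_definable (s : seq 'M[{poly K}]_N) x : exists f : GRing.formula K,
  GRing.rformula f /\ forall y, GRing.holds (env y) f <->
    exists2 t : nat -> K, (forall i, (i < size s)%N -> t i != -1) & y = act_curves s t x.
Proof.
pose f := GRing.And
  (and_form [seq GRing.Equal (GRing.Var K i) (act_term s N x i) | i : 'I_N <- enum 'I_N])
  (and_form [seq GRing.Not (GRing.Equal (GRing.Var K (N + j)) (GRing.Const (-1)))
     | j <- iota 0 (size s)]).
exists (foldr (@GRing.Exists K) f (iota N (size s))); split.
  have rf : GRing.rformula f.
    rewrite /f /= !rformula_and_form // => i /=; exact: rterm_act_term.
  by elim: (iota _ _).
move=> y; rewrite -GRing.foldExistsP; split.
  move=> [e ye [/holds_and_form fy /holds_and_form ft]].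
  exists (fun j => e`_(N + j)).
    by move=> j js; apply/eqP; apply: (ft j); rewrite mem_iota.
  apply/matrixP => i j; rewrite ord1 -eval_act_term -(fy i (mem_enum _ _)) /=.
  by rewrite -ye ?env_nth // !inE mem_iota leqNgt ltn_ord.
move=> [t ht yE]; exists (env y ++ mkseq t (size s)).
  move=> i; rewrite !inE mem_iota negb_and -ltnNge -leqNgt nth_cat size_env.
  move=> /orP[->//|si]; rewrite nth_default ?size_env; last by apply: leq_trans si; exact: leq_addr.
  case: ltnP => Ni; first by have := leq_trans (leq_addr _ _) si; rewrite leqNgt Ni.
  by rewrite nth_default // size_mkseq -(leq_add2l N) subnKC.
have nt j : (j < size s)%N -> (env y ++ mkseq t (size s))`_(N + j) = t j.
  by move=> js; rewrite nth_cat size_env ltnNge leq_addr /= addKn nth_mkseq.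
split.
  apply/holds_and_form => i _ /=; rewrite eval_act_term nth_cat size_env ltn_ord env_nth {1}yE.
  congr (fun_of_matrix _ _ _).
  have ext s' t1 t2 : (forall j, (j < size s')%N -> t1 j = t2 j) ->
      act_curves s' t1 x = act_curves s' t2 x.
    elim: s' t1 t2 => //= Gam s' IH t1 t2 h; rewrite h //; congr (_ *m _).
    by apply: IH => j js; apply: h.
  by apply: ext => j js; rewrite nt.
apply/holds_and_form => j; rewrite mem_iota add0n => /= js; rewrite nt //.
exact/eqP/ht.
Qed.

Lemma eval_mpoly (t : GRing.term K) : GRing.rterm t ->
  exists p : mpoly N K, forall y, GRing.eval (env y) t = peval p y.
Proof.
elim: t => //=.
- move=> i _; have [iN|Ni] := ltnP i N.
    exists (mpolyX K (mnm1 (Ordinal iN))) => y.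
    by rewrite pevalX -env_nth.
  by exists 0 => y; rewrite peval0 nth_default // size_env.
- by move=> c _; exists (mpolyC N c) => y; rewrite pevalC.
- by move=> k _; exists (mpolyC N k%:R) => y; rewrite pevalC.
- move=> t1 IH1 t2 IH2 /andP[/IH1[p1 h1] /IH2[p2 h2]].
  by exists (p1 + p2) => y; rewrite pevalD h1 h2.
- by move=> t1 IH1 /IH1[p1 h1]; exists (- p1) => y; rewrite /peval mevalN h1.
- by move=> t1 IH1 k /IH1[p1 h1]; exists (p1 *+ k) => y; rewrite /peval mevalMn h1.
- move=> t1 IH1 t2 IH2 /andP[/IH1[p1 h1] /IH2[p2 h2]].
  by exists (p1 * p2) => y; rewrite pevalM h1 h2.
- by move=> t1 IH1 k /IH1[p1 h1]; exists (p1 ^+ k) => y; rewrite /peval rmorphXn /= h1.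
Qed.

(** An equation that does not hold on all of an irreducible variety fails on a
    nonempty open subset, and boolean combinations only require intersecting
    finitely many such subsets. *)
Lemma generic_truth Y (f : GRing.formula K) : prime_locus Y ->
  GRing.qf_form f && GRing.rformula f ->
  exists D, ~ vanishing_ideal Y D /\ exists b : bool,
    forall y, Y y -> peval D y != 0 -> GRing.qf_eval (env y) f = b.
Proof.
move=> prY.
have n1 : ~ vanishing_ideal Y 1.
  have [x Yx] := prY.1.
  by move=> /(_ x Yx); rewrite peval1 => /eqP; rewrite oner_eq0.
have two (f1 f2 : GRing.formula K) (op : bool -> bool -> bool) :
  (exists D, ~ vanishing_ideal Y D /\ exists b : bool,
     forall y, Y y -> peval D y != 0 -> GRing.qf_eval (env y) f1 = b) ->
  (exists D, ~ vanishing_ideal Y D /\ exists b : bool,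
     forall y, Y y -> peval D y != 0 -> GRing.qf_eval (env y) f2 = b) ->
  exists D, ~ vanishing_ideal Y D /\ exists b : bool,
     forall y, Y y -> peval D y != 0 ->
       op (GRing.qf_eval (env y) f1) (GRing.qf_eval (env y) f2) = b.
  move=> [D1 [n1' [b1 h1]]] [D2 [n2 [b2 h2]]]; exists (D1 * D2); split.
    by move=> /prY.2[].
  exists (op b1 b2) => y Yy; rewrite pevalM mulf_eq0 negb_or => /andP[y1 y2].
  by rewrite h1 // h2.
elim: f => //=.
- by move=> b _; exists 1; split=> //; exists b.
- move=> t1 t2 /andP[/eval_mpoly[p1 h1] /eval_mpoly[p2 h2]].
  have [pI|pI] := pselect (vanishing_ideal Y (p1 - p2)).
    exists 1; split=> //; exists true => y Yy _; apply/eqP.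
    by rewrite h1 h2; apply/eqP; rewrite -subr_eq0 -(pI y Yy) /peval mevalB.
  exists (p1 - p2); split=> //; exists false => y Yy.
  by rewrite /peval mevalB -!/(peval _ _) subr_eq0 -h1 -h2 => /negbTE.

- by move=> f1 IH1 f2 IH2 /andP[/andP[q1 q2] /andP[r1 r2]];
    apply: (two f1 f2 andb); [apply: IH1; rewrite q1|apply: IH2; rewrite q2].
- by move=> f1 IH1 f2 IH2 /andP[/andP[q1 q2] /andP[r1 r2]];
    apply: (two f1 f2 orb); [apply: IH1; rewrite q1|apply: IH2; rewrite q2].
- by move=> f1 IH1 f2 IH2 /andP[/andP[q1 q2] /andP[r1 r2]];
    apply: (two f1 f2 implb); [apply: IH1; rewrite q1|apply: IH2; rewrite q2].
move=> f1 IH1 /IH1[D [nD [b h]]]; exists D; split=> //; exists (~~ b) => y Yy Dy.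
by rewrite h.
Qed.

(** By quantifier elimination membership in the image is generically true or
    generically false on Y, and density excludes the latter. *)
Lemma act_curves_open Y (s : seq 'M[{poly K}]_N) x : prime_locus Y ->
  (forall t : nat -> K, (forall i, (i < size s)%N -> t i != -1) -> Y (act_curves s t x)) ->
  (forall p, (forall t : nat -> K, (forall i, (i < size s)%N -> t i != -1) ->
     peval p (act_curves s t x) = 0) -> vanishing_ideal Y p) ->
  exists D, ~ vanishing_ideal Y D /\ forall y, Y y -> peval D y != 0 ->
    exists2 t : nat -> K, (forall i, (i < size s)%N -> t i != -1) & y = act_curves s t x.
Proof.
move=> prY sY dense; have [f [rf fP]] := act_curves_definable s x.
have qeP e := GRing.quantifier_elim_rformP (@ClosedFieldQE.wf_ex_elim K)
  (@ClosedFieldQE.holds_ex_elim K (@solve_monicpoly K)) e rf.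
have [D [nD [b bP]]] := generic_truth prY
  (GRing.quantifier_elim_wf (@ClosedFieldQE.wf_ex_elim K) rf).
exists D; split=> // y Yy Dy; apply/fP/qeP; rewrite bP //.
apply: contrapT => /negP/negbTE nb; apply: nD; apply: dense => t ht.
apply/eqP; apply: contraT => Dt.
have := bP _ (sY t ht) Dt; rewrite nb => /negbT/qeP.
by case; apply/fP; exists t.
Qed.

End Generic.

(** * The orbit of a smooth point *)

Section Orbits.
Variables (K : numClosedFieldType) (N : nat) (cexp : K -> K).
Local Notation V := 'cV[K]_N.
Variables (Om : 'M[K]_N) (X : set {vspace V}) (G : set 'M[K]_N).
Hypothesis expK : exponential cexp.
Hypothesis symOm : symplectic_form Om.
Hypothesis irrX : irreducible_in (@proj_closed K N) X.
Hypothesis legX : legendrian Om X.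
Hypothesis genX : generated_by_quadrics X.
Hypothesis lieG : connected_lie_subgroup (hamiltonian Om X) G.
Local Notation Y := (affine_cone X).
Local Notation h := (hamiltonian Om X).

Lemma hamiltonianZ a M : h M -> h (a *: M).
Proof. by move=> hM; rewrite -[_ *: _]addr0; apply: hamiltonian_lin => //; exact: hamiltonian0. Qed.

Lemma exp_in_group M : h M -> G (expmx M).
Proof. exact: (exp_lie_group expK hamiltonianZ lieG). Qed.

Lemma group_preserves g : G g -> preserves_quadrics X g.
Proof.
move=> Gg.
suff [] : preserves_quadrics X g /\ forall g', g' *m g = 1%:M -> preserves_quadrics X g' by [].
move: g Gg; apply: (lie_group_ind expK (hamiltonian0 Om X) lieG).
- move=> M hM; split=> [|g' g'M]; first exact: (expmx_preserves expK symOm irrX legX genX).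
  have -> : g' = expmx (- M).
    by rewrite -[LHS]mulmx1 -(mulmx1C (expmxV expK M)) mulmxA g'M mul1mx.
  apply: (expmx_preserves expK symOm irrX legX genX).
  by rewrite -scaleN1r; apply: hamiltonianZ.
- have comp g1 g2 : preserves_quadrics X g1 -> preserves_quadrics X g2 ->
      preserves_quadrics X (g1 *m g2).
    by move=> p1 p2 B qB; rewrite trmx_mul -!mulmxA [g1^T *m _]mulmxA !mulmxA -!(mulmxA g2^T) mulmxA;
       apply: p2; apply: p1.
  move=> g1 g2 [p1 i1] [p2 i2]; split=> [|g' g'g]; first exact: comp.
  have g1g : g1 *m (g2 *m g') = 1%:M by rewrite mulmxA; apply: mulmx1C.
  have -> : g' = (g' *m g1) *m (g2 *m g') by rewrite -mulmxA g1g mulmx1.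
  by apply: comp; [apply: i2; rewrite -mulmxA|apply: i1; apply: mulmx1C].
move=> g g' [pg ig] g'g; split; first exact: ig.
move=> g2 g2g'; have -> // : g2 = g.
by rewrite -[g2]mulmx1 -g'g mulmxA g2g' mul1mx.
Qed.

Lemma cone_quadrics v : Y v <-> forall B, quadrics X B -> bilin B v v = 0.
Proof.
split=> [Yv B [_ qB]|qv]; first exact: qB.
have clY : zariski_closed Y by case: (cone_irreducible irrX).
apply: (closed_zeros clY) => p pI; have [k [a [f [fq ->]]]] := genX pI.
elim/big_rec: _ => [|i q _ IH]; first exact: peval0.
rewrite pevalD IH addr0 pevalM; have [B sB fB] := homog2_quadratic (fq i).2.
rewrite fB peval_quadratic_poly qv ?mulr0 //.
by apply/(quadrics_part X sB); rewrite -fB.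
Qed.

Lemma group_cone g v : G g -> Y v -> Y (g *m v).
Proof.
move=> Gg /cone_quadrics qv; apply/cone_quadrics => B qB.
by rewrite bilin_mull bilin_mulr; apply: qv; apply: group_preserves.
Qed.

Lemma group_tangent g x v : G g -> Y x -> tangent_space Y x v ->
  tangent_space Y (g *m x) (g *m v).
Proof.
move=> Gg Yx /(tangent_quadrics _ genX Yx) Tv.
apply/(tangent_quadrics _ genX (group_cone Gg Yx)) => B qB.
by rewrite bilin_mull bilin_mulr; apply: Tv; apply: group_preserves.
Qed.

Lemma local_dimension_unique x y d1 d2 : Y x -> Y y ->
  local_dimension Y x d1 -> local_dimension Y y d2 -> d1 = d2.
Proof.
have irrY := cone_irreducible irrX.
have [d [_ _ ld _]] := generic_smooth irrY.
have uniq z e : Y z -> local_dimension Y z e -> e = d.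
  move=> Yz [ie me]; have [id md] := ld z Yz.
  by apply/eqP; rewrite eqn_leq md // me.
by move=> Yx Yy /(uniq _ _ Yx) -> /(uniq _ _ Yy) ->.
Qed.

Lemma group_smooth g x : G g -> smooth_at Y x -> smooth_at Y (g *m x).
Proof.
move=> Gg [Yx [W [WT dimW]]]; have Ygx := group_cone Gg Yx; split=> //.
have [g' Gg' g'g] := lie_groupV lieG Gg.
have gg' := mulmx1C g'g.
pose L := linfun (mulmx g : V -> V).
exists (L @: W)%VS; split.
  apply/seteqP; split=> v /=.
    move=> /memv_imgP[w wW ->]; rewrite lfunE /=; apply: group_tangent => //.
    by rewrite -WT.
  move=> Tv; have -> : v = L (g' *m v) by rewrite lfunE /= mulmxA gg' mul1mx.
  apply: memv_img; have := group_tangent Gg' Ygx Tv.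
  by rewrite mulmxA g'g mul1mx -WT.
have dimLW : \dim (L @: W) = \dim W.
  apply: limg_dim_eq; apply/eqP; rewrite -subv0; apply/subvP => w.
  rewrite memv_cap memv_ker lfunE /= => /andP[_ /eqP gw].
  by rewrite memv0 -[w]mul1mx -g'g -mulmxA gw mulmx0.
rewrite dimLW; have [d [_ _ ld _]] := generic_smooth (cone_irreducible irrX).
by rewrite (local_dimension_unique Yx Ygx dimW (ld _ Ygx)); apply: ld.
Qed.

Lemma nilpotent_curve P m : h P -> P ^+ m = 0 ->
  exists2 Gam, group_curve G Gam & mx_velocity Gam = P.
Proof.
move=> hP Pm; pose Gam : 'M[{poly K}]_N := \matrix_(i, j) \poly_(k < m.+2) dpow P k i j.
have at_c c : mx_at Gam c = expmx (c *: P).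
  have [s [E [m' [P' [_ eM]]]]] := expmx_scale expK P.
  have pr0 : projectors [:: 0 : K] (fun=> 1%:M : 'M[K]_N).
    split=> // [|x y]; first by rewrite big_seq1.
    by rewrite !inE => /eqP -> /eqP ->; rewrite eqxx mulmx1.
  have := @expmx_jordan _ _ _ _ (fun=> 0) (fun=> 1) m.+2 (c *: P) pr0.
  rewrite (spectral1 pr0) /spectral big_seq1 scale0r add0r => ->.
  - rewrite mul1mx; apply/matrixP => i j; rewrite !mxE horner_poly /expnil summxE.
    by apply: eq_bigr => k _; rewrite dpowZ [RHS]mxE mulrC.
  - by move=> x; rewrite mul1mx mulmx1.
  - by rewrite expr_scalemx !exprS Pm !mulr0 scaler0.
  - by move=> x; exact: expsum0.
exists Gam; last first.
  apply/matrixP => i j; rewrite !mxE horner_coef0 coef_deriv coef_poly /= mulr1n.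
  by rewrite /dpow factS fact0 invr1 scale1r expr1.
split=> [|c _]; first by rewrite at_c scale0r (expmx0 _ expK).
exists 1, (expmx (c *: P)); rewrite oner_eq0 scale1r; split=> //.
by apply: exp_in_group; apply: hamiltonianZ.
Qed.

(** The parameter is 1 + c = cexp t; the factor (1 + c) ^+ c0 makes all exponents
    nonnegative. *)
Lemma toral_curve s (E : K -> 'M[K]_N) (z : K -> int) : projectors s E ->
  h (spectral s E (fun x => (z x)%:~R)) ->
  exists Gam c, group_curve G Gam /\
    mx_velocity Gam = spectral s E (fun x => (z x)%:~R) + c%:M.
Proof.
move=> prE hD; have [e0 eD eS eC _] := expK.
pose c0 : nat := (\sum_(x <- s) absz (z x))%N; pose n x := absz (z x + c0%:Z).
have nE x : x \in s -> (n x)%:R = (z x)%:~R + c0%:R :> K.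
  move=> xs; rewrite -[c0%:R]/((c0%:Z)%:~R) -rmorphD /= -[(n x)%:R]/((n x)%:Z%:~R).
  congr (_%:~R); rewrite /n.
  have : (absz (z x) <= c0)%N by rewrite /c0 (big_rem x) //= leq_addr.
  by lia.
pose Gam : 'M[{poly K}]_N := \matrix_(i, j) \sum_(x <- s) (E x i j) *: (1 + 'X) ^+ n x.
have at_c c : mx_at Gam c = spectral s E (fun x => (1 + c) ^+ n x).
  apply/matrixP => i j; rewrite !mxE horner_sum /spectral. rewrite summxE.
  by apply: eq_bigr => x _; rewrite !hornerE mxE mulrC.
exists Gam, c0%:R; split; last first.
  apply/matrixP => i j; rewrite !mxE (raddf_sum (@deriv K)) /= horner_sum.
  transitivity ((\sum_(x <- s) (n x)%:R *: E x) i j).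
    rewrite summxE; apply: eq_bigr => x _.
    rewrite derivZ deriv_exp derivD derivC derivX add0r mul1r.
    by rewrite !hornerE hornerMn horner_exp !hornerE expr1n mxE mulrC.
  have -> : \sum_(x <- s) (n x)%:R *: E x =
      spectral s E (fun x => (z x)%:~R) + c0%:R%:M.
    rewrite -scalemx1 -(spectral1 prE) /spectral scaler_sumr -big_split /=.
    rewrite big_seq [RHS]big_seq; apply: eq_bigr => x xs.
    by rewrite nE // scalerDl scale1r.
  by rewrite !mxE.
split=> [|c c1].
  by rewrite at_c -(spectral1 prE); apply: eq_spectral => x _; rewrite addr0 expr1n.
have [|t tc] := eS (1 + c); first by rewrite addrC -[1]opprK subr_eq0.
have eX k : cexp t ^+ k = cexp (k%:R * t).
  elim: k => [|k IH]; first by rewrite mul0r e0.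
  by rewrite exprS IH -eD -natr1 mulrDl mul1r addrC.
have en0 y : cexp y != 0.
  apply/eqP => ey; have := eD y (- y); rewrite subrr e0 ey mul0r.
  by move/eqP; rewrite oner_eq0.
exists (cexp (c0%:R * t)), (expmx (t *: spectral s E (fun x => (z x)%:~R))).
split=> //; first by apply: exp_in_group; apply: hamiltonianZ.
have -> : t *: spectral s E (fun x => (z x)%:~R) = spectral s E (fun x => (z x)%:~R * t) + 0.
  by rewrite addr0 /spectral scaler_sumr; apply: eq_bigr => x _; rewrite scalerA mulrC.
rewrite (expmx_jordan (e := fun x => cexp ((z x)%:~R * t)) (m := 1) prE) //; last first.
  by move=> x; rewrite mulmx0 mul0mx.
rewrite /expnil big_ord1 dpow0 mulmx1 at_c /spectral scaler_sumr.
rewrite big_seq [RHS]big_seq; apply: eq_bigr => x xs.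
by rewrite -tc eX nE // mulrDl eD scalerA mulrC.
Qed.

Lemma scaling_curve : exists2 Gam, group_curve G Gam & mx_velocity Gam = 1%:M.
Proof.
pose Gam : 'M[{poly K}]_N := (1 + 'X)%:M.
have at_c c : mx_at Gam c = (1 + c)%:M.
  by apply/matrixP => i j; rewrite !mxE hornerMn !hornerE.
exists Gam; last first.
  by apply/matrixP => i j; rewrite !mxE derivMn hornerMn derivD derivC derivX !hornerE.
split=> [|c c1]; first by rewrite at_c addr0.
exists (1 + c), 1%:M; split; first by rewrite addrC -[1]opprK subr_eq0.
  exact: (lie_group1 lieG).
by rewrite at_c scalemx1.
Qed.

(** The scaling curve compensates for the scalars added to the velocities of the
    toral curves. *)
Lemma velocity_span (x : V) M : h M -> exists s : seq 'M[{poly K}]_N,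
  (forall Gam, Gam \in s -> group_curve G Gam) /\
  M *m x \in <<[seq mx_velocity Gam *m x | Gam <- s]>>%VS.
Proof.
move=> hM; have [s0 [E [m [P jM]]]] := jordan_exists M.
have [_ _ _ _ [_ Pm]] := jM.
have [r [b [z [hP hD ->]]]] := hamiltonian_decomp symOm irrX legX genX hM jM.
have [Gam1 c1 v1] := scaling_curve; have [GamP cP vP] := nilpotent_curve hP Pm.
have /choice[c] : forall j, exists c, exists Gam, group_curve G Gam /\
    mx_velocity Gam = spectral s0 E (fun x => (z x j)%:~R) + c%:M.
  by move=> j; have [Gam [c h']] := toral_curve (jordan_projectors jM) (hD j); exists c, Gam.
move=> /choice[Gam GamP'].
exists (Gam1 :: GamP :: [seq Gam j | j <- enum 'I_r]); split.
  move=> Gam'; rewrite !inE => /or3P[/eqP->|/eqP->|/mapP[j _ ->]] //.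
  exact: (GamP' j).1.
set U := <<_>>%VS.
have xU : x \in U by rewrite -[x]mul1mx -v1; apply: memv_span; rewrite /= inE eqxx.
rewrite mulmxDl mulmx_suml; apply: memvD; last first.
  by rewrite -vP; apply: memv_span; rewrite /= !inE eqxx orbT.
apply: memv_suml => j _; rewrite -scalemxAl; apply: memvZ.
have -> : spectral s0 E (fun x => (z x j)%:~R) *m x = mx_velocity (Gam j) *m x - c j *: x.
  by rewrite (GamP' j).2 mulmxDl mul_scalar_mx addrK.
apply: memvB; last exact: memvZ.
apply: memv_span; rewrite /= !inE; apply/orP; right; apply/orP; right.
by rewrite -map_comp; apply/mapP; exists j; rewrite ?mem_enum.
Qed.

Lemma tangent_curves x (W : {vspace V}) : smooth_at Y x -> x != 0 ->
  [set` W] = tangent_space Y x -> exists s : seq 'M[{poly K}]_N,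
  (forall Gam, Gam \in s -> group_curve G Gam) /\
  (W <= <<[seq mx_velocity Gam *m x | Gam <- s]>>)%VS.
Proof.
move=> sx x0 WT.
suff [s [cs ss]] : exists s : seq 'M[{poly K}]_N,
    (forall Gam, Gam \in s -> group_curve G Gam) /\
    forall v, v \in (vbasis W : seq V) -> v \in <<[seq mx_velocity Gam *m x | Gam <- s]>>%VS.
  exists s; split=> //; have /andP[/eqP <- _] := vbasisP W.
  exact/span_subvP.
have : {subset (vbasis W : seq V) <= W} by move=> v; exact: vbasis_mem.
elim: (vbasis W : seq V) => [|v l IH] lW; first by exists [::].
have [s1 [cs1 ss1]] := IH (fun u ul => lW u (mem_behead (s := v :: l) ul)).
have : tangent_space Y x v by rewrite -WT; apply: lW; exact: mem_head.
move=> /(tangent_hamiltonian symOm legX genX v sx x0)[M hM vE].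
have [s2 [cs2 ss2]] := velocity_span x hM.
exists (s1 ++ s2); split.
  by move=> Gam; rewrite mem_cat => /orP[/cs1|/cs2].
move=> u; rewrite map_cat span_cat inE => /predU1P[->|/ss1 us1].
  by rewrite vE; apply: (subvP (addvSr _ _)).
exact: (subvP (addvSl _ _)).
Qed.

(** A product of curves whose velocities at x span the tangent space is dominant,
    and its image lies in the cone over the orbit. *)
Lemma orbit_contains_open x : smooth_at Y x -> x != 0 ->
  exists D, ~ vanishing_ideal Y D /\ forall y, Y y -> peval D y != 0 ->
    exists a g, [/\ a != 0, G g & y = a *: (g *m x)].
Proof.
move=> sx x0; have [Yx [W [WT dimW]]] := sx; have irrY := cone_irreducible irrX.
have [s [cs Ws]] := tangent_curves sx x0 WT.
have orb := act_curves_orbit x (lie_group1 lieG) (lie_groupM lieG) cs.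
have sY (t : nat -> K) : (forall i, (i < size s)%N -> t i != -1) -> Y (act_curves s t x).
  by move=> /orb[a [g [_ Gg ->]]]; apply: affine_cone_scale; apply: group_cone.
have [D [nD Dy]] := act_curves_open (irreducible_prime irrY) sY
  (fun p => act_curves_dominant irrY Yx dimW (fun Gam Gs => (cs Gam Gs).1) Ws sY).
by exists D; split=> // y Yy /(Dy y Yy)[t /orb ht ->].
Qed.

Lemma vline_scale (a : K) (v : V) : a != 0 -> (<[a *: v]> = <[v]>)%VS.
Proof.
move=> a0; apply/eqP; rewrite eqEsubv -!memvE memvZ ?memv_line //=.
by rewrite -[v in v \in _](scalerK a0) memvZ // memv_line.
Qed.

Lemma proj_act_line g (v : V) : proj_act g <[v]>%VS = <[g *m v]>%VS.
Proof. by rewrite /proj_act limg_line lfunE. Qed.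

(** Two nonempty open subsets of an irreducible cone meet, so the orbits of any two
    smooth points coincide. *)
Theorem smooth_locus_orbit : exists2 L, X L & smooth_locus X = orbit_of G L.
Proof.
have [clX _ _] := irrX; have prY := irreducible_prime (cone_irreducible irrX).
have [D [/nvanishing[x Yx Dx] Dsm]] := smooth_dense irrX.
have [sx x0] := Dsm x Yx Dx; exists <[x]>%VS; first exact/(affine_cone_line clX x0).
apply/seteqP; split=> L.
  move=> [XL [y [yL y0 sy]]]; rewrite (memv_line_dim1 (proj_closed_dim clX XL) yL y0).
  have [D1 [n1 D1P]] := orbit_contains_open sx x0.
  have [D2 [n2 D2P]] := orbit_contains_open sy y0.
  have /nvanishing[w Yw] : ~ vanishing_ideal Y (D1 * D2) by move=> /prY.2[].
  rewrite pevalM mulf_eq0 negb_or => /andP[/(D1P w Yw)[a [g [a0 Gg wx]]]].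
  move=> /(D2P w Yw)[b [k [b0 Gk wy]]].
  have [k' Gk' k'k] := lie_groupV lieG Gk.
  exists (k' *m g); first exact: (lie_groupM lieG).
  rewrite proj_act_line -(vline_scale _ a0) -mulmxA scalemxAr -wx wy.
  by rewrite -scalemxAr mulmxA k'k mul1mx vline_scale.
move=> [g Gg <-]; rewrite proj_act_line.
have gx0 : g *m x != 0.
  have [g' _ g'g] := lie_groupV lieG Gg; apply: contraNneq x0 => gx.
  by rewrite -[x]mul1mx -g'g -mulmxA gx mulmx0.
have sgx := group_smooth Gg sx; split.
  by apply/(affine_cone_line clX gx0); exact: sgx.1.
by exists (g *m x); rewrite memv_line.
Qed.

End Orbits.

Theorem corollary6p8 (R : realType) (n : nat)
    (Om : 'M[R[i]]_(n + n)) (Om_symplectic : symplectic_form Om)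
    (X : set {vspace 'cV[R[i]]_(n + n)})
    (X_irreducible : irreducible_in (@proj_closed _ _) X)
    (X_legendrian : legendrian Om X)
    (X_quadrics : generated_by_quadrics X)
    (S : 'M[R[i]]_(n + n)) (S_basis : symplectic_basis Om S)
    (G : set 'M[R[i]]_(n + n)) (G_Sp : G `<=` symplectic_group Om)
    (G_lie : connected_lie_subgroup (rho_quadratic_part S X) G) :
  exists2 L, X L & smooth_locus X = orbit_of G L.
Proof.
move: G_lie; rewrite (rho_hamiltonian X S_basis) => G_lie.
exact: (@smooth_locus_orbit (R[i]) (n + n) (@cexp R) Om X G (cexp_exponential R)).
Qed.
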